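(* Suppose that an $m$-linear singular integral operator of convolution type $T$ with kernel $K$ is bounded from $L^{q_1}\times\cdots\times L^{q_m}$ to $L^2$ with norm at most $B$ for all $(q_1,\ldots,q_m)\in\Lambda_2$. Suppose that $K$ satisfies the coordinate-type Hörmander condition with finite constant $A$: $$\sum_{k=1}^m\int_{\Gamma_x^k}\big|K(y_1,\ldots,y_{k-1},y_k-x,y_{k+1},\ldots,y_m)-K(y_1,\ldots,y_m)\big|\,dy_1\cdots dy_m\le A\qquad\text{for all }x\in\mathbb R^n .$$ Then there is a constant $C$ depending only on $n$ and $m$ such that $$\|T(f_1,\ldots,f_m)\|_{BMO}\le C(A+B)\|f_1\|_{L^\infty}\cdots\|f_m\|_{L^\infty}$$ for all $f_1,\ldots,f_m\in L^\infty_c$. Moreover, $T$ has a bounded extension which satisfies $$\|T(f_1,\ldots,f_m)\|_{L^{1,\infty}}\le C(A+B)\|f_i\|_{L^1}\prod_{\substack{k=1\\k\neq i}}^m\|f_k\|_{L^\infty}$$ for all $1\le i\le m$, $f_i\in L^1$, and $f_k\in L^\infty_c$ for $k\ne i$.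
   Context: All function spaces are over $\mathbb R^n$; $L^\infty_c$ is the space of compactly supported bounded functions. $\Lambda_p=\{(p,\infty,\ldots,\infty),(\infty,p,\infty,\ldots,\infty),\ldots,(\infty,\ldots,\infty,p)\}$ is the set of $m$-tuples with one entry equal to $p$ and the other $m-1$ entries equal to $\infty$. For $x\in\mathbb R^n$ and $1\le k\le m$, $\Gamma^k_x=\{(y_1,\ldots,y_m)\in\mathbb R^{mn}:|y_k|>2|x|\}$. The kernel $K$ is a locally integrable function on $\mathbb R^{mn}\setminus\{0\}$. That $T$ is an $m$-linear singular integral operator of convolution type with kernel $K$ means that $T$ is $m$-linear and $$T(f_1,\ldots,f_m)(x)=\int_{\mathbb R^{mn}}K(x-y_1,\ldots,x-y_m)f_1(y_1)\cdots f_m(y_m)\,dy_1\cdots dy_m$$ for $f_1,\ldots,f_m\in L^\infty_c$ and $x\notin\bigcap_{i=1}^m\operatorname{supp}f_i$. $\|g\|_{BMO}=\sup_Q\inf_{c}\frac1{|Q|}\int_Q|g-c|\,dx$ (supremum over cubes $Q$; up to equivalence), and $\|g\|_{L^{1,\infty}}=\sup_{\lambda>0}\lambda|\{|g|>\lambda\}|$. *)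

(* Defs.v *)
From HB Require Import structures.
From mathcomp Require Import all_boot all_order all_algebra.
From mathcomp Require Import all_classical all_reals all_analysis.
From mathcomp Require Import complex.
Import Order.TTheory GRing.Theory Num.Theory.
Import numFieldNormedType.Exports.
Import ComplexField.Normc.

Set Implicit Arguments.
Unset Strict Implicit.
Unset Printing Implicit Defensive.

Local Open Scope classical_set_scope.
Local Open Scope ring_scope.

Section pushforward_sigma_finite.
Context d1 d2 (T1 : measurableType d1) (T2 : measurableType d2) (R : realType).
Variables (f : T1 -> T2) (g : T2 -> T1).
Hypotheses (mf : measurable_fun setT f) (mg : measurable_fun setT g).
Hypothesis fK : cancel f g.
Variable mu : {sigma_finite_measure set T1 -> \bar R}.

(* pushforward along f; the measurable left inverse g makes it sigma-finite *)
Definition pushforward_sf of measurable_fun setT f & measurable_fun setT g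
  & cancel f g : set T2 -> \bar R := pushforward mu f.

Local Notation nu := (pushforward_sf mf mg fK).

Let nu0 : nu set0 = 0%E.
Proof. by rewrite /pushforward_sf /pushforward preimage_set0 measure0. Qed.

Let nu_ge0 A : (0 <= nu A)%E.
Proof. exact: measure_ge0. Qed.

Let nu_sigma_additive : semi_sigma_additive nu.
Proof.
by move=> F mF tF mUF; have := @measure_semi_sigma_additive _ _ _
  (pushforward mu f : {measure set T2 -> \bar R}) F mF tF mUF; apply.
Qed.

HB.instance Definition _ := isMeasure.Build _ _ _ nu
  nu0 nu_ge0 nu_sigma_additive.

Let nu_sigma_finite : sigma_finite setT nu.
Proof.
have [F FT mF] := sigma_finiteT mu.
exists (fun k => g @^-1` F k) => [|k].
  by rewrite -preimage_bigcup -FT preimage_setT.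
have [mFk Fkoo] := mF k; split.
  by rewrite -[X in measurable X]setTI; exact: mg.
rewrite /pushforward_sf /pushforward -comp_preimage.
by rewrite (_ : g \o f = id)// funeqE => x; exact: fK.
Qed.

HB.instance Definition _ := Measure_isSigmaFinite.Build _ _ _ nu
  nu_sigma_finite.

End pushforward_sigma_finite.

Section product_sigma_finite.
Context d1 d2 (T1 : measurableType d1) (T2 : measurableType d2) (R : realType).
Variables (mu1 : {sigma_finite_measure set T1 -> \bar R})
          (mu2 : {sigma_finite_measure set T2 -> \bar R}).

(* alias of mu1 \x mu2 for which {sigma_finite_measure _} is inferred *)
Definition product_sf : set (T1 * T2) -> \bar R := (mu1 \x mu2)%E.

HB.instance Definition _ := Measure.on product_sf.

Let product_sf_sigma_finite : sigma_finite setT product_sf.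
Proof.
have /sigma_finiteP[F [FT ndF Foo]] := sigma_finiteT mu1.
have /sigma_finiteP[G [GT ndG Goo]] := sigma_finiteT mu2.
exists (fun k => F k `*` G k) => [|k].
  rewrite -setXTT FT GT predeqE => -[x y]; split.
    move=> [/= [i _ Fix] [j _ Gjy]]; exists (maxn i j) => //; split.
    - by move: x Fix; exact/subsetPset/ndF/leq_maxl.
    - by move: y Gjy; exact/subsetPset/ndG/leq_maxr.
  by move=> [i _ []/= ? ?]; split; exists i.
have [mFk Fk] := Foo k; have [mGk Gk] := Goo k; split; first exact: measurableX.
by rewrite /product_sf product_measure1E// lte_mul_pinfty// ge0_fin_numE.
Qed.

HB.instance Definition _ := Measure_isSigmaFinite.Build _ _ _ product_sf
  product_sf_sigma_finite.

End product_sigma_finite.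

Section tuple_measure.
Context d (T : measurableType d) (R : realType).

Definition tcons n (x : T * n.-tuple T) : n.+1.-tuple T := [tuple of x.1 :: x.2].

Definition tuncons n (t : n.+1.-tuple T) : T * n.-tuple T :=
  (thead t, [tuple of behead t]).

Lemma measurable_tcons n : measurable_fun setT (@tcons n).
Proof. exact: measurable_cons. Qed.

Lemma measurable_tuncons n : measurable_fun setT (@tuncons n).
Proof.
apply/measurable_fun_pairP; split; last exact: measurable_behead.
exact: measurable_tnth.
Qed.

Lemma tconsK n : cancel (@tcons n) (@tuncons n).
Proof. by move=> [x t]; congr pair; apply: val_inj. Qed.

(* the n-fold product measure of mu with itself *)
Fixpoint tuple_measure (mu : {sigma_finite_measure set T -> \bar R}) (n : nat) :
    {sigma_finite_measure set (n.-tuple T) -> \bar R} :=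
  match n with
  | 0%N => \d_([tuple] : 0.-tuple T)
  | k.+1 => pushforward_sf (product_sf mu (tuple_measure mu k))
      (@measurable_tcons k) (@measurable_tuncons k) (@tconsK k)
  end.

End tuple_measure.

Section matrix_measure.
Context (R : realType) (m n : nat).

Definition tuple_of_mx (A : 'M[R]_(m, n)) :
    m.-tuple (n.-tuple (measurableTypeR R)) :=
  [tuple [tuple A i j | j < n] | i < m].

Definition mx_of_tuple (t : m.-tuple (n.-tuple (measurableTypeR R))) :
    'M[R]_(m, n) :=
  \matrix_(i, j) tnth (tnth t i) j.

Lemma tuple_of_mxK : cancel tuple_of_mx mx_of_tuple.
Proof. by move=> A; apply/matrixP => i j; rewrite mxE !tnth_mktuple. Qed.

Lemma mx_of_tupleK : cancel mx_of_tuple tuple_of_mx.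
Proof.
move=> t; apply: eq_from_tnth => i; apply: eq_from_tnth => j.
by rewrite !tnth_mktuple mxE.
Qed.

(* Matrices carry the sigma-algebra generated by the entries, i.e. the Borel
   sigma-algebra of their topology. *)
HB.instance Definition _ := @isMeasurable.Build (preimage_display tuple_of_mx)
  'M[R]_(m, n) (g_sigma_algebra_preimage tuple_of_mx)
  (@measurable0 _ (g_sigma_algebra_preimageType tuple_of_mx))
  (@measurableC _ (g_sigma_algebra_preimageType tuple_of_mx))
  (fun F => @bigcupT_measurable _ (g_sigma_algebra_preimageType tuple_of_mx) F).

Lemma measurable_tuple_of_mx : measurable_fun setT tuple_of_mx.
Proof. by move=> _ B mB; exists B. Qed.

Lemma measurable_mx_of_tuple : measurable_fun setT mx_of_tuple.
Proof.
move=> _ _ [B mB <-]; rewrite !setTI -comp_preimage.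
rewrite (_ : tuple_of_mx \o mx_of_tuple = id)// funeqE => t.
exact: mx_of_tupleK.
Qed.

End matrix_measure.

(* Lebesgue measure on 'M[R]_(m, n) = R^(m * n); R^n is 'rV[R]_n = 'M_(1, n). *)
Definition lebesgue_mx (R : realType) (m n : nat) :
    {sigma_finite_measure set 'M[R]_(m, n) -> \bar R} :=
  pushforward_sf (tuple_measure (tuple_measure (@lebesgue_measure R) n) m)
    (@measurable_mx_of_tuple R m n) (@measurable_tuple_of_mx R m n)
    (@mx_of_tupleK R m n).

Section complex_functions.
Context d (T : measurableType d) (R : realType).
Variable mu : {measure set T -> \bar R}.
Implicit Types (D : set T) (f : T -> R[i]).

Definition cmeasurable D f :=
  measurable_fun D (fun x => complex.Re (f x)) /\
  measurable_fun D (fun x => complex.Im (f x)).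

(* Re and Im parts are integrated separately; meaningful for integrable f *)
Definition cintegral D f : R[i] :=
  Complex (\int[mu]_(x in D) complex.Re (f x))%R
          (\int[mu]_(x in D) complex.Im (f x))%R.

Definition cLnorm (p : \bar R) f : \bar R :=
  Lnorm mu p (fun x => (normc (f x))%:E).

Definition cLp (p : \bar R) : set (T -> R[i]) :=
  [set f | cmeasurable setT f /\ (cLnorm p f < +oo)%E].

Definition weakL1norm f : \bar R :=
  ereal_sup [set (l%:E * mu [set x | (l < normc (f x))%R])%E
            | l in [set l : R | 0 < l]].

End complex_functions.

Section Rn.
Context (R : realType) (n : nat).
Implicit Types (x : 'rV[R]_n) (f : 'rV[R]_n -> R[i]).

Local Notation leb := (lebesgue_mx R 1 n).

(* the norm supplied by the library on 'rV[R]_n is the sup norm *)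
Definition enorm x : R := Num.sqrt (\sum_(j < n) x 0 j ^+ 2).

(* topological support of the representative f *)
Definition supp f : set 'rV[R]_n := closure [set x | f x != 0].

Definition Linfc : set ('rV[R]_n -> R[i]) :=
  [set f | cLp leb +oo%E f /\ compact (supp f)].

Definition cube (a : 'rV[R]_n) (l : R) : set 'rV[R]_n :=
  [set x | forall j, a 0 j <= x 0 j <= a 0 j + l].

Definition mean_osc f (Q : set 'rV[R]_n) : \bar R :=
  ereal_inf [set ((fine (leb Q))^-1%:E *
                  \int[leb]_(x in Q) (normc (f x - c))%:E)%E | c in [set: R[i]]].

Definition BMOnorm f : \bar R :=
  ereal_sup [set e | exists (a : 'rV[R]_n) (l : R), 0 < l /\ e = mean_osc f (cube a l)].

End Rn.

Section multilinear.
Context (R : realType) (m n : nat).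

Local Notation F := ('rV[R]_n -> R[i]).
Local Notation leb := (lebesgue_mx R 1 n).

(* Operators act on representatives, so linearity is an a.e. identity.
   dfwith f g is f with its i-th entry replaced by g. *)
Definition multilinear_operator (D : 'I_m -> set F) (T : ('I_m -> F) -> F) :=
  (forall f : 'I_m -> F, (forall j, D j (f j)) -> cmeasurable setT (T f)) /\
  (forall (i : 'I_m) (f : 'I_m -> F) (a : R[i]) (g h : F),
    (forall j, D j (f j)) -> D i g -> D i h ->
    T (@dfwith _ (fun=> F) f i (fun x => a * g x + h x)) =
    (fun x => a * T (@dfwith _ (fun=> F) f i g) x +
              T (@dfwith _ (fun=> F) f i h) x) %[ae leb]).

(* Points of R^(mn) are m x n matrices, row i being y_i. *)
Definition sub_rows (x : 'rV[R]_n) (y : 'M[R]_(m, n)) : 'M[R]_(m, n) :=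
  \matrix_(i, j) (x 0 j - y i j).

Definition shift_row (k : 'I_m) (x : 'rV[R]_n) (y : 'M[R]_(m, n)) :
    'M[R]_(m, n) :=
  \matrix_(i, j) (if i == k then y i j - x 0 j else y i j).

Definition locally_integrable_off0 (K : 'M[R]_(m, n) -> R[i]) :=
  cmeasurable (~` [set (0 : 'M[R]_(m, n))]) K /\
  forall S : set 'M[R]_(m, n), S `<=` ~` [set 0] -> compact S ->
    (\int[lebesgue_mx R m n]_(y in S) (normc (K y))%:E < +oo)%E.

Definition singular_integral (K : 'M[R]_(m, n) -> R[i])
    (T : ('I_m -> F) -> F) :=
  multilinear_operator (fun=> @Linfc R n) T /\
  forall f : 'I_m -> F, (forall i, Linfc (f i)) ->
    \forall x \ae leb, ~ (\bigcap_i supp (f i)) x ->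
      T f x = cintegral (lebesgue_mx R m n) setT
        (fun y => K (sub_rows x y) * \prod_(i < m) f i (row i y)).

(* exponent tuples with one entry p and all the others +oo *)
Definition Lambda (p : \bar R) : set ('I_m -> \bar R) :=
  [set q | exists k, q = fun i => if i == k then p else +oo%E].

(* The a priori estimate on tuples in Linfc, where T is defined. *)
Definition bounded_by (B : R) (q : 'I_m -> \bar R) (r : \bar R)
    (T : ('I_m -> F) -> F) :=
  forall f : 'I_m -> F, (forall i, Linfc (f i)) ->
    (cLnorm leb r (T f) <= B%:E * \prod_(i < m) cLnorm leb (q i) (f i))%E.

Definition Gamma (k : 'I_m) (x : 'rV[R]_n) : set 'M[R]_(m, n) :=
  [set y | 2 * enorm x < enorm (row k y)].

Definition coord_Hormander (K : 'M[R]_(m, n) -> R[i]) (A : R) :=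
  forall x : 'rV[R]_n,
    (\sum_(k < m) \int[lebesgue_mx R m n]_(y in Gamma k x)
        (normc (K (shift_row k x y) - K y))%:E <= A%:E)%E.

(* one factor in L^1, at position i, the others bounded with compact support *)
Definition L1_Linfc (i : 'I_m) : 'I_m -> set F :=
  fun j => if j == i then cLp leb 1 else @Linfc R n.

End multilinear.

(* Main.v *)
Require Import Defs.
From HB Require Import structures.
From mathcomp Require Import all_boot all_order all_algebra.
From mathcomp Require Import all_classical all_reals all_analysis.
From mathcomp Require Import measurable_realfun ess_sup_inf complex.
From mathcomp Require Import zify ring lra.
Import Order.TTheory GRing.Theory Num.Theory.
Import numFieldNormedType.Exports.
Import ComplexField.Normc.

Set Implicit Arguments.
Unset Strict Implicit.
Unset Printing Implicit Defensive.

Local Open Scope classical_set_scope.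
Local Open Scope ring_scope.

Local Notation Re := (@complex.Re _).
Local Notation Im := (@complex.Im _).

(** Bounded functions: on a cube Q telescope [T f - T g], where [g] is [f] restricted outside
    a dilate of Q, into terms having one factor supported near Q, controlled by the L^2 bound;
    the remaining [T g] differs on Q from its value at a corner by at most a multiple of [A],
    since moving [x] one coordinate of [K] at a time is what the coordinate-type condition
    controls.

    Weak type (1,1): for a dyadic step function in the i-th slot the Calderon-Zygmund
    decomposition is a finite sum, so no convergence of [T] along the bad part is needed. Off
    the dilated cube, an atom of mean zero lets one replace [y_i] by a fixed point of its cube;
    after integration in [x], a measure preserving change of variables turns the error into
    the i-th term of the coordinate-type condition. Step functions are L^1-dense among bounded
    functions with support in a cube, boundedly, so the L^2 bound transfers the estimate to
    [Linfc]; the extension to L^1 is an almost everywhere limit along a fast approximating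
    sequence. *)

(** [T] agrees with the kernel integral only almost everywhere and off the common support, and [K]
    is known to be integrable only on compact sets away from 0. Each use of [K] therefore needs one
    factor separated from [x] by a definite margin, which the dilated cubes provide. The product of
    [A + B] with the norms may vanish, although heights and levels are divided by it. The estimates
    are proved for every positive majorant [M] of it, and the infimum over [M] is taken last. [T]
    acts on representatives. Factors are first truncated so as to be bounded everywhere by their
    norm; the L^2 bound shows that this changes [T f] only on a null set. *)

Section tuple_integral.
Context d (T : measurableType d) (R : realType).
Variable mu : {sigma_finite_measure set T -> \bar R}.
Local Open Scope ereal_scope.

Lemma integral_tuple0 (F : 0.-tuple T -> \bar R) :
  measurable_fun setT F ->
  \int[tuple_measure mu 0]_t F t = F [tuple].
Proof. by move=> mF; rewrite integral_dirac// diracT mul1e. Qed.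

Lemma integral_tupleS k (F : k.+1.-tuple T -> \bar R) :
  measurable_fun setT F -> (forall t, 0 <= F t) ->
  \int[tuple_measure mu k.+1]_t F t =
  \int[mu]_x \int[tuple_measure mu k]_t F (tcons (x, t)).
Proof.
move=> mF F0.
transitivity (\int[pushforward (mu \x tuple_measure mu k) (@tcons _ T k)]_t F t).
  by [].
rewrite ge0_integral_pushforward//; last exact: measurable_tcons.
rewrite preimage_setT fubini_tonelli1//=; last first.
  by apply: measurableT_comp => //; exact: measurable_tcons.
Qed.

End tuple_integral.

(** * Changes of variables on product spaces *)

Section tuple_moves.
Context d (T : measurableType d) (R : realType).
Variable mu : {sigma_finite_measure set T -> \bar R}.
Local Open Scope ereal_scope.
Local Notation tm := (tuple_measure mu).

Definition tset k (i : 'I_k) (x : T) (t : k.-tuple T) : k.-tuple T :=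
  [tuple if j == i then x else tnth t j | j < k].

Definition tmap k (phi : 'I_k -> T -> T) (t : k.-tuple T) : k.-tuple T :=
  [tuple phi j (tnth t j) | j < k].

Lemma tnth_tconsS k x (t : k.-tuple T) j :
  tnth (tcons (x, t)) (lift ord0 j) = tnth t j.
Proof. by rewrite /tcons tnthS. Qed.

Lemma tset_tcons0 k x h (t : k.-tuple T) : tset ord0 x (tcons (h, t)) = tcons (x, t).
Proof.
apply: eq_from_tnth => j; rewrite tnth_mktuple.
by case: (unliftP ord0 j) => [j'|] -> //; rewrite !tnth_tconsS.
Qed.

Lemma tset_tconsS k x h (t : k.-tuple T) i :
  tset (lift ord0 i) x (tcons (h, t)) = tcons (h, tset i x t).
Proof.
apply: eq_from_tnth => j; rewrite tnth_mktuple.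
case: (unliftP ord0 j) => [j'|] -> //.
by rewrite !tnth_tconsS tnth_mktuple (inj_eq lift_inj).
Qed.

Lemma tmap_tcons k (phi : 'I_k.+1 -> T -> T) h (t : k.-tuple T) :
  tmap phi (tcons (h, t)) =
  tcons (phi ord0 h, tmap (fun j => phi (lift ord0 j)) t).
Proof.
apply: eq_from_tnth => j; rewrite tnth_mktuple.
case: (unliftP ord0 j) => [j'|] -> //.
by rewrite !tnth_tconsS tnth_mktuple.
Qed.

Lemma measurable_tset k (i : 'I_k) :
  measurable_fun setT (fun z : T * k.-tuple T => tset i z.1 z.2).
Proof.
apply/measurable_fun_tnthP => j.
rewrite (_ : _ \o _ = fun z => if j == i then z.1 else tnth z.2 j); last first.
  by apply/funext => z /=; rewrite tnth_mktuple.
case: (j == i); first exact: measurable_fst.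
exact: (measurableT_comp (measurable_tnth j) measurable_snd).
Qed.

Lemma measurable_tmap k (phi : 'I_k -> T -> T) :
  (forall j, measurable_fun setT (phi j)) -> measurable_fun setT (tmap phi).
Proof.
move=> mphi; apply/measurable_fun_tnthP => j.
rewrite (_ : _ \o _ = phi j \o (@tnth _ _ ^~ j)); last first.
  by apply/funext => z /=; rewrite tnth_mktuple.
exact: (measurableT_comp (mphi j) (measurable_tnth j)).
Qed.

Lemma measurable_tcons2 d' (S : measurableType d') k (f : S -> T) (g : S -> k.-tuple T) :
  measurable_fun setT f -> measurable_fun setT g ->
  measurable_fun setT (fun x => tcons (f x, g x)).
Proof. exact: measurable_cons. Qed.

(** Each entry is moved by its own [mu]-preserving map, so Tonelli reduces the claim to one
    coordinate at a time. *)
Lemma ge0_integral_tmap k (phi : 'I_k -> T -> T) (F : k.-tuple T -> \bar R) :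
  (forall j, measurable_fun setT (phi j)) ->
  (forall j A, measurable A -> mu (phi j @^-1` A) = mu A) ->
  measurable_fun setT F -> (forall t, 0 <= F t) ->
  \int[tm k]_t F (tmap phi t) = \int[tm k]_t F t.
Proof.
move=> mphi mu_phi; elim: k phi mphi mu_phi F => [|k ih] phi mphi mu_phi F mF F0.
  by apply: eq_integral => t _; rewrite (tuple0 t) [tmap _ _]tuple0.
have mFt x : measurable_fun setT (fun t : k.-tuple T => F (tcons (x, t))).
  by apply: measurableT_comp => //; exact: measurable_tcons2.
rewrite !integral_tupleS//; last first.
  exact: (measurableT_comp mF (measurable_tmap mphi)).
under eq_integral.
  move=> x _; under eq_integral do rewrite tmap_tcons.
  rewrite (ih (fun j => phi (lift ord0 j)) _ _ (fun t => F (tcons (phi ord0 x, t))))//;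
    last by move=> j A; exact: mu_phi.
  over.
rewrite /=.
have mG : measurable_fun setT (fun x => \int[tm k]_t F (tcons (x, t))).
  apply: (measurable_fun_fubini_tonelli_F (fun z => F (tcons z))) => //.
  by apply: measurableT_comp => //; exact: measurable_tcons.
transitivity (\int[pushforward mu (phi ord0)]_x \int[tm k]_t F (tcons (x, t))).
  by rewrite ge0_integral_pushforward// => y _; exact: integral_ge0.

by apply: eq_measure_integral => A mA _; exact: mu_phi.
Qed.

(** A transposition of coordinates preserves a product measure. When [i] is the head this is Tonelli
    for the two outer integrals; otherwise the induction hypothesis is applied under the integral in
    the head. *)
Lemma ge0_integral_tswap k (i : 'I_k) (F : T * k.-tuple T -> \bar R) :
  measurable_fun setT F -> (forall z, 0 <= F z) ->
  \int[mu]_x \int[tm k]_t F (x, t) =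
  \int[mu]_x \int[tm k]_t F (tnth t i, tset i x t).
Proof.
elim: k i F => [[]//|k ih] i F mF F0.
have mtc : measurable_fun setT (fun z : (T * T) * k.-tuple T =>
    (z.1.1, tcons (z.1.2, z.2))).
  apply: measurable_fun_pair.
    exact: (measurableT_comp measurable_fst measurable_fst).
  apply: measurable_tcons2; last exact: measurable_snd.
  exact: (measurableT_comp measurable_snd measurable_fst).
have mswap : measurable_fun setT
    (fun z : T * k.+1.-tuple T => (tnth z.2 i, tset i z.1 z.2)).
  apply: measurable_fun_pair; last exact: measurable_tset.
  exact: (measurableT_comp (measurable_tnth i) measurable_snd).
have mG : measurable_fun setT
    (fun z => \int[tm k]_t F (z.1, tcons (z.2, t))).
  apply: (measurable_fun_fubini_tonelli_F
    (fun z : (T * T) * k.-tuple T => F (z.1.1, tcons (z.1.2, z.2)))) => //.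
  exact: (measurableT_comp mF mtc).
have G0 z : 0 <= \int[tm k]_t F (z.1, tcons (z.2, t)) by exact: integral_ge0.
under eq_integral.
  move=> x _; rewrite integral_tupleS//; last exact: measurableT_comp.
  over.
under [RHS]eq_integral.
  move=> x _; rewrite integral_tupleS//; last first.
    apply: (measurableT_comp mF).
    exact: (measurableT_comp mswap (measurable_pair1 _)).
  over.
rewrite /= (fubini_tonelli _ mG G0)/=.
case: (unliftP ord0 i) => [j|] ->.
- under [LHS]eq_integral.
    move=> h _; rewrite (ih j (fun z => F (z.1, tcons (h, z.2))))//; last first.
      apply: (measurableT_comp mF); apply: measurable_fun_pair => //.
      exact: measurable_tcons2.
    over.
  rewrite /=.
  under [RHS]eq_integral.
    move=> x _; under eq_integral.
      move=> h _; under eq_integral do rewrite tnth_tconsS tset_tconsS.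
      over.
    over.
  rewrite /=.
  apply: (fubini_tonelli (fun z => \int[tm k]_t F (tnth t j, tcons (z.1, tset j z.2 t)))).
    apply: (measurable_fun_fubini_tonelli_F
      (fun z : (T * T) * k.-tuple T => F (tnth z.2 j, tcons (z.1.1, tset j z.1.2 z.2)))) => //.
    apply: (measurableT_comp mF); apply: measurable_fun_pair.
      exact: (measurableT_comp (measurable_tnth j) measurable_snd).
    apply: measurable_tcons2.
      exact: (measurableT_comp measurable_fst measurable_fst).
    have mg : measurable_fun setT (fun z : (T * T) * k.-tuple T => (z.1.2, z.2)).
      apply: measurable_fun_pair; last exact: measurable_snd.
      exact: (measurableT_comp measurable_snd measurable_fst).
    exact: (measurableT_comp (measurable_tset j) mg).
  by move=> z; exact: integral_ge0.
- apply: eq_integral => x _; apply: eq_integral => h _; apply: eq_integral => t _.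
  by rewrite tset_tcons0.
Qed.

End tuple_moves.

(** * Measurability and integration in matrix variables *)

Section matrix_measurability.
Context (R : realType) (m n : nat).

Lemma measurable_entry (i : 'I_m) (j : 'I_n) :
  measurable_fun setT (fun Y : 'M[R]_(m, n) => Y i j).
Proof.
rewrite (_ : (fun Y => _) =
    (fun t => tnth t j) \o ((fun t => tnth t i) \o @tuple_of_mx R m n)); last first.
  by apply/funext => Y /=; rewrite !tnth_mktuple.
apply: (measurableT_comp (@measurable_tnth _ (measurableTypeR R) n j)).
apply: (measurableT_comp (measurable_tnth i)).
exact: measurable_tuple_of_mx.
Qed.

Lemma measurable_mx d (S : measurableType d) (f : S -> 'M[R]_(m, n)) :
  (forall i j, measurable_fun setT (fun s => f s i j)) -> measurable_fun setT f.
Proof.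
move=> mf _ _ [B mB <-]; rewrite !setTI -comp_preimage.
have : measurable_fun setT (@tuple_of_mx R m n \o f).
  apply/measurable_fun_tnthP => i; apply/measurable_fun_tnthP => j.
  rewrite [X in measurable_fun _ X](_ : _ = fun s => f s i j); first exact: mf.
  by apply/funext => s /=; rewrite !tnth_mktuple.
by move=> /(_ measurableT _ mB); rewrite setTI.
Qed.

End matrix_measurability.

Section matrix_integral.
Context (R : realType) (m n : nat).
Local Open Scope ereal_scope.
Local Notation lebt k := (tuple_measure (@lebesgue_measure R) k).
Local Notation lebM := (lebesgue_mx R m n).

Lemma ge0_integral_mx (F : 'M[R]_(m, n) -> \bar R) :
  measurable_fun setT F -> (forall Y, 0 <= F Y) ->
  \int[lebM]_Y F Y =
  \int[tuple_measure (lebt n) m]_t F (mx_of_tuple t).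
Proof.
move=> mF F0.
transitivity (\int[pushforward (tuple_measure (lebt n) m) (@mx_of_tuple R m n)]_Y F Y).
  by [].
by rewrite ge0_integral_pushforward//; exact: measurable_mx_of_tuple.
Qed.

End matrix_integral.

Section row_integral.
Context (R : realType) (n : nat).
Local Open Scope ereal_scope.
Local Notation lebt k := (tuple_measure (@lebesgue_measure R) k).

Definition row_of_tuple (t : n.-tuple (measurableTypeR R)) : 'rV[R]_n :=
  \row_j tnth t j.

Lemma measurable_row_of_tuple : measurable_fun setT row_of_tuple.
Proof.
apply: measurable_mx => i j; rewrite (_ : (fun _ => _) = fun t => tnth t j).
  exact: (@measurable_tnth _ (measurableTypeR R) n j).
by apply/funext => t; rewrite mxE.
Qed.

Lemma ge0_integral_row (F : 'rV[R]_n -> \bar R) :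
  measurable_fun setT F -> (forall Y, 0 <= F Y) ->
  \int[lebesgue_mx R 1 n]_y F y = \int[lebt n]_t F (row_of_tuple t).
Proof.
move=> mF F0; rewrite ge0_integral_mx//.
have mFm : measurable_fun setT (fun t : 1.-tuple (n.-tuple (measurableTypeR R)) =>
    F (mx_of_tuple t)).
  by apply: measurableT_comp => //; exact: measurable_mx_of_tuple.
rewrite (integral_tupleS _ mFm)//; apply: eq_integral => t _.
rewrite integral_tuple0.
  by congr F; apply/matrixP => i j; rewrite !mxE (ord1 i).
apply: (measurableT_comp mFm).
exact: measurable_tcons2.
Qed.

End row_integral.

(** * Reflections, translations and row exchanges of Lebesgue measure *)

Section lebesgue_moves.
Context (R : realType).

Lemma lebesgue_measureDr (w : R) (A : set (measurableTypeR R)) : measurable A ->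
  lebesgue_measure ((fun x => x + w) @^-1` A) = lebesgue_measure A.
Proof.
move=> mA; have mw : measurable_fun setT (fun x : measurableTypeR R => x + w : measurableTypeR R).
  exact: measurable_funD.
rewrite -[LHS]/(pushforward lebesgue_measure
  (fun x : measurableTypeR R => x + w : measurableTypeR R) A).
apply/esym/lebesgue_measure_unique => //= _ [[a b]] _ <-.
rewrite /pushforward /=.
rewrite (_ : _ @^-1` _ = `]a - w, b - w]%classic); last first.
  by apply/seteqP; split=> x /=; rewrite !in_itv/= ltrBlDr lerBrDr.
by rewrite !lebesgue_measure_itv/= !lte_fin ltrD2r; case: ifP => // _; rewrite -!EFinB;
  congr EFin; ring.
Qed.

Lemma lebesgue_measureBl (w : R) (A : set (measurableTypeR R)) : measurable A ->
  lebesgue_measure ((fun x => w - x) @^-1` A) = lebesgue_measure A.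
Proof.
move=> mA; rewrite -[RHS](lebesgue_measureDr w mA) -[RHS]lebesgue_measureN//.
  by congr lebesgue_measure; apply/seteqP; split => x /=; rewrite addrC.
rewrite -[X in measurable X]setTI.
by apply: measurable_funD => //; exact: measurable_id.
Qed.

End lebesgue_moves.

Section matrix_moves.
Context (R : realType) (m n : nat).
Local Open Scope ereal_scope.
Local Notation lebM := (lebesgue_mx R m n).
Local Notation leb := (lebesgue_mx R 1 n).

(** Each row is either reflected through [W] or translated by it. One family thus covers the
    substitution [y -> x - y], translations of a single row, and mixtures where some row stays
    fixed. *)
Definition mx_move (s : 'I_m -> bool) (W : 'M[R]_(m, n)) (Y : 'M[R]_(m, n)) :
    'M[R]_(m, n) :=
  \matrix_(i, j) (if s i then W i j - Y i j else Y i j + W i j)%R.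

Definition rset (i : 'I_m) (x : 'rV[R]_n) (Y : 'M[R]_(m, n)) : 'M[R]_(m, n) :=
  \matrix_(k, j) if k == i then x 0%R j else Y k j.

Lemma row_rset i x Y : row i (rset i x Y) = x.
Proof. by apply/rowP => j; rewrite !mxE eqxx. Qed.

Lemma measurable_mx_move s W : measurable_fun setT (mx_move s W).
Proof.
apply: measurable_mx => i j.
rewrite (_ : (fun _ => _) = fun Y : 'M[R]_(m, n) => if s i then W i j - Y i j else Y i j + W i j)%R.
  by case: (s i); [apply: measurable_funB|apply: measurable_funD] => //; exact: measurable_entry.
by apply/funext => Y; rewrite mxE.
Qed.

Lemma measurable_row (i : 'I_m) : measurable_fun setT (fun Y : 'M[R]_(m, n) => row i Y).
Proof.
apply: measurable_mx => k j; rewrite (_ : (fun _ => _) = fun Y : 'M[R]_(m, n) => Y i j).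
  exact: measurable_entry.
by apply/funext => Y; rewrite mxE.
Qed.

Lemma measurable_rset d (S : measurableType d) i (f : S -> 'rV[R]_n) (g : S -> 'M[R]_(m, n)) :
  measurable_fun setT f -> measurable_fun setT g ->
  measurable_fun setT (fun s => rset i (f s) (g s)).
Proof.
move=> mf mg; apply: measurable_mx => k j.
rewrite (_ : (fun _ => _) = fun s => if k == i then f s 0%R j else g s k j); last first.
  by apply/funext => Y; rewrite mxE.
case: (k == i).
  exact: (measurableT_comp (measurable_entry 0%R j) mf).
exact: (measurableT_comp (measurable_entry k j) mg).
Qed.

Lemma ge0_integral_mx_move s W (F : 'M[R]_(m, n) -> \bar R) :
  measurable_fun setT F -> (forall Y, 0 <= F Y) ->
  \int[lebM]_Y F (mx_move s W Y) = \int[lebM]_Y F Y.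
Proof.
move=> mF F0; rewrite !ge0_integral_mx//; last first.
  exact: (measurableT_comp mF (measurable_mx_move s W)).
pose phi i := @tmap _ (measurableTypeR R) n
  (fun j x => if s i then W i j - x else x + W i j)%R.
have mphi1 i j : measurable_fun setT
    (fun x : measurableTypeR R => (if s i then W i j - x else x + W i j)%R : measurableTypeR R).
  by case: (s i); [apply: measurable_funB|apply: measurable_funD].
have mphi i : measurable_fun setT (phi i) by apply: measurable_tmap.
have mFm : measurable_fun setT
    (fun t : m.-tuple (n.-tuple (measurableTypeR R)) => F (mx_of_tuple t)).
  by apply: measurableT_comp => //; exact: measurable_mx_of_tuple.
rewrite -[RHS](@ge0_integral_tmap _ _ _ (tuple_measure (@lebesgue_measure R) n) m phi
  (fun t => F (mx_of_tuple t)))//.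
  apply: eq_integral => t _; congr F; apply/matrixP => i j.
  by rewrite !mxE !tnth_mktuple.
(* That a row map preserves the measure of R^n is the same statement one level down, for scalar
   entries and an indicator. *)
move=> i A mA.
have mI : measurable_fun setT (fun t => (\1_A t)%:E : \bar R).
  by apply/measurable_EFinP; exact: measurable_indic.
have mpA : measurable (phi i @^-1` A).
  by rewrite -[X in measurable X]setTI; exact: mphi.
rewrite -(setIT (phi i @^-1` A)) -[in RHS](setIT A) -!integral_indic//.
rewrite -[RHS](@ge0_integral_tmap _ _ _ (@lebesgue_measure R) n
  (fun j x => if s i then W i j - x else x + W i j)%R (fun t => (\1_A t)%:E))//.
by move=> j B mB; case: (s i); [exact: lebesgue_measureBl|exact: lebesgue_measureDr].
Qed.

(** It lets the output variable and [y_i] trade places, which converts an integral of [T] over its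
    output into an integral of the kernel over its [i]-th variable. *)
Lemma ge0_integral_rswap (i : 'I_m) (F : 'rV[R]_n * 'M[R]_(m, n) -> \bar R) :
  measurable_fun setT F -> (forall z, 0 <= F z) ->
  \int[leb]_x \int[lebM]_Y F (x, Y) =
  \int[leb]_x \int[lebM]_Y F (row i Y, rset i x Y).
Proof.
move=> mF F0.
pose G (z : n.-tuple (measurableTypeR R) * m.-tuple (n.-tuple (measurableTypeR R))) :=
  F (row_of_tuple z.1, mx_of_tuple z.2).
have mp : measurable_fun setT
    (fun z : n.-tuple (measurableTypeR R) * m.-tuple (n.-tuple (measurableTypeR R)) =>
    (row_of_tuple z.1, mx_of_tuple z.2)).
  apply: measurable_fun_pair.
    by apply: measurableT_comp; [exact: measurable_row_of_tuple|exact: measurable_fst].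
  by apply: measurableT_comp; [exact: measurable_mx_of_tuple|exact: measurable_snd].
have mG : measurable_fun setT G by exact: (measurableT_comp mF mp).
have ms : measurable_fun setT
    (fun z : 'rV[R]_n * 'M[R]_(m, n) => (row i z.2, rset i z.1 z.2)).
  apply: measurable_fun_pair; last exact: measurable_rset.
  exact: (measurableT_comp (measurable_row i) measurable_snd).
have dbl (H : 'rV[R]_n * 'M[R]_(m, n) -> \bar R) :
    measurable_fun setT H -> (forall z, 0 <= H z) ->
    \int[leb]_x \int[lebM]_Y H (x, Y) =
    \int[tuple_measure (@lebesgue_measure R) n]_x
      \int[tuple_measure (tuple_measure (@lebesgue_measure R) n) m]_t
        H (row_of_tuple x, mx_of_tuple t).
  move=> mH H0; rewrite ge0_integral_row.
  - apply: eq_integral => x _; rewrite ge0_integral_mx//.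
    exact: (measurableT_comp mH).
  - exact: (measurable_fun_fubini_tonelli_F H).
  - by move=> x; exact: integral_ge0.
rewrite dbl// (@ge0_integral_tswap _ _ _ (tuple_measure (@lebesgue_measure R) n) m i G)//.
rewrite (dbl (fun z => F (row i z.2, rset i z.1 z.2)))//; last first.
  exact: (measurableT_comp mF ms).
apply: eq_integral => x _; apply: eq_integral => t _ /=; rewrite /G /=; congr (F (_, _)).
  by apply/rowP => j; rewrite !mxE.
by apply/matrixP => k j; rewrite !mxE tnth_mktuple; case: (k == i).
by move=> z; exact: F0.
Qed.

End matrix_moves.

(** * Lebesgue measure of boxes and cubes *)

Section box_measure.
Local Open Scope ereal_scope.

Lemma tuple_measure_box d (T : measurableType d) (R : realType)
    (mu : {sigma_finite_measure set T -> \bar R}) k (I : 'I_k -> set T) :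
  (forall j, measurable (I j)) ->
  measurable [set t : k.-tuple T | forall j, I j (tnth t j)] /\
  tuple_measure mu k [set t : k.-tuple T | forall j, I j (tnth t j)] =
  \prod_(j < k) mu (I j).
Proof.
move=> mI; have mbox k' (I' : 'I_k' -> set T) : (forall j, measurable (I' j)) ->
    measurable [set t : k'.-tuple T | forall j, I' j (tnth t j)].
  move=> mI'; rewrite (_ : [set t | _] =
      \bigcap_(j in [set: 'I_k']) ((fun t : k'.-tuple T => tnth t j) @^-1` I' j)); last first.
    by apply/seteqP; split=> t /= h j; [move=> _|]; exact: h.
  apply: fin_bigcap_measurable; first exact: finite_finset.
  move=> j _; rewrite -[X in measurable X]setTI.
  by apply: measurable_tnth.
split; first exact: mbox.
elim: k I mI => [|k ih] I mI.
  rewrite big_ord0 (_ : [set _ | _] = setT).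
    by rewrite -[LHS]/(\d_([tuple] : 0.-tuple T) setT) diracT.
  by apply/seteqP; split=> // t _ [].
rewrite -[LHS]/((mu \x tuple_measure mu k) (@tcons _ T k @^-1` _)).
rewrite (_ : _ @^-1` _ = I ord0 `*`
  [set t : k.-tuple T | forall j, I (lift ord0 j) (tnth t j)]); last first.
  apply/seteqP; split => -[x t] /=.
    by move=> h; split=> [|j]; [exact: (h ord0)|have := h (lift ord0 j); rewrite tnth_tconsS].
  move=> [h0 h] j; case: (unliftP ord0 j) => [j'|] ->//.
  by rewrite tnth_tconsS.
rewrite product_measure1E//; last exact: (mbox _ (fun j => I (lift ord0 j)) (fun j => mI _)).
by rewrite big_ord_recl (ih (fun j => I (lift ord0 j))).
Qed.

End box_measure.

Section rows.
Context (R : realType) (n : nat).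
Local Open Scope ereal_scope.
Local Notation leb := (lebesgue_mx R 1 n).

Lemma measurable_box (I : 'I_n -> set R) : (forall j, measurable (I j : set (measurableTypeR R))) ->
  measurable [set x : 'rV[R]_n | forall j, I j (x 0%R j)].
Proof.
move=> mI; rewrite (_ : [set t | _] =
    \bigcap_(j in [set: 'I_n]) ((fun x : 'rV[R]_n => x 0%R j) @^-1` I j)); last first.
  by apply/seteqP; split=> t /= h j; [move=> _|]; exact: h.
apply: fin_bigcap_measurable; first exact: finite_finset.
by move=> j _; rewrite -[X in measurable X]setTI; apply: measurable_entry => //; exact: mI.
Qed.

Lemma lebesgue_box (I : 'I_n -> set R) : (forall j, measurable (I j : set (measurableTypeR R))) ->
  leb [set x : 'rV[R]_n | forall j, I j (x 0%R j)] =
  \prod_(j < n) lebesgue_measure (I j).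
Proof.
move=> mI; have mB := measurable_box mI.
rewrite -(setIT [set x | _]) -integral_indic//.
have mi : measurable_fun setT (fun x : 'rV[R]_n =>
    (\1_[set x : 'rV[R]_n | forall j, I j (x 0%R j)] x)%:E : \bar R).
  by apply/measurable_EFinP; exact: measurable_indic.
rewrite ge0_integral_row//.
have [mt <-] := tuple_measure_box (@lebesgue_measure R) mI.
rewrite -[in RHS](setIT [set t | _]) -integral_indic//.
apply: eq_integral => t _; congr (_%:E); rewrite !indicE; congr (nat_of_bool _)%:R.
apply/idP/idP => /set_mem h; apply/mem_set => j /=; have := h j; by rewrite /row_of_tuple mxE.
Qed.

Lemma measurable_cube (a : 'rV[R]_n) (l : R) : measurable (cube a l).
Proof.
rewrite (_ : cube a l = [set x : 'rV[R]_n | forall j,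
    [set` `[a 0%R j, a 0%R j + l]%R] (x 0%R j)]).
  by apply: (@measurable_box (fun j => [set` `[a 0%R j, a 0%R j + l]%R])) => j; exact: measurable_itv.
by apply/seteqP; split=> x h j; have := h j; rewrite /= in_itv.
Qed.

Lemma lebesgue_cube (a : 'rV[R]_n) (l : R) : (0 <= l)%R -> leb (cube a l) = (l ^+ n)%:E.
Proof.
move=> l0; rewrite (_ : cube a l = [set x : 'rV[R]_n | forall j,
    [set` `[a 0%R j, a 0%R j + l]%R] (x 0%R j)]); last first.
  by apply/seteqP; split=> x h j; have := h j; rewrite /= in_itv.
rewrite (@lebesgue_box (fun j => [set` `[a 0%R j, a 0%R j + l]%R])); last by move=> j; exact: measurable_itv.
under eq_bigr => j _.
  rewrite lebesgue_measure_itv/= lte_fin ltrDl -EFinB addrAC subrr add0r.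
  rewrite (_ : (if _ then _ else _) = l%:E); last first.
    by case: ltP => // l0'; apply/eqP; rewrite eqe eq_le l0 l0'.
  over.
by rewrite prodEFin prodr_const card_ord.
Qed.

(** Half-open, so that the dyadic children of a cube partition it exactly. *)
Definition hcube (a : 'rV[R]_n) (l : R) : set 'rV[R]_n :=
  [set x | forall j, a 0%R j <= x 0%R j < a 0%R j + l]%R.

Lemma measurable_hcube (a : 'rV[R]_n) (l : R) : measurable (hcube a l).
Proof.
rewrite (_ : hcube a l = [set x : 'rV[R]_n | forall j,
    [set` `[a 0%R j, a 0%R j + l[%R] (x 0%R j)]).
  by apply: (@measurable_box (fun j => [set` `[a 0%R j, a 0%R j + l[%R])) => j; exact: measurable_itv.
by apply/seteqP; split=> x h j; have := h j; rewrite /= in_itv.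
Qed.

Lemma lebesgue_hcube (a : 'rV[R]_n) (l : R) : (0 <= l)%R -> leb (hcube a l) = (l ^+ n)%:E.
Proof.
move=> l0; rewrite (_ : hcube a l = [set x : 'rV[R]_n | forall j,
    [set` `[a 0%R j, a 0%R j + l[%R] (x 0%R j)]); last first.
  by apply/seteqP; split=> x h j; have := h j; rewrite /= in_itv.
rewrite (@lebesgue_box (fun j => [set` `[a 0%R j, a 0%R j + l[%R])); last by move=> j; exact: measurable_itv.
under eq_bigr => j _.
  rewrite lebesgue_measure_itv/= lte_fin ltrDl -EFinB addrAC subrr add0r.
  rewrite (_ : (if _ then _ else _) = l%:E); last first.
    by case: ltP => // l0'; apply/eqP; rewrite eqe eq_le l0 l0'.
  over.
by rewrite prodEFin prodr_const card_ord.
Qed.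

End rows.

(** * Cancellation against a factor of mean zero *)

Lemma maxrM0 (R : realDomainType) (a b : R) :
  Num.max (a * b) 0 = Num.max a 0 * Num.max b 0 + Num.max (- a) 0 * Num.max (- b) 0.
Proof.
by rewrite /Num.max; case: ltP; case: (ltP a); case: (ltP b); case: (ltP (- a));
  case: (ltP (- b)); nra.
Qed.

Section zero_mean.
Context (R : realType) (m n : nat).
Local Open Scope ereal_scope.
Local Notation lebM := (lebesgue_mx R m n).
Local Notation leb := (lebesgue_mx R 1 n).

(* The row [i] is exchanged with a spare variable carrying the indicator of a unit cube. *)
Lemma ge0_integral_row_split (i : 'I_m) (b : 'rV[R]_n -> \bar R) (g : 'M[R]_(m, n) -> \bar R) :
  measurable_fun setT b -> (forall x, 0 <= b x) ->
  measurable_fun setT g -> (forall Y, 0 <= g Y) ->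
  (forall x Y, g (rset i x Y) = g Y) ->
  \int[lebM]_Y (b (row i Y) * g Y) =
  (\int[leb]_x b x) * \int[lebM]_Y ((\1_(hcube 0 1) (row i Y))%:E * g Y).
Proof.
move=> mb b0 mg g0 gi.
pose w x := (\1_(hcube (0 : 'rV[R]_n) 1) x)%:E : \bar R.
have mw : measurable_fun setT w.
  by apply/measurable_EFinP; exact: measurable_indic (measurable_hcube _ _).
have w0 x : 0 <= w x by rewrite lee_fin.
have mbr (h : 'rV[R]_n -> \bar R) : measurable_fun setT h ->
    measurable_fun setT (fun Y : 'M[R]_(m, n) => h (row i Y)).
  by move=> mh; exact: (measurableT_comp mh (measurable_row i)).
have w1 : \int[leb]_x w x = 1.
  rewrite integral_indic//; last exact: measurable_hcube.
  by rewrite setIT; have := @lebesgue_hcube R n 0%R 1%R ler01; rewrite expr1n.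
transitivity (\int[leb]_x \int[lebM]_Y (w x * (b (row i Y) * g Y))).
  under [RHS]eq_integral.
    move=> x _; rewrite ge0_integralZl//; first over.
    - by apply: emeasurable_funM => //; exact: mbr.
    - by move=> Y _; rewrite mule_ge0.
  rewrite /= ge0_integralZr// ?w1 ?mul1e//.
  by apply: integral_ge0 => Y _; rewrite mule_ge0.
rewrite (@ge0_integral_rswap _ _ _ i (fun z => w z.1 * (b (row i z.2) * g z.2)))/=; last 2 first.
- apply: emeasurable_funM; first exact: (measurableT_comp mw measurable_fst).
  by apply: emeasurable_funM;
    [exact: (measurableT_comp (mbr _ mb) measurable_snd)|exact: (measurableT_comp mg measurable_snd)].
- by move=> z; rewrite !mule_ge0.
under eq_integral.
  move=> x _; under eq_integral do rewrite row_rset gi muleCA.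
  rewrite ge0_integralZl//; first over.
  - by apply: emeasurable_funM => //; exact: mbr.
  - by move=> Y _; rewrite mule_ge0.
rewrite /= ge0_integralZr//.
by apply: integral_ge0 => Y _; rewrite mule_ge0.
Qed.

(** Integrability is known for the product but not for [g], so the argument stays with nonnegative
    functions. The positive and negative parts of the product are sums of products of parts of [b]
    and [g]; [b] has positive and negative parts of equal integral, so exchanging them turns one sum
    into the other. The common value is finite and cancels. *)
Lemma integral_row_zero_mean (i : 'I_m) (b : 'rV[R]_n -> R) (g : 'M[R]_(m, n) -> R) :
  leb.-integrable setT (EFin \o b) -> \int[leb]_x (b x)%:E = 0 ->
  measurable_fun setT g -> (forall x Y, g (rset i x Y) = g Y) ->
  lebM.-integrable setT (fun Y => (b (row i Y) * g Y)%:E) ->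
  \int[lebM]_Y (b (row i Y) * g Y)%:E = 0.
Proof.
move=> ib b0 mg gi ibg.
have mb : measurable_fun setT (EFin \o b) by exact: measurable_int ib.
have mbp : measurable_fun setT (EFin \o b)^\+ by exact: measurable_funepos.
have mbn : measurable_fun setT (EFin \o b)^\- by exact: measurable_funeneg.
have mgE : measurable_fun setT (EFin \o g) by apply/measurable_EFinP.
have mgp : measurable_fun setT (EFin \o g)^\+ by exact: measurable_funepos.
have mgn : measurable_fun setT (EFin \o g)^\- by exact: measurable_funeneg.
have bpn : \int[leb]_x (EFin \o b)^\+ x = \int[leb]_x (EFin \o b)^\- x.
  have fp : \int[leb]_x (EFin \o b)^\+ x \is a fin_num by exact: integrable_pos_fin_num.
  have fn : \int[leb]_x (EFin \o b)^\- x \is a fin_num by exact: integrable_neg_fin_num.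
  by move: b0; rewrite integralE => /eqP; rewrite sube_eq ?add0e// => /eqP.
have split (h : 'M[R]_(m, n) -> \bar R) : measurable_fun setT h -> (forall Y, 0 <= h Y) ->
    (forall x Y, h (rset i x Y) = h Y) ->
    \int[lebM]_Y ((EFin \o b)^\+ (row i Y) * h Y) = \int[lebM]_Y ((EFin \o b)^\- (row i Y) * h Y).
  by move=> mh h0 hi; rewrite !(@ge0_integral_row_split i)// bpn.
have mbr (h : 'rV[R]_n -> \bar R) : measurable_fun setT h ->
    measurable_fun setT (fun Y : 'M[R]_(m, n) => h (row i Y)).
  by move=> mh; exact: (measurableT_comp mh (measurable_row i)).
have pE Y : (EFin \o (fun Y => b (row i Y) * g Y)%R)^\+ Y =
    (EFin \o b)^\+ (row i Y) * (EFin \o g)^\+ Y + (EFin \o b)^\- (row i Y) * (EFin \o g)^\- Y.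
  rewrite !funeposE !funenegE /= -!EFin_max -!EFinM -EFinD; congr EFin.
  exact: maxrM0.
have nE Y : (EFin \o (fun Y => b (row i Y) * g Y)%R)^\- Y =
    (EFin \o b)^\+ (row i Y) * (EFin \o g)^\- Y + (EFin \o b)^\- (row i Y) * (EFin \o g)^\+ Y.
  rewrite !funeposE !funenegE /= -!EFin_max -!EFinM -EFinD; congr EFin.
  by rewrite -mulrN maxrM0 opprK.
have ip : \int[lebM]_Y (EFin \o (fun Y => b (row i Y) * g Y)%R)^\+ Y =
    \int[lebM]_Y (EFin \o (fun Y => b (row i Y) * g Y)%R)^\- Y.
  under eq_integral do rewrite pE.
  under [RHS]eq_integral do rewrite nE.
  have mm (u : 'rV[R]_n -> \bar R) (v : 'M[R]_(m, n) -> \bar R) : measurable_fun setT u -> measurable_fun setT v ->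
      measurable_fun setT (fun Y => u (row i Y) * v Y).
    by move=> mu mv; apply: emeasurable_funM => //; exact: mbr.
  rewrite !ge0_integralD//; try (by move=> Y _; rewrite mule_ge0); try exact: mm.
  rewrite (split (EFin \o g)^\+)//; last by move=> x Y; rewrite !funeposE /= gi.
  rewrite -(split (EFin \o g)^\-)//; last by move=> x Y; rewrite !funenegE /= gi.
  by rewrite addeC.
rewrite integralE -/(EFin \o (fun Y => b (row i Y) * g Y)%R) ip subee//.
exact: integrable_neg_fin_num.
Qed.

End zero_mean.

(** * Modulus, measurability and integrals of complex functions *)

Section complex_facts.
Context (R : realType).
Implicit Types x y : R[i].

Lemma ReD x y : Re (x + y) = Re x + Re y. Proof. by case: x; case: y. Qed.
Lemma ImD x y : Im (x + y) = Im x + Im y. Proof. by case: x; case: y. Qed.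
Lemma ReN x : Re (- x) = - Re x. Proof. by case: x. Qed.
Lemma ImN x : Im (- x) = - Im x. Proof. by case: x. Qed.
Lemma ReM x y : Re (x * y) = Re x * Re y - Im x * Im y. Proof. by case: x; case: y. Qed.
Lemma ImM x y : Im (x * y) = Re x * Im y + Im x * Re y. Proof. by case: x; case: y. Qed.

Lemma normcE2 x : normc x ^+ 2 = Re x ^+ 2 + Im x ^+ 2.
Proof. by case: x => a b /=; rewrite sqr_sqrtr// addr_ge0// sqr_ge0. Qed.

Lemma normc_ge0 x : 0 <= normc x.
Proof. by case: x => a b /=; exact: sqrtr_ge0. Qed.

Lemma normRe_le x : `|Re x| <= normc x.
Proof.
rewrite -(@ler_pXn2r _ 2) ?nnegrE ?normc_ge0// normcE2 real_normK ?num_real//.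
by rewrite lerDl sqr_ge0.
Qed.

Lemma normIm_le x : `|Im x| <= normc x.
Proof.
rewrite -(@ler_pXn2r _ 2) ?nnegrE ?normc_ge0// normcE2 real_normK ?num_real//.
by rewrite lerDr sqr_ge0.
Qed.

Lemma normc_le x : normc x <= `|Re x| + `|Im x|.
Proof.
rewrite -(@ler_pXn2r _ 2) ?nnegrE ?normc_ge0 ?addr_ge0// normcE2 sqrrD.
rewrite !real_normK ?num_real// lerD2r lerDl.
by rewrite mulrn_wge0// mulr_ge0.
Qed.

Lemma normcB_sym x y : normc (x - y) = normc (y - x).
Proof. by rewrite -normcN opprB. Qed.

Lemma le_normcB x y : normc (x - y) <= normc x + normc y.
Proof. by rewrite -(normcN y); exact: le_normcD. Qed.

Lemma normc_eq0 x : (normc x == 0) = (x == 0).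
Proof.
by apply/eqP/eqP => [/eq0_normc|->]; [|exact: normc0].
Qed.

Lemma normc_prod (I : finType) (P : pred I) (F : I -> R[i]) :
  normc (\prod_(i | P i) F i) = \prod_(i | P i) normc (F i).
Proof.
apply: (big_morph (@normc R)); [exact: normcM|exact: normc1].
Qed.

Lemma le_normc_sum (I : Type) (s : seq I) (F : I -> R[i]) :
  normc (\sum_(i <- s) F i) <= \sum_(i <- s) normc (F i).
Proof.
elim: s => [|i s ih]; first by rewrite !big_nil normc0.
by rewrite !big_cons (le_trans (le_normcD _ _))// lerD2l.
Qed.

End complex_facts.

Section complex_measurability.
Context d (T : measurableType d) (R : realType).
Implicit Types (f g : T -> R[i]) (A : set T).

Definition cres A f : T -> R[i] := fun x => if x \in A then f x else 0.

Lemma measurable_fun_in A : measurable A -> measurable_fun setT (fun x => x \in A).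
Proof.
move=> mA; apply: (measurable_fun_bool true); rewrite setTI.
rewrite (_ : _ @^-1` _ = A)//.
by apply/seteqP; split=> x /=; [move/set_mem|move/mem_set].
Qed.

Lemma cmeasurable_cst (c : R[i]) : cmeasurable setT (fun _ : T => c).
Proof. by split. Qed.

Lemma cmeasurableD f g : cmeasurable setT f -> cmeasurable setT g ->
  cmeasurable setT (fun x => f x + g x).
Proof.
move=> [f1 f2] [g1 g2]; split.
  by under eq_fun do rewrite ReD; exact: measurable_funD.
by under eq_fun do rewrite ImD; exact: measurable_funD.
Qed.

Lemma cmeasurableN f : cmeasurable setT f -> cmeasurable setT (fun x => - f x).
Proof.
move=> [f1 f2]; split.
  by under eq_fun do rewrite ReN; exact: measurableT_comp.
by under eq_fun do rewrite ImN; exact: measurableT_comp.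
Qed.

Lemma cmeasurableB f g : cmeasurable setT f -> cmeasurable setT g ->
  cmeasurable setT (fun x => f x - g x).
Proof. by move=> mf mg; apply: cmeasurableD => //; exact: cmeasurableN. Qed.

Lemma cmeasurableM f g : cmeasurable setT f -> cmeasurable setT g ->
  cmeasurable setT (fun x => f x * g x).
Proof.
move=> [f1 f2] [g1 g2]; split.
  by under eq_fun do rewrite ReM; apply: measurable_funB; exact: measurable_funM.
by under eq_fun do rewrite ImM; apply: measurable_funD; exact: measurable_funM.
Qed.

Lemma cmeasurableZ (a : R[i]) f : cmeasurable setT f -> cmeasurable setT (fun x => a * f x).
Proof. by move=> mf; apply: cmeasurableM => //; exact: cmeasurable_cst. Qed.

Lemma cmeasurable_prod (I : finType) (P : pred I) (F : I -> T -> R[i]) :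
  (forall i, P i -> cmeasurable setT (F i)) ->
  cmeasurable setT (fun x => \prod_(i | P i) F i x).
Proof.
move=> mF; rewrite (_ : (fun x => _) = \big[(fun f g x => f x * g x)/(fun=> 1)]_(i | P i) F i).
  by apply: (big_ind (cmeasurable setT)) => //; exact: cmeasurableM.
by apply/funext => x; elim/big_rec2 : _ => // i y1 y2 _ ->.
Qed.

Lemma cmeasurable_sum (I : Type) (s : seq I) (F : I -> T -> R[i]) :
  (forall i, cmeasurable setT (F i)) ->
  cmeasurable setT (fun x => \sum_(i <- s) F i x).
Proof.
move=> mF; rewrite (_ : (fun x => _) = \big[(fun f g x => f x + g x)/(fun=> 0)]_(i <- s) F i).
  by apply: (big_ind (cmeasurable setT)) => //; exact: cmeasurableD.
by apply/funext => x; elim/big_rec2 : _ => // i y1 y2 _ ->.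
Qed.

Lemma cmeasurable_comp d' (S : measurableType d') (f : T -> R[i]) (h : S -> T) :
  cmeasurable setT f -> measurable_fun setT h -> cmeasurable setT (fun x => f (h x)).
Proof. by move=> [f1 f2] mh; split; [exact: (measurableT_comp f1 mh)|exact: (measurableT_comp f2 mh)]. Qed.

Lemma cmeasurable_res A f : measurable A -> cmeasurable setT f ->
  cmeasurable setT (cres A f).
Proof.
move=> mA [f1 f2]; split.
  rewrite (_ : (fun x => _) = (fun x => if x \in A then Re (f x) else 0)).
    apply: measurable_fun_ifT => //.
    exact: measurable_fun_in.
  by apply/funext => x; rewrite /cres; case: ifP.
rewrite (_ : (fun x => _) = (fun x => if x \in A then Im (f x) else 0)).
  apply: measurable_fun_ifT => //.
  exact: measurable_fun_in.
by apply/funext => x; rewrite /cres; case: ifP.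
Qed.

Lemma measurable_normc (D : set T) f : cmeasurable D f ->
  measurable_fun D (fun x => normc (f x)).
Proof.
move=> [f1 f2].
rewrite (_ : (fun x => _) = (fun x => Num.sqrt (Re (f x) ^+ 2 + Im (f x) ^+ 2))).
  apply: measurableT_comp; first exact: continuous_measurable_fun (@sqrt_continuous R).
  by apply: measurable_funD; exact: measurable_funX.
by apply/funext => x; case: (f x).
Qed.

Lemma measurable_enormc (D : set T) f : cmeasurable D f ->
  measurable_fun D (fun x => (normc (f x))%:E).
Proof. by move=> mf; apply/measurable_EFinP; exact: measurable_normc. Qed.

Lemma measurable_of_bool (b : T -> bool) : measurable_fun setT b -> measurable [set x | b x].
Proof. by move=> mb; rewrite -[X in measurable X]setTI; exact: (mb _ [set true]). Qed.

Lemma measurable_gt (h : T -> R) c : measurable_fun setT h -> measurable [set x | c < h x].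
Proof. by move=> mh; apply: measurable_of_bool; exact: measurable_fun_ltr. Qed.

Lemma measurable_le (h : T -> R) c : measurable_fun setT h -> measurable [set x | h x <= c].
Proof. by move=> mh; apply: measurable_of_bool; exact: measurable_fun_ler. Qed.

Lemma measurable_ge (h : T -> R) c : measurable_fun setT h -> measurable [set x | c <= h x].
Proof. by move=> mh; apply: measurable_of_bool; exact: measurable_fun_ler. Qed.

Lemma measurable_normc_gt f c : cmeasurable setT f -> measurable [set x | c < normc (f x)].
Proof. by move=> mf; apply: measurable_gt; exact: measurable_normc. Qed.

End complex_measurability.

Section complex_integral.
Context d (T : measurableType d) (R : realType).
Variable mu : {measure set T -> \bar R}.
Implicit Types (f g : T -> R[i]) (A : set T).

Definition cintegrable f := cmeasurable setT f /\
  (\int[mu]_x (normc (f x))%:E < +oo)%E.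

Lemma integral_normc_ge0 (D : set T) f : (0 <= \int[mu]_(x in D) (normc (f x))%:E)%E.
Proof. by apply: integral_ge0 => x _; rewrite lee_fin normc_ge0. Qed.

Lemma cintegrable_Re f : cintegrable f -> mu.-integrable setT (fun x => (Re (f x))%:E).
Proof.
move=> [mf foo]; apply/integrableP; split; first by apply/measurable_EFinP; case: mf.
apply: le_lt_trans foo; apply: ge0_le_integral => //.
- by apply: measurableT_comp => //; apply/measurable_EFinP; case: mf.
- exact: measurable_enormc.
- by move=> x _; rewrite lee_fin normRe_le.
Qed.

Lemma cintegrable_Im f : cintegrable f -> mu.-integrable setT (fun x => (Im (f x))%:E).
Proof.
move=> [mf foo]; apply/integrableP; split; first by apply/measurable_EFinP; case: mf.
apply: le_lt_trans foo; apply: ge0_le_integral => //.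
- by apply: measurableT_comp => //; apply/measurable_EFinP; case: mf.
- exact: measurable_enormc.
- by move=> x _; rewrite lee_fin normIm_le.
Qed.

Lemma integral_normcD (D : set T) f g : measurable D ->
  cmeasurable setT f -> cmeasurable setT g ->
  (\int[mu]_(x in D) (normc (f x + g x))%:E <=
   \int[mu]_(x in D) (normc (f x))%:E + \int[mu]_(x in D) (normc (g x))%:E)%E.
Proof.
have n0 (h : T -> R[i]) x : D x -> (0 <= (normc (h x))%:E)%E by rewrite lee_fin normc_ge0.
move=> mD mf mg; have m h : cmeasurable setT h -> measurable_fun D (fun x => (normc (h x))%:E).
  by move=> mh; apply: measurable_funTS; exact: measurable_enormc.
rewrite -ge0_integralD//; try exact: m; try exact: n0.
apply: ge0_le_integral => //.
- by move=> x _; rewrite lee_fin normc_ge0.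
- exact: m (cmeasurableD mf mg).
- by apply: emeasurable_funD; exact: m.
- by move=> x _; rewrite -EFinD lee_fin le_normcD.
Qed.

Lemma integral_normcZ (D : set T) (a : R[i]) f : measurable D -> cmeasurable D f ->
  (\int[mu]_(x in D) (normc (a * f x))%:E =
   (normc a)%:E * \int[mu]_(x in D) (normc (f x))%:E)%E.
Proof.
move=> mD mf; under eq_integral do rewrite normcM EFinM.
rewrite ge0_integralZl// ?lee_fin ?normc_ge0//; first exact: measurable_enormc.
by move=> x _; rewrite lee_fin normc_ge0.
Qed.

Lemma cintegrableN f : cintegrable f -> cintegrable (fun x => - f x).
Proof.
move=> [mf foo]; split; first exact: cmeasurableN.
by under eq_integral do rewrite normcN.
Qed.

Lemma cintegrableD f g : cintegrable f -> cintegrable g ->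
  cintegrable (fun x => f x + g x).
Proof.
move=> [mf foo] [mg goo]; split; first exact: cmeasurableD.
by apply: le_lt_trans (integral_normcD measurableT mf mg) _; rewrite lte_add_pinfty.
Qed.

Lemma cintegrableB f g : cintegrable f -> cintegrable g ->
  cintegrable (fun x => f x - g x).
Proof. by move=> fi gi; apply: cintegrableD => //; exact: cintegrableN. Qed.

Lemma cintegrableZ (a : R[i]) f : cintegrable f -> cintegrable (fun x => a * f x).
Proof.
move=> [mf foo]; split; first exact: cmeasurableZ.
by rewrite integral_normcZ// lte_mul_pinfty// lee_fin normc_ge0.
Qed.

Lemma cintegralB f g : cintegrable f -> cintegrable g ->
  cintegral mu setT (fun x => f x - g x) = cintegral mu setT f - cintegral mu setT g.
Proof.
move=> fi gi; rewrite /cintegral.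
have -> : (fun x => Re (f x - g x)) = (fun x => Re (f x) - Re (g x)).
  by apply/funext => x; rewrite ReD ReN.
have -> : (fun x => Im (f x - g x)) = (fun x => Im (f x) - Im (g x)).
  by apply/funext => x; rewrite ImD ImN.
by rewrite !RintegralB//; try exact: cintegrable_Re; try exact: cintegrable_Im.
Qed.

(** The factor 2 comes from bounding the real and imaginary parts separately; it propagates into all
    constants below. *)
Lemma normc_cintegral_le f : cintegrable f ->
  ((normc (cintegral mu setT f))%:E <= 2%:E * \int[mu]_x (normc (f x))%:E)%E.
Proof.
move=> fi; have [mf foo] := fi.
have h (u : T -> R) : mu.-integrable setT (fun x => (u x)%:E) -> (forall x, `|u x| <= normc (f x)) ->
    (`|\int[mu]_x u x|%:E <= \int[mu]_x (normc (f x))%:E)%E.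
  move=> ui uf; rewrite /Rintegral.
  apply: (@le_trans _ _ (\int[mu]_x `|(u x)%:E|)%E).
    rewrite EFin_normr_Rintegral//.
    by apply: le_abse_integral => //; exact: measurable_int ui.
  apply: ge0_le_integral => //.
  - by apply: measurableT_comp => //; exact: measurable_int ui.
  - exact: measurable_enormc.
  - by move=> x _; rewrite lee_fin.
rewrite mule_natl mule2n.
apply: (@le_trans _ _ (`|\int[mu]_x Re (f x)|%:E + `|\int[mu]_x Im (f x)|%:E)%E).
  by rewrite -EFinD lee_fin; exact: (normc_le (cintegral mu setT f)).
by apply: leeD; apply: h => [|x]; [exact: cintegrable_Re|exact: normRe_le|exact: cintegrable_Im|exact: normIm_le].
Qed.

End complex_integral.

(** * Compactness in matrix spaces and bounded supports *)

Section matrix_compact.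
Context (R : realType).

Lemma entry_le_norm m n (Y : 'M[R]_(m, n)) i j : `|Y i j| <= `|Y|.
Proof.
rewrite [leRHS]/Num.Def.normr /= mx_normrE; apply/bigmax_geP; right => /=.
by exists (i, j).
Qed.

Lemma norm_le_entry m n (Y : 'M[R]_(m, n)) (r : R) : 0 <= r ->
  (forall i j, `|Y i j| <= r) -> `|Y| <= r.
Proof.
move=> r0 Yr; rewrite [leLHS]/Num.Def.normr /= mx_normrE; by apply/bigmax_leP; split=> // -[i j] _; exact: Yr.
Qed.

Lemma vec_mx_continuous m n : continuous (@vec_mx R m n).
Proof.
apply: bounded_linear_continuous.
apply/linear_boundedP; exists 1; split => [|r r1 x]; first exact: num_real.
apply: (@le_trans _ _ `|x|); last by rewrite ler_peMl// ltW.
by apply: norm_le_entry => // i j; rewrite mxE; exact: entry_le_norm.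
Qed.

Lemma closed_entry_le m n (r : R) i j : closed [set Y : 'M[R]_(m, n) | `|Y i j| <= r].
Proof.
rewrite (_ : [set Y | _] = (fun Y : 'M[R]_(m, n) => `|Y i j|) @^-1` [set x | x <= r])//.
apply: preimage_closed; last exact: closed_le.
move=> Y _; apply: (@continuous_comp _ _ _ (fun Y : 'M[R]_(m, n) => Y i j) (fun x => `|x|)).
  exact: coord_continuous.
exact: (@norm_continuous R R).
Qed.

Lemma closed_entry_ge m n (r : R) i j : closed [set Y : 'M[R]_(m, n) | r <= `|Y i j|].
Proof.
rewrite (_ : [set Y | _] = (fun Y : 'M[R]_(m, n) => `|Y i j|) @^-1` [set x | r <= x])//.
apply: preimage_closed; last exact: closed_ge.
move=> Y _; apply: (@continuous_comp _ _ _ (fun Y : 'M[R]_(m, n) => Y i j) (fun x => `|x|)).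
  exact: coord_continuous.
exact: (@norm_continuous R R).
Qed.

(** Heine-Borel is applied to row vectors of length [m * n], and the compact set is carried to
    matrices by the continuous reshaping [vec_mx]. *)
Lemma compact_entries m n (r : R) :
  compact [set Y : 'M[R]_(m, n) | forall i j, `|Y i j| <= r].
Proof.
pose A := [set Y : 'rV[R]_(m * n) | forall i j, `|Y i j| <= r].
have cA : compact A.
  apply: bounded_closed_compact.
    exists `|r|; split; first exact: num_real.
    move=> M rM Y AY; apply: norm_le_entry; first by rewrite (le_trans _ (ltW rM)).
    by move=> i j; apply: le_trans (ltW rM); apply: le_trans (AY i j) (ler_norm _).
  rewrite (_ : A = \bigcap_(ij in [set: 'I_1 * 'I_(m * n)]) [set Y | `|Y ij.1 ij.2| <= r]).
    by apply: closed_bigI => ij _; exact: closed_entry_le.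
  by apply/seteqP; split => Y h => [[i j] _|i j]; [exact: h|exact: (h (i, j))].
have -> : [set Y : 'M[R]_(m, n) | forall i j, `|Y i j| <= r] = vec_mx @` A.
  apply/seteqP; split => [Y Yr|_ [Y AY <-] i j]; last by rewrite mxE; exact: AY.
  exists (mxvec Y); last exact: mxvecK.
  move=> i j; case/mxvec_indexP : j => k l.
  by rewrite (ord1 i) mxvecE.
apply: continuous_compact => //.
by apply: continuous_subspaceT; exact: vec_mx_continuous.
Qed.

(** A pointwise form of compact support; [supp_bsupp] and [bsupp_compact] pass between the two, so
    that closures need not be handled again. *)
Definition bsupp n (r : R) (f : 'rV[R]_n -> R[i]) :=
  forall x, f x != 0 -> forall j, `|x 0 j| <= r.

Lemma supp_bsupp n (f : 'rV[R]_n -> R[i]) : compact (supp f) -> exists2 r, 0 <= r & bsupp r f.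
Proof.
move=> /compact_bounded[M [Mr fM]].
exists (`|M| + 1) => [|x fx j]; first by rewrite addr_ge0.
apply: le_trans (entry_le_norm _ _ _) _.
apply: fM; first by rewrite (le_lt_trans (ler_norm _))// ltrDl.
exact: subset_closure.
Qed.

Lemma bsupp_supp n (r : R) (f : 'rV[R]_n -> R[i]) : bsupp r f ->
  supp f `<=` [set x | forall i j, `|x i j| <= r].
Proof.
move=> fr; rewrite /supp.
have cE : closed [set x : 'rV[R]_n | forall i j, `|x i j| <= r].
  by apply: compact_closed; [exact: norm_hausdorff|exact: compact_entries].
rewrite [X in _ `<=` X](closure_id _).1//.
by apply: closure_subset => x /= fx i j; rewrite (ord1 i); exact: fr.
Qed.

Lemma bsupp_compact n (r : R) (f : 'rV[R]_n -> R[i]) : bsupp r f -> compact (supp f).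
Proof.
move=> fr; apply: subclosed_compact (@compact_entries 1 n r) _.
  exact: closed_closure.
exact: bsupp_supp.
Qed.

End matrix_compact.

(** * Function norms and the space [Linfc] *)

Section norms.
Context (R : realType) (n : nat).
Local Notation leb := (lebesgue_mx R 1 n).
Local Notation F := ('rV[R]_n -> R[i]).
Implicit Types (f g : F).

(** [Lnorm] at [+oo] unfolds to the essential supremum only when the space has positive measure. *)
Lemma lebT_gt0 : (0 < leb setT)%E.
Proof.
apply: (@lt_le_trans _ _ (leb (hcube 0 1))).
  by rewrite lebesgue_hcube// expr1n lte_fin.
by apply: le_measure; rewrite ?inE//; exact: measurable_hcube.
Qed.

Lemma cLnormy_ae f : (cLnorm leb +oo f < +oo)%E ->
  \forall x \ae leb, normc (f x) <= fine (cLnorm leb +oo f).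
Proof.
move=> foo.
have -> : cLnorm leb +oo f = ess_sup leb (fun x => (normc (f x))%:E).
  rewrite /cLnorm unlock lebT_gt0; congr ess_sup.
  by apply/funext => x /=; rewrite ger0_norm// normc_ge0.
move: foo; rewrite /cLnorm unlock lebT_gt0.
rewrite (_ : abse \o _ = (fun x => (normc (f x))%:E)); last first.
  by apply/funext => x /=; rewrite ger0_norm// normc_ge0.
move=> foo; have s0 : (0 <= ess_sup leb (fun x => (normc (f x))%:E))%E.
  apply: ess_sup_gee; first exact: lebT_gt0.
  by apply: nearW => x; rewrite lee_fin normc_ge0.
apply: filterS (ess_sup_ge leb (fun x => (normc (f x))%:E)) => x.
by rewrite -lee_fin fineK// ge0_fin_numE.
Qed.

Lemma cLnormy_le f (M : R) : 0 <= M -> (\forall x \ae leb, normc (f x) <= M) ->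
  (cLnorm leb +oo f <= M%:E)%E.
Proof.
move=> M0 fM; rewrite /cLnorm unlock lebT_gt0.
apply/ess_supP; apply: filterS fM => x fx /=.
by rewrite lee_fin ger0_norm// normc_ge0.
Qed.

Lemma cLnorm1E f : cLnorm leb 1 f = (\int[leb]_x (normc (f x))%:E)%E.
Proof.
rewrite /cLnorm Lnorm1; apply: eq_integral => x _ /=.
by rewrite ger0_norm// normc_ge0.
Qed.

Lemma cLnorm2E f : (cLnorm leb 2%:E f `^ 2 = \int[leb]_x (normc (f x) ^+ 2)%:E)%E.
Proof.
rewrite /cLnorm poweR_Lnorm//; apply: eq_integral => x _.
by rewrite gee0_abs ?lee_fin ?normc_ge0// poweR_EFin powR_mulrn// normc_ge0.
Qed.

Lemma LinfcP f : Linfc f <->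
  [/\ cmeasurable setT f, exists2 M, 0 <= M & \forall x \ae leb, normc (f x) <= M &
      exists2 r, 0 <= r & bsupp r f].
Proof.
split=> [[[mf foo] /supp_bsupp fs]|[mf [M M0 fM] [r r0 fr]]].
  split=> //; exists (fine (cLnorm leb +oo f)); last exact: cLnormy_ae.
  by rewrite fine_ge0// /cLnorm Lnorm_ge0.
split; last exact: bsupp_compact fr.
by split=> //; apply: le_lt_trans (cLnormy_le M0 fM) (ltry _).
Qed.

Lemma LinfcI f M r : cmeasurable setT f -> 0 <= M -> (forall x, normc (f x) <= M) ->
  bsupp r f -> 0 <= r -> Linfc f.
Proof.
move=> mf M0 fM fr r0; apply/LinfcP; split=> //; last by exists r.
by exists M => //; exact: nearW.
Qed.

Lemma Linfc_cmeasurable f : Linfc f -> cmeasurable setT f.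
Proof. by move=> /LinfcP[]. Qed.

Lemma bsupp_le r r' f : r <= r' -> bsupp r f -> bsupp r' f.
Proof. by move=> rr' fr x fx j; apply: le_trans (fr x fx j) rr'. Qed.

Lemma LinfcD f g : Linfc f -> Linfc g -> Linfc (fun x => f x + g x).
Proof.
move=> /LinfcP[mf [M M0 fM] [r r0 fr]] /LinfcP[mg [N N0 gN] [s s0 gs]].
apply/LinfcP; split; first exact: cmeasurableD.
- exists (M + N); first exact: addr_ge0.
  by apply: filterS2 fM gN => x fx gx; rewrite (le_trans (le_normcD _ _))// lerD.
- exists (Num.max r s); first by rewrite le_max r0.
  move=> x fgx j; rewrite le_max; have [fx|fx] := eqVneq (f x) 0.
    by rewrite gs ?orbT//; move: fgx; rewrite fx add0r.
  by rewrite fr.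
Qed.

Lemma LinfcZ (a : R[i]) f : Linfc f -> Linfc (fun x => a * f x).
Proof.
move=> /LinfcP[mf [M M0 fM] [r r0 fr]]; apply/LinfcP; split.
- by apply: cmeasurableM => //; exact: cmeasurable_cst.
- exists (normc a * M); first by rewrite mulr_ge0// normc_ge0.
  by apply: filterS fM => x fx; rewrite normcM ler_wpM2l// normc_ge0.
- exists r => // x; rewrite mulf_eq0 negb_or => /andP[_ fx] j; exact: fr.
Qed.

Lemma LinfcN f : Linfc f -> Linfc (fun x => - f x).
Proof. by move=> /(LinfcZ (-1)); under eq_fun do rewrite mulN1r. Qed.

Lemma LinfcB f g : Linfc f -> Linfc g -> Linfc (fun x => f x - g x).
Proof. by move=> fi gi; apply: LinfcD => //; exact: LinfcN. Qed.

Lemma Linfc0 : Linfc (fun _ : 'rV[R]_n => 0 : R[i]).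
Proof.
apply: (@LinfcI _ 0 0) => // x.
- by rewrite normc0.
- by rewrite eqxx.
Qed.

Lemma Linfc_res A f : measurable A -> Linfc f -> Linfc (cres A f).
Proof.
move=> mA /LinfcP[mf [M M0 fM] [r r0 fr]]; apply/LinfcP; split.
- exact: cmeasurable_res.
- exists M => //; apply: filterS fM => x fx; rewrite /cres; case: ifP => // _.
  by rewrite normc0.
- by exists r => // x; rewrite /cres; case: ifP => [_ /fr//|_]; rewrite eqxx.
Qed.

Lemma Linfc_integrable f : Linfc f -> cintegrable leb f.
Proof.
move=> /LinfcP[mf [M M0 fM] [r r0 fr]]; split => //.
pose Q := cube (const_mx (- r) : 'rV[R]_n) (r + r).
have mQ : measurable Q by exact: measurable_cube.
apply: (@le_lt_trans _ _ (\int[leb]_x (M%:E * (\1_Q x)%:E))%E).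
  apply: ae_ge0_le_integral => //.
  - by move=> x _; rewrite lee_fin normc_ge0.
  - exact: measurable_enormc.
  - by move=> x _; rewrite mule_ge0// lee_fin.
  - by apply: measurable_funeM; apply/measurable_EFinP; exact: measurable_indic.
  apply: filterS fM => x fx _; have [->|f0] := eqVneq (f x) 0.
    by rewrite normc0 mule_ge0// lee_fin.
  rewrite indicE mem_set ?mule1 ?lee_fin//= => j.
  by rewrite !mxE addrA addNr add0r -ler_norml fr.
rewrite ge0_integralZl//; last by apply/measurable_EFinP; exact: measurable_indic.
rewrite integral_indic// setIT.
by have /= -> := lebesgue_cube (const_mx (- r) : 'rV[R]_n) (addr_ge0 r0 r0); rewrite -EFinM ltry.
Qed.

(* A representative of [f] bounded everywhere, not just almost everywhere, by its norm. *)
Definition ftrunc f : F := cres [set x | normc (f x) <= fine (cLnorm leb +oo f)] f.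

Lemma measurable_normc_le (c : R) f : cmeasurable setT f ->
  measurable [set x | normc (f x) <= c].
Proof. by move=> mf; apply: measurable_le; exact: measurable_normc. Qed.

Lemma ftrunc_Linfc f : Linfc f -> Linfc (ftrunc f).
Proof.
by move=> fi; apply: Linfc_res => //; apply: measurable_normc_le; exact: Linfc_cmeasurable.
Qed.

Lemma ftrunc_ae f : Linfc f -> ftrunc f = f %[ae leb].
Proof.
move=> [[mf foo] _]; apply: filterS (cLnormy_ae foo) => x fx _.
by rewrite /ftrunc /cres mem_set.
Qed.

Lemma ftrunc_le f x : normc (ftrunc f x) <= fine (cLnorm leb +oo f).
Proof.
rewrite /ftrunc /cres; case: ifP => [/set_mem//|_].
by rewrite normc0 fine_ge0// /cLnorm Lnorm_ge0.
Qed.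

End norms.

(** * Telescoping and L^2 bounds for the multilinear operator *)

Lemma prode_le (R : realType) (I : finType) (P : pred I) (u v : I -> \bar R) :
  (forall i, P i -> 0 <= u i /\ u i <= v i)%E ->
  (\prod_(i | P i) u i <= \prod_(i | P i) v i)%E.
Proof.
move=> uv; suff : (0 <= \prod_(i | P i) u i /\ \prod_(i | P i) u i <= \prod_(i | P i) v i)%E by case.
elim/big_rec2 : _ => // i x y Pi [x0 xy]; have [u0 uvi] := uv _ Pi.
by split; [rewrite mule_ge0|rewrite lee_pmul].
Qed.

Section operator.
Context (R : realType) (n m : nat).
Local Notation leb := (lebesgue_mx R 1 n).
Local Notation F := ('rV[R]_n -> R[i]).
Implicit Types (f g : 'I_m -> F).

Definition upd f (i : 'I_m) (u : F) : 'I_m -> F := fun j => if j == i then u else f j.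

Lemma dfwith_upd f i u : @dfwith _ (fun=> F) f i u = upd f i u.
Proof.
apply/funext => j; rewrite /upd; case: eqVneq => [->|ji]; first exact: dfwithin.
by rewrite dfwithout// eq_sym.
Qed.

Lemma upd_id f i : upd f i (f i) = f.
Proof. by apply/funext => j; rewrite /upd; case: eqP => // ->. Qed.

Lemma upd_upd f i u v : upd (upd f i u) i v = upd f i v.
Proof. by apply/funext => j; rewrite /upd; case: eqP. Qed.

Lemma upd_Linfc f i u : (forall j, Linfc (f j)) -> Linfc u -> forall j, Linfc (upd f i u j).
Proof. by move=> fi ui j; rewrite /upd; case: eqP. Qed.

Lemma upd0_Linfc f i : (forall j, j != i -> Linfc (f j)) -> forall j, Linfc (upd f i (fun=> 0) j).
Proof. by move=> fi j; rewrite /upd; case: eqVneq => [_|/fi//]; exact: Linfc0. Qed.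

(** Hybrid tuples leading from [f] at [k = 0] to [g] at [k = m], changing one slot at a time. *)
Definition mix f g (k : nat) : 'I_m -> F := fun j => if (j < k)%N then g j else f j.

Lemma mix_Linfc f g k : (forall j, Linfc (f j)) -> (forall j, Linfc (g j)) ->
  forall j, Linfc (mix f g k j).
Proof. by move=> fi gi j; rewrite /mix; case: ifP. Qed.

Lemma mixE f g (k : 'I_m) : mix f g k = upd (mix f g k) k (f k).
Proof. by apply/funext => j; rewrite /upd /mix; case: eqP => // ->; rewrite ltnn. Qed.

Lemma mixSE f g (k : 'I_m) : mix f g k.+1 = upd (mix f g k) k (g k).
Proof.
apply/funext => j; rewrite /upd /mix; case: eqP => [->|jk]; first by rewrite ltnS leqnn.
by rewrite ltnS leq_eqVlt; case: eqP => // /val_inj.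
Qed.

Variables (T : ('I_m -> F) -> F) (B : R).
Hypothesis Tlin : multilinear_operator (fun=> @Linfc R n) T.
Hypothesis Tbd : forall q, Lambda 2%:E q -> bounded_by B q 2%:E T.

Lemma T_meas f : (forall j, Linfc (f j)) -> cmeasurable setT (T f).
Proof. by case: Tlin => + _; exact. Qed.

Lemma T_linear i f (a : R[i]) (u v : F) : (forall j, Linfc (f j)) -> Linfc u -> Linfc v ->
  \forall x \ae leb, T (upd f i (fun x => a * u x + v x)) x =
    a * T (upd f i u) x + T (upd f i v) x.
Proof.
move=> fi ui vi; case: Tlin => _ /(_ i f a u v fi ui vi).
by rewrite !dfwith_upd; apply: filterS => x /(_ I).
Qed.

Lemma T_sub i f (u v : F) : (forall j, Linfc (f j)) -> Linfc u -> Linfc v ->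
  \forall x \ae leb, T (upd f i (fun x => u x - v x)) x =
    T (upd f i u) x - T (upd f i v) x.
Proof.
move=> fi ui vi; have := T_linear i (-1) fi vi ui.
apply: filterS => x; rewrite mulN1r addrC => <-; congr (T (upd f i _) x).
by apply/funext => y; rewrite mulN1r addrC.
Qed.

Lemma T_telescope f g : (forall j, Linfc (f j)) -> (forall j, Linfc (g j)) ->
  \forall x \ae leb, T f x - T g x =
    \sum_(k < m) T (upd (mix f g k) k (fun y => f k y - g k y)) x.
Proof.
move=> fi gi.
have : \forall x \ae leb, forall k : 'I_m,
    T (upd (mix f g k) k (fun y => f k y - g k y)) x = T (mix f g k) x - T (mix f g k.+1) x.
  apply: filter_forall => k; rewrite mixSE [in T (mix f g k)]mixE.
  by apply: T_sub => //; exact: mix_Linfc.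
apply: filterS => x h.
rewrite (eq_bigr (fun k : 'I_m => - (T (mix f g k.+1) x - T (mix f g k) x))); last first.
  by move=> k _; rewrite h opprB.
rewrite sumrN -(big_mkord xpredT (fun k => T (mix f g k.+1) x - T (mix f g k) x)).
rewrite telescope_sumr// opprB.
congr (T _ _ - T _ _); apply/funext => j; rewrite /mix //.
by rewrite ltn_ord.
Qed.

(** The hypothesis for the exponents with 2 in slot [i], squared so that both L^2 norms become plain
    integrals. *)
Lemma T_sq i f (N : 'I_m -> R) : 0 <= B -> (forall j, Linfc (f j)) ->
  (forall j, j != i -> 0 <= N j /\ (cLnorm leb +oo (f j) <= (N j)%:E)%E) ->
  (\int[leb]_x (normc (T f x) ^+ 2)%:E <=
   ((B * \prod_(j < m | j != i) N j) ^+ 2)%:E * \int[leb]_x (normc (f i x) ^+ 2)%:E)%E.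
Proof.
move=> B0 fi fN; rewrite -!cLnorm2E.
have := @Tbd (fun j => if j == i then 2%:E else +oo%E) (ex_intro _ i erefl) f fi.
rewrite (bigD1 i)//= eqxx.
have Np : 0 <= \prod_(j < m | j != i) N j by apply: prodr_ge0 => j /fN[].
set P := (\prod_(j | _) _)%E => TB.
have PN : (P <= (\prod_(j < m | j != i) N j)%:E)%E.
  rewrite -prodEFin; apply: prode_le => j ji; rewrite (negbTE ji).
  by split; [rewrite /cLnorm Lnorm_ge0|case: (fN _ ji)].
have P0 : (0 <= P)%E by apply: prode_ge0 => j _; rewrite /cLnorm Lnorm_ge0.
have TB' : (cLnorm leb 2%:E (T f) <= (B * \prod_(j < m | j != i) N j)%:E * cLnorm leb 2%:E (f i))%E.
  apply: le_trans TB _; rewrite EFinM -muleA lee_wpmul2l ?lee_fin//.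
  by rewrite muleC lee_wpmul2r// /cLnorm Lnorm_ge0.
apply: le_trans (gt0_ler_poweR _ _ _ TB') _ => //.
- by rewrite in_itv/= leey andbT /cLnorm Lnorm_ge0.
- by rewrite in_itv/= leey andbT mule_ge0// ?lee_fin ?mulr_ge0// /cLnorm Lnorm_ge0.
rewrite poweRM ?lee_fin ?mulr_ge0// ?/cLnorm ?Lnorm_ge0//.
by rewrite poweR_EFin powR_mulrn// mulr_ge0.
Qed.

Lemma ae_eq0_sq (u : F) : cmeasurable setT u ->
  (\int[leb]_x (normc (u x) ^+ 2)%:E <= 0)%E -> \forall x \ae leb, u x = 0.
Proof.
move=> mu u0.
have mu2 : measurable_fun setT (fun x => (normc (u x) ^+ 2)%:E).
  by apply/measurable_EFinP; apply: measurable_funX; exact: measurable_normc.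
have /(ae_eq_integral_abs _ measurableT mu2) : (\int[leb]_x `|(normc (u x) ^+ 2)%:E| = 0)%E.
  under eq_integral do rewrite gee0_abs ?lee_fin ?sqr_ge0//.
  apply/eqP; rewrite eq_le u0 integral_ge0// => x _; by rewrite lee_fin sqr_ge0.
apply: filterS => x /(_ I) [] /eqP; rewrite sqrf_eq0 => /eqP; exact: eq0_normc.
Qed.

(** Multilinearity alone does not make [T] blind to null sets. The L^2 bound does: a factor
    vanishing almost everywhere has L^2 norm 0. *)
Lemma T_upd_ae0 i f (u : F) : 0 <= B -> (forall j, Linfc (f j)) -> Linfc u ->
  u = (fun=> 0) %[ae leb] -> \forall x \ae leb, T (upd f i u) x = 0.
Proof.
move=> B0 fi ui u0; have fui := upd_Linfc i fi ui.
apply: ae_eq0_sq; first exact: T_meas.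
apply: le_trans (@T_sq i _ (fun j => fine (cLnorm leb +oo (f j))) B0 fui _) _.
  move=> j ji; rewrite /upd (negbTE ji); split.
    by rewrite fine_ge0// /cLnorm Lnorm_ge0.
  by rewrite fineK// ge0_fin_numE ?/cLnorm ?Lnorm_ge0//; case: (fi j) => -[].
rewrite /upd eqxx [X in (_ * X)%E](_ : _ = 0%E) ?mule0//.
rewrite (ae_eq_integral (fun=> 0%E))// ?integral0//.
- by apply/measurable_EFinP; apply: measurable_funX; apply: measurable_normc; exact: Linfc_cmeasurable.
- by apply: filterS u0 => x /(_ I) -> _; rewrite normc0 expr0n.
Qed.

Lemma T_upd0 i f : (forall j, Linfc (f j)) -> \forall x \ae leb, T (upd f i (fun=> 0)) x = 0.
Proof.
move=> fi; have l0 := @Linfc0 R n; have := T_sub i fi l0 l0.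
have E : (fun _ : 'rV[R]_n => 0 - 0 : R[i]) = (fun=> 0) by apply/funext => y; rewrite subrr.
by apply: filterS => x; rewrite E => ->; rewrite subrr.
Qed.

Lemma T_ae f g : 0 <= B -> (forall j, Linfc (f j)) -> (forall j, Linfc (g j)) ->
  (forall j, f j = g j %[ae leb]) -> T f = T g %[ae leb].
Proof.
move=> B0 fi gi fg.
have : \forall x \ae leb, forall k : 'I_m, T (upd (mix f g k) k (fun y => f k y - g k y)) x = 0.
  apply: filter_forall => k; apply: T_upd_ae0 => //; first exact: mix_Linfc.
    exact: LinfcB.
  by apply: filterS (fg k) => x /(_ I) -> _; rewrite subrr.
apply: filterS2 (T_telescope fi gi) => x h k _; apply/eqP; rewrite -subr_eq0 h.
by rewrite big1.
Qed.

(** For the indicator of a unit cube in every slot all norms are positive, so a negative [B] would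
    make the norm of the image negative. *)
Lemma B_ge0 : (0 < m)%N -> 0 <= B.
Proof.
move=> m0; rewrite leNgt; apply/negP => B0.
pose u : F := cres (hcube 0 1) (fun=> 1).
have ui : Linfc u.
  apply: (@LinfcI _ _ _ 1 1) => //.
  - by apply: cmeasurable_res; [exact: measurable_hcube|exact: (@cmeasurable_cst _ _ _ 1)].
  - by move=> x; rewrite /u /cres; case: ifP; rewrite ?normc1 ?normc0.
  - move=> x; rewrite /u /cres; case: ifP => [/set_mem xQ _ j|]; last by rewrite eqxx.
    by have /andP[] := xQ j; rewrite !mxE add0r => h1 h2; rewrite ger0_norm// ltW.
have up p : (0 < p)%E -> (0 < cLnorm leb p u)%E.
  move=> p0; rewrite lt_def /cLnorm Lnorm_ge0 andbT; apply/eqP => u0.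
  have := Lnorm_eq0_eq0 (measurable_enormc (Linfc_cmeasurable ui)) p0 u0.
  move=> /(ae_eq_integral _ _ _ _ _) -/(_ measurableT (measurable_enormc (Linfc_cmeasurable ui))).
  rewrite integral0 => /(_ (measurable_cst _)).
  rewrite (eq_integral (fun x => (\1_(hcube 0 1) x)%:E)); last first.
    by move=> x _; rewrite /u /cres indicE; case: ifP; rewrite ?normc1 ?normc0.
  rewrite integral_indic ?setIT//; last exact: measurable_hcube.
  have /= -> := @lebesgue_hcube R n 0 1 ler01.
  by rewrite expr1n => -[] /eqP; rewrite oner_eq0.
pose i0 := Ordinal m0.
have := @Tbd (fun j => if j == i0 then 2%:E else +oo%E) (ex_intro _ i0 erefl) (fun=> u) (fun=> ui).
apply/negP; rewrite -ltNge.
apply: (@lt_le_trans _ _ 0%E); last by rewrite /cLnorm Lnorm_ge0.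
rewrite pmule_llt0 ?lte_fin//.
elim/big_ind : _ => //; first by move=> *; exact: mule_gt0.
by move=> i _; apply: up; case: ifP.
Qed.

End operator.

(** * Cubes, their dilates and separation *)

Section geometry.
Context (R : realType) (n : nat).
Implicit Types (x y z u a : 'rV[R]_n).

Lemma enorm_ge_entry x j : `|x 0 j| <= enorm x.
Proof.
rewrite -sqrtr_sqr ler_sqrt ?sumr_ge0// => [|k _]; last exact: sqr_ge0.
rewrite (bigD1 j)//= lerDl sumr_ge0// => k _; exact: sqr_ge0.
Qed.

Lemma enorm_le_sum x (l : R) : (forall j, `|x 0 j| <= l) -> enorm x <= n%:R * l.
Proof.
case: n x => [|n'] x xl.
  by rewrite /enorm big_ord0 sqrtr0 mul0r.
have l0 : 0 <= l by apply: le_trans (xl ord0).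
have nl0 : 0 <= n'.+1%:R * l by rewrite mulr_ge0.
rewrite -(ger0_norm nl0) -sqrtr_sqr ler_sqrt ?sqr_ge0//.
apply: (@le_trans _ _ (\sum_(j < n'.+1) l ^+ 2)).
  by apply: ler_sum => j _; rewrite -[leLHS]real_normK ?num_real// lerXn2r ?nnegrE.
rewrite sumr_const card_ord -[leLHS]mulr_natl exprMn ler_wpM2r ?sqr_ge0//.
by rewrite -natrX ler_nat; exact: leq_pmulr.
Qed.

Lemma enormN x : enorm (- x) = enorm x.
Proof. by rewrite /enorm; congr Num.sqrt; apply: eq_bigr => j _; rewrite mxE sqrrN. Qed.

(* The factor is chosen so that a sup-norm separation from the cube implies the Euclidean
   inequality defining [Gamma]. *)
Definition dil a (l : R) : set 'rV[R]_n :=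
  cube (a - const_mx (2 * n%:R * l)) ((4 * n%:R + 1) * l).

Lemma dilP a l x y : cube a l x -> ~ dil a l y -> exists j, 2 * n%:R * l < `|x 0 j - y 0 j|.
Proof.
move=> xa /existsNP[j] nya; exists j; rewrite ltNge; apply/negP => xy; apply: nya.
have /andP[x1 x2] := xa j; move: xy; rewrite ler_norml => /andP[y1 y2].
by rewrite !mxE; apply/andP; split; lra.
Qed.

(** Points of the cube are at Euclidean distance at most [n * l], while a point off the dilate
    differs from [x] by more than [2 * n * l] in some coordinate. *)
Lemma dil_far a l x z y : cube a l x -> cube a l z -> ~ dil a l y ->
  2 * enorm (x - z) < enorm (x - y).
Proof.
move=> xa za ya; have [j xy] := dilP xa ya.
apply: (@le_lt_trans _ _ (2 * n%:R * l)).
  rewrite -mulrA ler_pM2l//; apply: enorm_le_sum => k; rewrite !mxE ler_norml.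
  by have /andP[] := xa k; have /andP[] := za k; move=> *; apply/andP; split; lra.
by apply: lt_le_trans xy _; have := enorm_ge_entry (x - y) j; rewrite !mxE.
Qed.

Lemma measurable_enorm : measurable_fun setT (@enorm R n).
Proof.
apply: measurableT_comp; first exact: continuous_measurable_fun (@sqrt_continuous R).
by apply: measurable_sum => j; apply: measurable_funX; exact: measurable_entry.
Qed.

(** A quantitative form of lying off the support. The margin [d] confines the kernel's argument to a
    closed set that avoids 0. *)
Definition sep x (d : R) (f : 'rV[R]_n -> R[i]) :=
  forall y, f y != 0 -> exists j, d <= `|x 0 j - y 0 j|.

Lemma sep_supp x d f : 0 < d -> sep x d f -> ~ supp f x.
Proof.
move=> d0 xdf /(_ (ball x d) (nbhsx_ballx x _ d0))[y [/xdf[j xy]]].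
rewrite mx_norm_ball /ball_ /= => xyd.
have := le_lt_trans (entry_le_norm _ 0 j) xyd; rewrite !mxE => /(le_lt_trans xy).
by rewrite ltxx.
Qed.

End geometry.

(** * Integrability of the kernel integrand *)

Section kernel.
Context (R : realType) (n m : nat) (K : 'M[R]_(m, n) -> R[i]).
Local Notation lebM := (lebesgue_mx R m n).
Hypothesis Kloc : locally_integrable_off0 K.

Lemma measurable_mx_set1 : measurable [set 0 : 'M[R]_(m, n)].
Proof.
rewrite (_ : [set 0] = \bigcap_(ij in [set: 'I_m * 'I_n])
    ((fun Y : 'M[R]_(m, n) => Y ij.1 ij.2) @^-1` [set 0])).
  apply: fin_bigcap_measurable; first exact: finite_finset.
  by move=> ij _; rewrite -[X in measurable X]setTI; apply: measurable_entry.
apply/seteqP; split => [_ -> ij _ /=|Y h]; first by rewrite mxE.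
by apply/matrixP => i j; rewrite mxE; exact: (h (i, j)).
Qed.

Lemma measurable_norm_entry (i : 'I_m) (j : 'I_n) :
  measurable_fun setT (fun Y : 'M[R]_(m, n) => `|Y i j|).
Proof. by apply: measurableT_comp => //; exact: measurable_entry. Qed.

Lemma measurable_entry_le (i : 'I_m) (j : 'I_n) (r : R) :
  measurable [set Y : 'M[R]_(m, n) | `|Y i j| <= r].
Proof. by apply: measurable_le; exact: measurable_norm_entry. Qed.

Lemma measurable_entry_ge (i : 'I_m) (j : 'I_n) (r : R) :
  measurable [set Y : 'M[R]_(m, n) | r <= `|Y i j|].
Proof. by apply: measurable_ge; exact: measurable_norm_entry. Qed.

(** Measurability is given off the origin, and a single measurable point can be added. *)
Lemma K_meas : cmeasurable setT K.
Proof.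
have [[K1 K2] _] := Kloc.
have h (u : 'M[R]_(m, n) -> R) : measurable_fun (~` [set (0 : 'M[R]_(m, n))]) u -> measurable_fun setT u.
  move=> mu; rewrite -(setvU [set (0 : 'M[R]_(m, n))]); apply/measurable_funU.
  - by apply: measurableC; exact: measurable_mx_set1.
  - exact: measurable_mx_set1.
  - by split=> //; exact: measurable_fun_set1.
by split; exact: h.
Qed.

Definition rep_rows (x : 'rV[R]_n) : 'M[R]_(m, n) := \matrix_(i, j) x 0 j.

Lemma sub_rowsE x Y : sub_rows x Y = mx_move (fun=> true) (rep_rows x) Y.
Proof. by apply/matrixP => i j; rewrite !mxE. Qed.

Lemma measurable_sub_rows x : measurable_fun setT (@sub_rows R m n x).
Proof.
rewrite (_ : sub_rows x = mx_move (fun=> true) (rep_rows x)).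
  exact: measurable_mx_move.
by apply/funext => Y; rewrite sub_rowsE.
Qed.

Definition integrand (f : 'I_m -> 'rV[R]_n -> R[i]) (x : 'rV[R]_n) (Y : 'M[R]_(m, n)) :=
  K (sub_rows x Y) * \prod_(i < m) f i (row i Y).

Lemma cmeasurable_prod_row (P : pred 'I_m) (f : 'I_m -> 'rV[R]_n -> R[i]) :
  (forall j, P j -> cmeasurable setT (f j)) ->
  cmeasurable setT (fun Y : 'M[R]_(m, n) => \prod_(i < m | P i) f i (row i Y)).
Proof.
move=> mf; apply: (cmeasurable_prod (F := fun i Y => f i (row i Y))) => i Pi.
by apply: (cmeasurable_comp (mf i Pi)); exact: measurable_row.
Qed.

Lemma integrand_meas f x : (forall j, cmeasurable setT (f j)) ->
  cmeasurable setT (integrand f x).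
Proof.
move=> mf; apply: cmeasurableM; last by apply: cmeasurable_prod_row => j _.
by apply: (cmeasurable_comp K_meas); exact: measurable_sub_rows.
Qed.

(** After the substitution [Y -> sub_rows x Y] the factors confine the argument of [K] to a compact
    set: its entries are at most [|x| + r], and some entry of row [i] has size at least [d].
    Separation in one slot already keeps this set away from 0. *)
Lemma integrand_integrable f (N : 'I_m -> R) r x i d :
  (forall j, cmeasurable setT (f j)) ->
  (forall j y, normc (f j y) <= N j) ->
  (forall j, bsupp r (f j)) ->
  0 < d -> sep x d (f i) -> cintegrable lebM (integrand f x).
Proof.
move=> mf fN fr d0 fd; split; first exact: integrand_meas.
have N0 j : 0 <= N j by apply: le_trans (fN j 0); exact: normc_ge0.
pose S := [set U : 'M[R]_(m, n) | forall i j, `|U i j| <= `|x| + r] `&`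
  \bigcup_(j in [set: 'I_n]) [set U | d <= `|U i j|].
have cS : compact S.
  apply: subclosed_compact (@compact_entries R m n (`|x| + r)) _; last exact: subIsetl.
  apply: closedI.
    by apply: compact_closed; [exact: norm_hausdorff|exact: compact_entries].
  by apply: closed_bigcup; [exact: finite_finset|move=> j _; exact: closed_entry_ge].
have S0 : S `<=` ~` [set 0].
  by move=> U [_ [j _ h]] /= U0; move: h; rewrite /= U0 mxE normr0 leNgt d0.
have mS : measurable S.
  apply: measurableI.
    rewrite (_ : [set U | _] = \bigcap_(ij in [set: 'I_m * 'I_n])
        [set U : 'M[R]_(m, n) | `|U ij.1 ij.2| <= `|x| + r]).
      apply: fin_bigcap_measurable; first exact: finite_finset.
      by move=> ij _; exact: measurable_entry_le.
    apply/seteqP; split => U h => [ij _ /=|k l]; first exact: h.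
    by have := h (k, l) I.
  apply: fin_bigcup_measurable; first exact: finite_finset.
  by move=> j _; exact: measurable_entry_ge.
have KS := (Kloc.2 S S0 cS).
pose G U : \bar R := ((\prod_j N j)%:E * (normc (cres S K U))%:E)%E.
have mKS : cmeasurable setT (cres S K) by apply: cmeasurable_res => //; exact: K_meas.
have mG : measurable_fun setT G.
  by apply: measurable_funeM; exact: measurable_enormc.
have NN : 0 <= \prod_j N j by apply: prodr_ge0.
have G0 U : (0 <= G U)%E by rewrite mule_ge0// lee_fin ?normc_ge0.
apply: (@le_lt_trans _ _ (\int[lebM]_Y G (mx_move (fun=> true) (rep_rows x) Y))%E).
  apply: ge0_le_integral => //.
  - by move=> Y _; rewrite lee_fin normc_ge0.
  - by apply: measurable_enormc; exact: integrand_meas.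
  - by apply: measurableT_comp => //; exact: measurable_mx_move.
  move=> Y _; rewrite -sub_rowsE /G /integrand normcM normc_prod -EFinM lee_fin.
  have pN : \prod_j normc (f j (row j Y)) <= \prod_j N j.
    by apply: ler_prod => j _; rewrite normc_ge0 fN.
  have [->|/prodf_neq0 fY] := eqVneq (\prod_j normc (f j (row j Y))) 0.
    by rewrite mulr0 mulr_ge0// normc_ge0.
  have fY' j : f j (row j Y) != 0 by rewrite -normc_eq0; exact: fY.
  rewrite /cres mem_set; first by rewrite mulrC ler_wpM2r// normc_ge0.
  split => [k l|].
    rewrite mxE (le_trans (ler_normB _ _))// lerD ?entry_le_norm//.
    by have := fr k _ (fY' k) l; rewrite mxE.
  by have [j hj] := fd _ (fY' i); exists j => //=; move: hj; rewrite !mxE.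
rewrite ge0_integral_mx_move// ge0_integralZl//; last 2 first.
  exact: measurable_enormc.
  by move=> U _; rewrite lee_fin normc_ge0.
rewrite muleC lte_mul_pinfty// ?lee_fin//.
- exact: integral_normc_ge0.
- rewrite ge0_fin_numE; last exact: integral_normc_ge0.
  apply: le_lt_trans KS; rewrite [leRHS]integral_mkcond.
  rewrite (eq_integral ((fun Y => (normc (K Y))%:E) \_ S))// => U _.
  by rewrite /cres /patch; case: ifP => // _; rewrite normc0.
- by rewrite ltry.
Qed.

End kernel.

(** * The coordinate-type condition and factors far from a cube *)

Section hormander.
Context (R : realType) (n m : nat) (K : 'M[R]_(m, n) -> R[i]) (A : R).
Local Notation lebM := (lebesgue_mx R m n).
Hypotheses (Kloc : locally_integrable_off0 K) (Khor : coord_Hormander K A).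
Hypotheses (n0 : (0 < n)%N) (m0 : (0 < m)%N).

Lemma measurable_Gamma k v : measurable (Gamma k v : set 'M[R]_(m, n)).
Proof.
apply: measurable_gt.
exact: (measurableT_comp (@measurable_enorm R n) (measurable_row k)).
Qed.

Lemma measurable_shift_row k v : measurable_fun setT (@shift_row R m n k v).
Proof.
apply: measurable_mx => i j.
rewrite (_ : (fun _ => _) = fun Y : 'M[R]_(m, n) => if i == k then Y i j - v 0 j else Y i j).
  by case: (i == k); [apply: measurable_funB => //|]; exact: measurable_entry.
by apply/funext => Y; rewrite mxE.
Qed.

(** The cut-off to [Gamma] is put into the integrand, so that changes of variables over the whole
    space apply. *)
Definition hdiff k v (U : 'M[R]_(m, n)) : \bar R :=
  (normc (cres (Gamma k v) (fun U => K (shift_row k v U) - K U) U))%:E.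

Lemma hdiff_ge0 k v U : (0 <= hdiff k v U)%E.
Proof. by rewrite lee_fin normc_ge0. Qed.

Lemma hdiff_meas k v : measurable_fun setT (hdiff k v).
Proof.
apply: measurable_enormc; apply: cmeasurable_res; first exact: measurable_Gamma.
apply: cmeasurableB; last exact: (K_meas Kloc).
exact: (cmeasurable_comp (K_meas Kloc) (measurable_shift_row k v)).
Qed.

Lemma hdiff_int k v :
  (\int[lebM]_U hdiff k v U =
   \int[lebM]_(y in Gamma k v) (normc (K (shift_row k v y) - K y))%:E)%E.
Proof.
rewrite [RHS]integral_mkcond; apply: eq_integral => U _.
by rewrite /hdiff /cres patchE; case: ifP => // _; rewrite normc0.

Qed.

Lemma sum_hdiff_le v : (\sum_(k < m) \int[lebM]_U hdiff k v U <= A%:E)%E.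
Proof. rewrite (eq_bigr _ (fun k _ => hdiff_int k v)); exact: Khor. Qed.

Lemma hdiff_le k v : (\int[lebM]_U hdiff k v U <= A%:E)%E.
Proof.
apply: le_trans (sum_hdiff_le v); rewrite (bigD1 k)//= leeDl// sume_ge0// => j _.
by apply: integral_ge0 => U _; exact: hdiff_ge0.
Qed.

Lemma A_ge0 : 0 <= A.
Proof.
rewrite -lee_fin; apply: le_trans (hdiff_le (Ordinal m0) 0).
by apply: integral_ge0 => U _; exact: hdiff_ge0.
Qed.

Lemma dil_sep a l (x : 'rV[R]_n) u : cube a l x -> (forall y, dil a l y -> u y = 0) ->
  sep x (2 * n%:R * l) u.
Proof.
move=> xa ua y uy; have [|j xy] := @dilP _ _ a l x y xa; last by exists j; exact: ltW.
by move=> /ua uy0; rewrite uy0 eqxx in uy.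
Qed.

(** Each intermediate change is a [shift_row] by [x - z] of a matrix whose [k]-th row is [x - y_k].
    By [dil_far] that row is long enough to lie in [Gamma]. Summed over [k] this uses the Hörmander
    sum exactly once; the 2 is the one of [normc_cintegral_le]. *)
Lemma far_estimate (f : 'I_m -> 'rV[R]_n -> R[i]) (N : 'I_m -> R) r a l x z :
  0 < l -> cube a l x -> cube a l z ->
  (forall j, cmeasurable setT (f j)) -> (forall j y, normc (f j y) <= N j) ->
  (forall j, bsupp r (f j)) -> (forall j y, dil a l y -> f j y = 0) ->
  normc (cintegral lebM setT (integrand K f x) - cintegral lebM setT (integrand K f z)) <=
  2 * A * \prod_(j < m) N j.
Proof.
move=> l0 xa za mf fN fr fa.
have d0 : 0 < 2 * n%:R * l by rewrite !mulr_gt0// ltr0n.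
have N0 j : 0 <= N j by apply: le_trans (fN j 0); exact: normc_ge0.
have ii w : cube a l w -> cintegrable lebM (integrand K f w).
  move=> wa.
  exact: (integrand_integrable Kloc mf fN fr d0 (dil_sep wa (fa (Ordinal m0)))).
rewrite -cintegralB; [|exact: ii|exact: ii].
have mB : cmeasurable setT (fun Y => integrand K f x Y - integrand K f z Y).
  by apply: cmeasurableB; exact: integrand_meas.
rewrite -lee_fin; apply: le_trans (normc_cintegral_le (cintegrableB (ii _ xa) (ii _ za))) _.
rewrite -mulrA EFinM lee_wpmul2l//.
(* The first [k] rows are already based at [z], the others still at [x], so [W 0] gives [sub_rows x]
   and [W m] gives [sub_rows z]. *)
pose W (k : nat) : 'M[R]_(m, n) := \matrix_(j, l) if (j < k)%N then z 0 l else x 0 l.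
have WS (k : 'I_m) Y : mx_move (fun=> true) (W k.+1) Y =
    shift_row k (x - z) (mx_move (fun=> true) (W k) Y).
  apply/matrixP => i j; rewrite !mxE; case: eqVneq => [->|ik].
    by rewrite ltnS leqnn ltnn; ring.
  by rewrite ltnS leq_eqVlt (inj_eq val_inj) (negbTE ik).
have PN : 0 <= \prod_(j < m) N j by apply: prodr_ge0.
apply: (@le_trans _ _ (\int[lebM]_Y ((\prod_(j < m) N j)%:E *
    \sum_(k < m) hdiff k (x - z) (mx_move (fun=> true) (W k) Y)))%E); last first.
  have mh (k : 'I_m) : measurable_fun setT (fun Y => hdiff k (x - z) (mx_move (fun=> true) (W k) Y)).
    exact: (measurableT_comp (hdiff_meas _ _) (measurable_mx_move _ _)).
  rewrite ge0_integralZl//.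
  - rewrite muleC EFinM lee_wpmul2r ?lee_fin//.
    rewrite ge0_integral_sum//.
      apply: le_trans (sum_hdiff_le (x - z)); apply: lee_sum => k _.
      rewrite (@ge0_integral_mx_move _ _ _ _ _ (hdiff k (x - z)))//; first exact: hdiff_meas.
      by move=> U; exact: hdiff_ge0.
    by move=> k Y _; exact: hdiff_ge0.
  - by apply: emeasurable_sum => k.
  - by move=> Y _; apply: sume_ge0 => k _; exact: hdiff_ge0.
apply: ge0_le_integral => //.
- by move=> Y _; rewrite lee_fin normc_ge0.
- exact: measurable_enormc.
- apply: measurable_funeM; apply: emeasurable_sum => k.
  exact: (measurableT_comp (hdiff_meas _ _) (measurable_mx_move _ _)).
move=> Y _; rewrite /integrand -mulrBl normcM normc_prod.
have pN : \prod_j normc (f j (row j Y)) <= \prod_j N j.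
  by apply: ler_prod => j _; rewrite normc_ge0 fN.
(* Unless the integrand vanishes, every factor is nonzero, and so every row lies off the dilate. *)
have [->|/prodf_neq0 fY] := eqVneq (\prod_j normc (f j (row j Y))) 0.
  by rewrite mulr0 mule_ge0 ?lee_fin// sume_ge0// => k _; exact: hdiff_ge0.
have fY' j : f j (row j Y) != 0 by rewrite -normc_eq0; exact: fY.
have far j : ~ dil a l (row j Y) by move=> /fa fz; have := fY' j; rewrite fz eqxx.
rewrite muleC EFinM; apply: lee_pmul; rewrite ?lee_fin ?normc_ge0//.
  by apply: prodr_ge0 => j _; exact: normc_ge0.
rewrite (_ : K (sub_rows x Y) - K (sub_rows z Y) = \sum_(k < m)
   (K (mx_move (fun=> true) (W k) Y) - K (mx_move (fun=> true) (W k.+1) Y))); last first.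
  pose KW k := K (mx_move (fun=> true) (W k) Y).
  rewrite (eq_bigr (fun k : 'I_m => - (KW k.+1 - KW k))); last by move=> k _; rewrite opprB.
  rewrite sumrN -(big_mkord xpredT (fun k => KW k.+1 - KW k)).
  rewrite telescope_sumr// opprB !sub_rowsE.
  congr (K _ - K _); apply/matrixP => i j; rewrite !mxE ?ltn_ord//.
rewrite /hdiff sumEFin lee_fin; apply: le_trans (le_normc_sum _ _) _.
apply: ler_sum => k _; rewrite WS normcB_sym /cres mem_set// /Gamma /=.
apply: lt_le_trans (dil_far xa za (far k)) _.
rewrite (_ : x - row k Y = row k (mx_move (fun=> true) (W k) Y))//.
by apply/rowP => j; rewrite !mxE ltnn.
Qed.

End hormander.

(** * Scaling and L^2 size estimates *)

Section size_estimates.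
Context (R : realType) (n : nat).
Local Notation leb := (lebesgue_mx R 1 n).
Local Notation F := ('rV[R]_n -> R[i]).

(** Descends from positive majorants [M] to [X], which may be 0 and hence cannot itself serve as a
    divisor. *)
Lemma lee_inf_scale (v : \bar R) (C X : R) : 0 <= C -> 0 <= X ->
  (forall M, 0 < M -> X <= M -> (v <= (C * M)%:E)%E) -> (v <= (C * X)%:E)%E.
Proof.
move=> C0 X0 h; apply/lee_addgt0Pr => e e0.
have C1 : 0 < C + 1 by rewrite ltr_wpDl.
have d0 : 0 < e / (C + 1) by rewrite divr_gt0.
apply: le_trans (h (X + e / (C + 1)) _ _) _; [exact: ltr_wpDl|by rewrite lerDl ltW|].
rewrite -EFinD lee_fin mulrDr lerD2l mulrCA ler_piMr ?ltW//.
by rewrite ltr_pdivrMr// mul1r ltrDl.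
Qed.

(** A substitute for Cauchy-Schwarz: the pointwise bound [t <= (M + t ^+ 2 / M) / 2] is integrated
    over [D]. Since [M] already has the expected size of [u], nothing is lost and no square root
    appears. *)
Lemma integral_normc_AMGM (u : F) (D : set 'rV[R]_n) (M V1 V2 : R) :
  cmeasurable setT u -> measurable D -> 0 < M ->
  (leb D <= V1%:E)%E -> (\int[leb]_x (normc (u x) ^+ 2)%:E <= (M ^+ 2 * V2)%:E)%E ->
  (\int[leb]_(x in D) (normc (u x))%:E <= (2^-1 * M * (V1 + V2))%:E)%E.
Proof.
move=> mu mD M0 DV uV.
have mu1 (E : set 'rV[R]_n) : measurable_fun E (fun x => (normc (u x))%:E).
  by apply: measurable_funTS; exact: measurable_enormc.
have mu2 (E : set 'rV[R]_n) : measurable_fun E (fun x => (normc (u x) ^+ 2)%:E).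
  apply: measurable_funTS; apply/measurable_EFinP; apply: measurable_funX.
  exact: measurable_normc.
have iM : 0 <= 2^-1 / M by rewrite divr_ge0 ?invr_ge0// ltW.
apply: (@le_trans _ _ (\int[leb]_(x in D) ((2^-1 * M)%:E + (2^-1 * M^-1)%:E * (normc (u x) ^+ 2)%:E))%E).
  apply: ge0_le_integral => //.
  - by move=> x _; rewrite lee_fin normc_ge0.
  - by apply: emeasurable_funD => //; exact: measurable_funeM.
  move=> x _; rewrite -EFinM -EFinD lee_fin.
  have := sqr_ge0 (normc (u x) - M); set t := normc (u x) => tM.
  rewrite -(ler_pM2l M0) mulrDr (_ : M * (2^-1 * M^-1 * t ^+ 2) = 2^-1 * t ^+ 2); first nra.
  by field; rewrite gt_eqF.
rewrite ge0_integralD//.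

- rewrite integral_cst// ge0_integralZl//; last by move=> x _; rewrite lee_fin sqr_ge0.
  apply: (@le_trans _ _ ((2^-1 * M)%:E * V1%:E + (2^-1 * M^-1)%:E * (M ^+ 2 * V2)%:E)%E).
    apply: leeD; apply: lee_wpmul2l; rewrite ?lee_fin ?mulr_ge0 ?invr_ge0 ?(ltW M0)//.
    apply: le_trans uV; apply: ge0_subset_integral => // x _; by rewrite lee_fin sqr_ge0.
  rewrite -!EFinM -EFinD lee_fin le_eqVlt; apply/orP; left; apply/eqP.
  by field; rewrite gt_eqF.
- by move=> x _; rewrite lee_fin mulr_ge0 ?invr_ge0// ltW.
- by move=> x _; apply: mule_ge0; rewrite lee_fin ?sqr_ge0.
- exact: measurable_funeM.
Qed.

Lemma integral_sq_le (u : F) (N V : R) (D : set 'rV[R]_n) : measurable D -> 0 <= N ->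
  cmeasurable setT u ->
  (forall x, normc (u x) <= N) -> (forall x, ~ D x -> u x = 0) -> leb D = V%:E ->
  (\int[leb]_x (normc (u x) ^+ 2)%:E <= (N ^+ 2 * V)%:E)%E.
Proof.
move=> mD N0 mu uN uD DV.
apply: (@le_trans _ _ (\int[leb]_x ((N ^+ 2)%:E * (\1_D x)%:E))%E).
  apply: ge0_le_integral => //.
  - by move=> x _; rewrite lee_fin sqr_ge0.
  - by apply/measurable_EFinP; apply: measurable_funX; exact: measurable_normc.
  - by apply: measurable_funeM; apply/measurable_EFinP; exact: measurable_indic.
  move=> x _; rewrite -EFinM lee_fin indicE.
  case: (asboolP (D x)) => [Dx|nDx].
    by rewrite mem_set// mulr1 lerXn2r ?nnegrE ?normc_ge0//.
  by rewrite uD// normc0 expr0n mulr_ge0// sqr_ge0.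
rewrite ge0_integralZl//; last 2 first.
- by apply/measurable_EFinP; exact: measurable_indic.
- by rewrite lee_fin sqr_ge0.
by rewrite integral_indic// setIT; have /= -> := DV; rewrite -EFinM.
Qed.

Lemma lee_of_scale (c v : R) (x : \bar R) : 0 < c -> (c%:E * x <= v%:E)%E -> (x <= (v / c)%:E)%E.
Proof. by move=> c0; rewrite mulrC EFinM lee_pdivlMl. Qed.

End size_estimates.

(** * Cancellation for complex factors *)

Section zero_mean_complex.
Context (R : realType) (m n : nat).
Local Notation lebM := (lebesgue_mx R m n).
Local Notation leb := (lebesgue_mx R 1 n).

(** The product expands into four real products, each dominated by the modulus of [b * g] and each
    with a first factor of mean zero. *)
Lemma cintegral_row_zero_mean (i : 'I_m) (b : 'rV[R]_n -> R[i]) (g : 'M[R]_(m, n) -> R[i]) :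
  cintegrable leb b -> cintegral leb setT b = 0 ->
  cmeasurable setT g -> (forall x Y, g (rset i x Y) = g Y) ->
  cintegrable lebM (fun Y => b (row i Y) * g Y) ->
  cintegral lebM setT (fun Y => b (row i Y) * g Y) = 0.
Proof.
move=> bi b0 mg gi bgi; have [mb _] := bi; have [_ boo] := bgi.
have mbr := cmeasurable_comp mb (@measurable_row R m n i).
have E0 (u : 'rV[R]_n -> R) : leb.-integrable setT (fun x => (u x)%:E) -> \int[leb]_x u x = 0 ->
    (\int[leb]_x (u x)%:E = 0)%E.
  by move=> ui; rewrite /Rintegral => /eqP; rewrite fine_eq0 ?integrable_fin_num// => /eqP.
have [re0 im0] : \int[leb]_x Re (b x) = 0 /\ \int[leb]_x Im (b x) = 0.
  by move: b0; rewrite /cintegral => -[].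
have prodi (u : 'rV[R]_n -> R) (v : 'M[R]_(m, n) -> R) :
    measurable_fun setT u -> measurable_fun setT v ->
    (forall x, `|u x| <= normc (b x)) -> (forall Y, `|v Y| <= normc (g Y)) ->
    lebM.-integrable setT (fun Y => (u (row i Y) * v Y)%:E).
  move=> mu mv ub vg.
  have muv : measurable_fun setT (fun Y => (u (row i Y) * v Y)%:E).
    apply/measurable_EFinP; apply: measurable_funM => //.
    exact: (measurableT_comp mu (measurable_row i)).
  apply/integrableP; split => //; apply: le_lt_trans boo; apply: ge0_le_integral => //.
  - exact: measurableT_comp.
  - by apply: measurable_enormc; exact: cmeasurableM.
  - by move=> Y _; rewrite lee_fin normrM normcM ler_pM.
have zero (u : 'rV[R]_n -> R) (v : 'M[R]_(m, n) -> R) :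
    measurable_fun setT u -> measurable_fun setT v ->
    (forall x, `|u x| <= normc (b x)) -> (forall Y, `|v Y| <= normc (g Y)) ->
    leb.-integrable setT (fun x => (u x)%:E) -> \int[leb]_x u x = 0 ->
    (forall x Y, v (rset i x Y) = v Y) ->
    \int[lebM]_Y (u (row i Y) * v Y) = 0.
  move=> mu mv ub vg ui u0 vi; rewrite /Rintegral.
  by rewrite integral_row_zero_mean//; [exact: E0|exact: prodi].
have rb := @normRe_le R; have ib := @normIm_le R.
have riB := cintegrable_Re bi; have iiB := cintegrable_Im bi.
have [mb1 mb2] := mb; have [mg1 mg2] := mg.
have gre x Y : Re (g (rset i x Y)) = Re (g Y) by rewrite gi.
have gim x Y : Im (g (rset i x Y)) = Im (g Y) by rewrite gi.
rewrite /cintegral.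
have -> : (fun Y => Re (b (row i Y) * g Y)) =
    (fun Y => Re (b (row i Y)) * Re (g Y) - Im (b (row i Y)) * Im (g Y)).
  by apply/funext => Y; rewrite ReM.
have -> : (fun Y => Im (b (row i Y) * g Y)) =
    (fun Y => Re (b (row i Y)) * Im (g Y) + Im (b (row i Y)) * Re (g Y)).
  by apply/funext => Y; rewrite ImM.
rewrite RintegralB//; [|
  exact: (prodi (fun x => Re (b x)) (fun Y => Re (g Y)))|
  exact: (prodi (fun x => Im (b x)) (fun Y => Im (g Y)))].
rewrite RintegralD//; [|
  exact: (prodi (fun x => Re (b x)) (fun Y => Im (g Y)))|
  exact: (prodi (fun x => Im (b x)) (fun Y => Re (g Y)))].
rewrite (zero (fun x => Re (b x)) (fun Y => Re (g Y)))//.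
rewrite (zero (fun x => Im (b x)) (fun Y => Im (g Y)))//.
rewrite (zero (fun x => Re (b x)) (fun Y => Im (g Y)))//.
rewrite (zero (fun x => Im (b x)) (fun Y => Re (g Y)))//.
by rewrite subrr addr0.
Qed.

End zero_mean_complex.

(** * Atoms away from their cube *)

Section offdiag.
Context (R : realType) (n m : nat) (K : 'M[R]_(m, n) -> R[i]) (A : R).
Local Notation leb := (lebesgue_mx R 1 n).
Local Notation lebM := (lebesgue_mx R m n).
Local Notation F := ('rV[R]_n -> R[i]).
Hypotheses (Kloc : locally_integrable_off0 K) (Khor : coord_Hormander K A).
Hypotheses (n0 : (0 < n)%N) (m0 : (0 < m)%N).
Variables (i : 'I_m) (a c : 'rV[R]_n) (l : R).
Hypotheses (l0 : 0 < l) (ca : cube a l c).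

Let mK := K_meas Kloc.

(** The error of freezing [y_i] at [c]: row [i] of the second argument is [x - c], independent of
    [Y]. *)
Definition odiff (x : 'rV[R]_n) (Y : 'M[R]_(m, n)) :=
  K (sub_rows x Y) - K (rset i (x - c) (sub_rows x Y)).

Definition okernel (b : F) (z : 'rV[R]_n * 'M[R]_(m, n)) : \bar R :=
  ((\1_(~` dil a l) z.1)%:E * ((normc (b (row i z.2)))%:E * (normc (odiff z.1 z.2))%:E))%E.

Lemma measurable_rVB d (S : measurableType d) (f g : S -> 'rV[R]_n) :
  measurable_fun setT f -> measurable_fun setT g ->
  measurable_fun setT (fun s => f s - g s : 'rV[R]_n).
Proof.
move=> mf mg; apply: measurable_mx => k j.
rewrite (_ : (fun _ => _) = fun s => f s k j - g s k j); last first.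
  by apply/funext => s; rewrite !mxE.
apply: measurable_funB.
  exact: (measurableT_comp (measurable_entry k j) mf).
exact: (measurableT_comp (measurable_entry k j) mg).
Qed.

Lemma measurable_sub_rows2 :
  measurable_fun setT (fun z : 'rV[R]_n * 'M[R]_(m, n) => sub_rows z.1 z.2).
Proof.
apply: measurable_mx => k j.
rewrite (_ : (fun _ => _) = fun z : 'rV[R]_n * 'M[R]_(m, n) => z.1 0 j - z.2 k j); last first.
  by apply/funext => s; rewrite !mxE.
apply: measurable_funB.
  exact: (measurableT_comp (measurable_entry 0 j) measurable_fst).
exact: (measurableT_comp (measurable_entry k j) measurable_snd).
Qed.

Lemma okernel_meas (b : F) : cmeasurable setT b -> measurable_fun setT (okernel b).
Proof.
move=> mb; apply: emeasurable_funM.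
  apply/measurable_EFinP.
  have mi : measurable_fun setT (\1_(~` dil a l) : 'rV[R]_n -> R).
    by apply: measurable_indic; apply: measurableC; exact: measurable_cube.
  exact: (measurableT_comp mi measurable_fst).
apply: emeasurable_funM; apply: measurable_enormc.
  apply: (cmeasurable_comp mb).
  exact: (measurableT_comp (measurable_row i) measurable_snd).
apply: cmeasurableB; apply: (cmeasurable_comp mK); first exact: measurable_sub_rows2.
apply: measurable_rset; last exact: measurable_sub_rows2.
by apply: measurable_rVB => //; exact: measurable_fst.
Qed.

Lemma okernel_ge0 b z : (0 <= okernel b z)%E.
Proof. by rewrite !mule_ge0// lee_fin ?normc_ge0. Qed.

(** Three measure preserving moves bring the double integral to the form of [|b|] at a point of its
    cube, integrated against one [hdiff] over all kernel variables. Everything is nonnegative, so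
    Tonelli applies throughout. *)
Lemma offdiag_estimate (b : F) : cmeasurable setT b -> (forall y, ~ cube a l y -> b y = 0) ->
  (\int[leb]_x \int[lebM]_Y okernel b (x, Y) <= A%:E * \int[leb]_x (normc (b x))%:E)%E.
Proof.
move=> mb ba.
pose H1 (z : 'rV[R]_n * 'M[R]_(m, n)) : \bar R :=
  ((\1_(~` dil a l) z.1)%:E * ((normc (b (row i z.2)))%:E *
   (normc (K (rset i (z.1 - row i z.2) z.2) - K (rset i (z.1 - c) z.2)))%:E))%E.
have H1_ge0 z : (0 <= H1 z)%E by rewrite !mule_ge0// lee_fin ?normc_ge0.
have mr2 : measurable_fun setT (fun z : 'rV[R]_n * 'M[R]_(m, n) => row i z.2).
  exact: (measurableT_comp (measurable_row i) measurable_snd).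
have mH1 : measurable_fun setT H1.
  apply: emeasurable_funM.
    apply/measurable_EFinP.
    have mi : measurable_fun setT (\1_(~` dil a l) : 'rV[R]_n -> R).
      by apply: measurable_indic; apply: measurableC; exact: measurable_cube.
    exact: (measurableT_comp mi measurable_fst).
  apply: emeasurable_funM; apply: measurable_enormc.
    exact: (cmeasurable_comp mb mr2).
  by apply: cmeasurableB; apply: (cmeasurable_comp mK); apply: measurable_rset;
    rewrite /=; try exact: measurable_snd; apply: measurable_rVB => //; exact: measurable_fst.
(* For fixed [x], every row but the [i]-th is reflected to [x - y_j]; row [i] still carries the
   variable of [b]. *)
have step1 x : (\int[lebM]_Y okernel b (x, Y) = \int[lebM]_U H1 (x, U))%E.
  pose s (j : 'I_m) := j != i.
  pose W : 'M[R]_(m, n) := \matrix_(j, k) if j == i then 0 else x 0 k.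
  rewrite -(@ge0_integral_mx_move _ _ _ s W (fun U => H1 (x, U)))//; last first.
    exact: (measurableT_comp mH1).
  apply: eq_integral => Y _; rewrite /okernel /H1 /odiff /=.
  have E1 : row i (mx_move s W Y) = row i Y.
    by apply/rowP => j; rewrite !mxE /s eqxx /= addr0.
  have E2 : rset i (x - row i Y) (mx_move s W Y) = sub_rows x Y.
    apply/matrixP => k j; rewrite !mxE /s; by case: eqVneq => [->|ki] //=; rewrite ?mxE.
  have E3 : rset i (x - c) (mx_move s W Y) = rset i (x - c) (sub_rows x Y).
    by apply/matrixP => k j; rewrite !mxE /s; case: eqVneq.
  by rewrite E1 E2 E3.
under eq_integral do rewrite step1.
(* From here on [x] is the variable of [b], and row [i] of the matrix is the former output
   variable. *)
rewrite (ge0_integral_rswap i mH1 H1_ge0) muleC -ge0_integralZr//; last 3 first.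
- exact: measurable_enormc.
- by move=> x _; rewrite lee_fin normc_ge0.
- by rewrite lee_fin (A_ge0 Khor).
have mswap : measurable_fun setT
    (fun z : 'rV[R]_n * 'M[R]_(m, n) => H1 (row i z.2, rset i z.1 z.2)).
  apply: (measurableT_comp mH1); apply: measurable_fun_pair => //.
  by apply: measurable_rset; [exact: measurable_fst|exact: measurable_snd].
apply: ge0_le_integral => //.
- by move=> x _; exact: integral_ge0.
- exact: (measurable_fun_fubini_tonelli_F (fun z => H1 (row i z.2, rset i z.1 z.2))).
- by apply: emeasurable_funM => //; exact: measurable_enormc.
move=> x _.
(* Translating row [i] by [- c] turns the two arguments of [K] into [V U] and its [shift_row] by
   [x - c]. *)
pose W' : 'M[R]_(m, n) := \matrix_(j, k) if j == i then - c 0 k else 0.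
pose V := mx_move (fun=> false) W'.
have mV : measurable_fun setT V by exact: measurable_mx_move.
have mh : measurable_fun setT (hdiff K i (x - c)) by exact: hdiff_meas.
have h0 := hdiff_ge0 K i (x - c).
apply: (@le_trans _ _ (\int[lebM]_U ((normc (b x))%:E * hdiff K i (x - c) (V U)))%E).
  apply: ge0_le_integral => //.
  - have mrx : measurable_fun setT (fun U : 'M[R]_(m, n) => (row i U, rset i x U)).
      by apply: measurable_fun_pair; [exact: measurable_row|exact: measurable_rset].
    exact: (measurableT_comp mH1 mrx).
  - by apply: measurable_funeM; exact: (measurableT_comp mh mV).
  move=> U _; rewrite /H1 /= row_rset indicE.
  have [->|bx] := eqVneq (b x) 0; first by rewrite normc0 !(mul0e, mule0).
  have xa : cube a l x by apply: contrapT => /ba bx0; rewrite bx0 eqxx in bx.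
  have [/set_mem /= Ua|_] := boolP (row i U \in ~` dil a l); last first.
    by rewrite mul0e mule_ge0// lee_fin normc_ge0.
  rewrite mul1e lee_wpmul2l ?lee_fin ?normc_ge0//.
  have VE : row i (V U) = row i U - c.
    by apply/rowP => j; rewrite !mxE eqxx.
  have E1 : rset i (row i U - x) (rset i x U) = shift_row i (x - c) (V U).
    apply/matrixP => k j; rewrite !mxE; case: eqVneq => [->|ki]; last by rewrite ?mxE ?(negbTE ki) ?addr0.
    by rewrite ?mxE; ring.
  have E2 : rset i (row i U - c) (rset i x U) = V U.
    apply/matrixP => k j; rewrite !mxE; case: eqVneq => [->|ki]; last by rewrite ?mxE ?(negbTE ki) ?addr0.
    by rewrite ?mxE ?eqxx.
  rewrite E1 E2 /cres mem_set// /Gamma /= VE.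
  by rewrite -(enormN (x - c)) -(enormN (_ - c)) !opprB; exact: dil_far.
rewrite ge0_integralZl//; [|exact: (measurableT_comp mh mV)|by rewrite lee_fin normc_ge0].
rewrite (@ge0_integral_mx_move _ _ _ _ _ (hdiff K i (x - c)))//.
by rewrite lee_wpmul2l ?lee_fin ?normc_ge0//; exact: (hdiff_le Khor).
Qed.

Lemma cube_sep x (b : F) : ~ dil a l x -> (forall y, ~ cube a l y -> b y = 0) ->
  sep x (2 * n%:R * l) b.
Proof.
move=> xa ba y fy.
have ya : cube a l y by apply: contrapT => /ba b0; rewrite b0 eqxx in fy.
by have [j h] := dilP ya xa; exists j; rewrite distrC ltW.
Qed.

Lemma offdiag_integrand (f : 'I_m -> F) (N : 'I_m -> R) r :
  (forall j, cmeasurable setT (f j)) -> (forall j y, normc (f j y) <= N j) ->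
  (forall j, bsupp r (f j)) ->
  cintegrable leb (f i) -> cintegral leb setT (f i) = 0 ->
  (forall y, ~ cube a l y -> f i y = 0) ->
  \forall x \ae leb, ~ dil a l x ->
    ((normc (cintegral lebM setT (integrand K f x)))%:E <=
     (2 * \prod_(j < m | j != i) N j)%:E * \int[lebM]_Y okernel (f i) (x, Y))%E.
Proof.
move=> mf fN fr fii fi0 fia.
have N0 j : 0 <= N j by apply: le_trans (fN j 0); exact: normc_ge0.
have PN : 0 <= \prod_(j < m | j != i) N j by apply: prodr_ge0.
have mI := measurable_fun_fubini_tonelli_F (m2 := lebM) _ (okernel_meas (mf i)) (okernel_ge0 _).
have I0 x : (0 <= \int[lebM]_Y okernel (f i) (x, Y))%E by apply: integral_ge0 => Y _; exact: okernel_ge0.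
have : leb.-integrable setT (fun x => \int[lebM]_Y okernel (f i) (x, Y))%E.
  apply/integrableP; split; first exact: mI.
  under eq_integral do rewrite gee0_abs//.
  apply: le_lt_trans (offdiag_estimate (mf i) fia) _.
  by rewrite lte_mul_pinfty ?lee_fin ?(A_ge0 Khor)//; case: fii.
move=> /(integrable_ae measurableT); apply: filterS => x /(_ I) xfin xa.
have d0 : 0 < 2 * n%:R * l by rewrite !mulr_gt0// ltr0n.
have ii := integrand_integrable Kloc mf fN fr d0 (cube_sep xa fia).
pose P (Y : 'M[R]_(m, n)) := \prod_(j < m | j != i) f j (row j Y).
have mP : cmeasurable setT P by apply: cmeasurable_prod_row.
have PleN Y : normc (P Y) <= \prod_(j < m | j != i) N j.
  by rewrite /P normc_prod; apply: ler_prod => j _; rewrite normc_ge0 fN.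
have mrs : measurable_fun setT (fun Y => rset i (x - c) (sub_rows x Y) : 'M[R]_(m, n)).
  by apply: measurable_rset => //; exact: measurable_sub_rows.
have mod : cmeasurable setT (odiff x).
  apply: cmeasurableB; first exact: (cmeasurable_comp mK (measurable_sub_rows x)).
  exact: (cmeasurable_comp mK mrs).
have mfr := cmeasurable_comp (mf i) (@measurable_row R m n i).
have okx : measurable_fun setT (fun Y => okernel (f i) (x, Y)).
  exact: (measurableT_comp (okernel_meas (mf i))).
pose Phi Y := odiff x Y * (f i (row i Y) * P Y).
have Phi_le : (\int[lebM]_Y (normc (Phi Y))%:E <=
    (\prod_(j < m | j != i) N j)%:E * \int[lebM]_Y okernel (f i) (x, Y))%E.
  rewrite -ge0_integralZl//; [|by move=> Y _; exact: okernel_ge0].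
  apply: ge0_le_integral => //.
  - by move=> Y _; rewrite lee_fin normc_ge0.
  - by apply: measurable_enormc; apply: cmeasurableM => //; exact: cmeasurableM.
  - exact: measurable_funeM.
  move=> Y _; rewrite /okernel /= indicE mem_set//= mul1e -!EFinM lee_fin /Phi !normcM.
  have := PleN Y; set p := \prod_(_ | _) _; have := normc_ge0 (odiff x Y); have := normc_ge0 (f i (row i Y)).
  set u := normc (odiff x Y); set v := normc (f i _); set w := normc (P Y) => v0 u0 wp.
  rewrite (_ : u * (v * w) = (u * v) * w); last by ring.
  by rewrite (_ : p * (v * u) = (u * v) * p); [rewrite ler_wpM2l ?mulr_ge0|ring].
have Phi_i : cintegrable lebM Phi.
  split; first by apply: cmeasurableM => //; exact: cmeasurableM.
  apply: le_lt_trans Phi_le _; rewrite lte_mul_pinfty ?lee_fin//.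
  by rewrite ltey_eq xfin.
have split_int Y : integrand K f x Y = f i (row i Y) * (K (sub_rows x Y) * P Y).
  by rewrite /integrand (bigD1 i)//= -/(P Y); ring.
pose g Y := K (rset i (x - c) (sub_rows x Y)) * P Y.
have g_i : cintegrable lebM (fun Y => f i (row i Y) * g Y).
  rewrite (_ : (fun Y => _) = (fun Y => integrand K f x Y - Phi Y)); first exact: cintegrableB.
  by apply/funext => Y; rewrite split_int /Phi /odiff /g; ring.
have g0 : cintegral lebM setT (fun Y => f i (row i Y) * g Y) = 0.
  apply: cintegral_row_zero_mean => //.
    by apply: cmeasurableM => //; exact: (cmeasurable_comp mK mrs).
  move=> w Y; rewrite /g; congr (K _ * _).
    by apply/matrixP => k j; rewrite !mxE; case: eqVneq.
  apply: eq_bigr => j ji; congr (f j _); apply/rowP => k.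
  by rewrite !mxE (negbTE ji).
have -> : cintegral lebM setT (integrand K f x) = cintegral lebM setT Phi.
  have := cintegralB ii Phi_i.
  rewrite (_ : (fun Y => _) = (fun Y => f i (row i Y) * g Y)) ?g0; last first.
    by apply/funext => Y; rewrite split_int /Phi /odiff /g; ring.
  by move/esym/eqP; rewrite subr_eq0 => /eqP.
apply: le_trans (normc_cintegral_le Phi_i) _.
by rewrite EFinM -muleA lee_wpmul2l.
Qed.

End offdiag.

(** * Calderon-Zygmund decomposition of dyadic step functions *)

Section calderon_zygmund.
Context (R : realType) (n : nat).
Local Notation leb := (lebesgue_mx R 1 n).
Local Notation F := ('rV[R]_n -> R[i]).
Implicit Types (f g : F) (a x y : 'rV[R]_n) (l : R).

(** Boundedness is qualitative, to stay within [Linfc]. The quantitative data are the side and the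
    L^1 norm, which [cz_spec] controls in total. *)
Record atom := Atom {
  at_corner : 'rV[R]_n; at_side : R; at_fun : F;
  at_side_gt0 : 0 < at_side;
  at_meas : cmeasurable setT at_fun;
  at_bounded : exists M, forall x, normc (at_fun x) <= M;
  at_off : forall x, ~ cube at_corner at_side x -> at_fun x = 0;
  at_mean0 : cintegral leb setT at_fun = 0 }.

(* On [hcube a l]: x and y lie in the same dyadic subcube of side [l / 2 ^ d]. *)
Definition same (d : nat) a l x y := forall (j : 'I_n) (k : nat),
  (k%:R * (l / 2 ^+ d) <= x 0 j - a 0 j) = (k%:R * (l / 2 ^+ d) <= y 0 j - a 0 j).

Definition stepf (d : nat) a l f :=
  (forall x, ~ hcube a l x -> f x = 0) /\
  (forall x y, hcube a l x -> hcube a l y -> same d a l x y -> f x = f y).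

Lemma hcube_cube a l x : hcube a l x -> cube a l x.
Proof. by move=> xa j; have /andP[-> /ltW] := xa j. Qed.

Lemma bounded_cube_integrable f a l M : 0 < l -> cmeasurable setT f ->
  (forall x, normc (f x) <= M) -> (forall x, ~ cube a l x -> f x = 0) -> Linfc f.
Proof.
move=> l0 mf fM fa.
have M0 : 0 <= M by apply: le_trans (fM 0); exact: normc_ge0.
apply: (@LinfcI _ _ _ M (`|a| + l)) => //; last by rewrite addr_ge0// ltW.
move=> x fx j; have xa : cube a l x by apply: contrapT => /fa f0; rewrite f0 eqxx in fx.
have /andP[h1 h2] := xa j; have := entry_le_norm a 0 j.
rewrite !ler_norml => /andP[h3 h4]; apply/andP; split; lra.
Qed.

Definition sub_corner a l (s : {ffun 'I_n -> bool}) : 'rV[R]_n :=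
  \row_j (a 0 j + if s j then l / 2 else 0).

Lemma sub_hcube a l s x : 0 < l -> hcube (sub_corner a l s) (l / 2) x -> hcube a l x.
Proof.
move=> l0 xs j; have := xs j; rewrite !mxE; case: (s j) => /andP[h1 h2]; apply/andP; split; lra.
Qed.

Lemma sub_hcube_ex a l x : hcube a l x -> exists s, hcube (sub_corner a l s) (l / 2) x.
Proof.
move=> xa; exists [ffun j => a 0 j + l / 2 <= x 0 j] => j; have /andP[h1 h2] := xa j.
rewrite !mxE ffunE; case: (leP (a 0 j + l / 2) (x 0 j)) => h; apply/andP; split; lra.
Qed.

Lemma sub_hcube_inj a l x s t : hcube (sub_corner a l s) (l / 2) x ->
  hcube (sub_corner a l t) (l / 2) x -> s = t.
Proof.
move=> xs xt; apply/ffunP => j; have := xs j; have := xt j; rewrite !mxE.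
by case: (s j); case: (t j) => // /andP[h1 h2] /andP[h3 h4]; lra.
Qed.

(** Parent and child have the same mesh. In an upper-half coordinate the child's thresholds are the
    parent's with index shifted by [2 ^ d]; parent thresholds of smaller index lie below the child's
    corner and are met by both points. *)
Lemma stepf_sub d a l f s : 0 < l -> stepf d.+1 a l f ->
  stepf d (sub_corner a l s) (l / 2) (cres (hcube (sub_corner a l s) (l / 2)) f).
Proof.
move=> l0 [f0 fc]; split => [x xs|x y xs ys xy].
  by rewrite /cres memNset.
rewrite /cres !mem_set//; apply: fc; [exact: sub_hcube xs|exact: sub_hcube ys|].
have d0 : 0 < 2 ^+ d :> R by rewrite exprn_gt0.
have E : l / 2 / 2 ^+ d = l / 2 ^+ d.+1 :> R by rewrite exprS invfM mulrA.
move=> j k; have := xy j; have := xs j; have := ys j; rewrite !mxE E.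
case: (s j) => /andP[ys1 ys2] /andP[xs1 xs2] xyj; last first.
  by have := xyj k; rewrite !addr0.
have h z : (k%:R * (l / 2 ^+ d.+1) <= z - (a 0 j + l / 2)) =
           ((k + 2 ^ d)%:R * (l / 2 ^+ d.+1) <= z - a 0 j).
  rewrite natrD natrX mulrDl (_ : 2 ^+ d * (l / 2 ^+ d.+1) = l / 2).
    by rewrite opprD addrA lerBrDr.
  by rewrite exprS; field; rewrite gt_eqF.
have [kd|kd] := leqP (2 ^ d) k.
  have /= := xyj (k - 2 ^ d)%N.
  have h' z : ((k - 2 ^ d)%N%:R * (l / 2 ^+ d.+1) <= z - (a 0 j + l / 2)) =
           (k%:R * (l / 2 ^+ d.+1) <= z - a 0 j).
    rewrite -{2}(subnK kd) natrD natrX mulrDl (_ : 2 ^+ d * (l / 2 ^+ d.+1) = l / 2).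
      by rewrite opprD addrA lerBrDr.
    by rewrite exprS; field; rewrite gt_eqF.
  by rewrite !h'.
have kl : k%:R * (l / 2 ^+ d.+1) <= l / 2.
  rewrite (_ : l / 2 = 2 ^+ d * (l / 2 ^+ d.+1)); last by rewrite exprS; field; rewrite gt_eqF.
  rewrite ler_pM2r; first by rewrite -natrX ler_nat ltnW.
  by rewrite divr_gt0// exprn_gt0.
by rewrite !(le_trans kl)//; lra.
Qed.

(** At generation 0 any two points of the cube are [same]: threshold 0 is met by both and no other
    by either. *)
Lemma stepf0_cst a l f : 0 < l -> stepf 0 a l f ->
  exists c, f = cres (hcube a l) (fun=> c).
Proof.
move=> l0 [f0 fc].
have aa : hcube a l a by move=> j; rewrite lexx ltrDl.
exists (f a); apply/funext => x; rewrite /cres; case: (boolP (x \in _)) => [/set_mem xa|/negP xa].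
  apply: fc => // j [|k]; first by rewrite mul0r subrr lexx; have /andP[h _] := xa j; rewrite subr_ge0 h.
  rewrite expr0 divr1 subrr; have k1 : l <= k.+1%:R * l by rewrite ler_peMl ?(ltW l0)// ler1n.
  have /andP[_ h] := xa j.
  by apply/idP/idP => h'; lra.
by apply: f0 => xa'; apply: xa; exact: mem_set.
Qed.

Lemma integral_cres_cst (Q : set 'rV[R]_n) (V : R) (c : R[i]) : measurable Q -> leb Q = V%:E ->
  (\int[leb]_x (normc (cres Q (fun=> c) x))%:E = (normc c * V)%:E)%E.
Proof.
move=> mQ QV; transitivity (\int[leb]_(x in Q) (normc c)%:E)%E.
  rewrite [RHS]integral_mkcond; apply: eq_integral => x _.
  by rewrite /cres patchE; case: ifP => // _; rewrite normc0.
by rewrite integral_cst//; have /= -> := QV.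
Qed.

Lemma cintegral_cres_cst (Q : set 'rV[R]_n) (V : R) (c : R[i]) : measurable Q -> leb Q = V%:E ->
  cintegral leb setT (cres Q (fun=> c)) = Complex V 0 * c.
Proof.
move=> mQ QV; have h (r : R) : \int[leb]_x (if x \in Q then r else 0) = V * r.
  transitivity (\int[leb]_(x in Q) r).
    rewrite [RHS]Rintegral_mkcond; apply: eq_Rintegral => x _.
    by rewrite patchE; case: ifP.
  by rewrite Rintegral_cst//; have /= -> := QV; rewrite mulrC.
rewrite /cintegral; have -> : (fun x => Re (cres Q (fun=> c) x)) = (fun x => if x \in Q then Re c else 0).
  by apply/funext => x; rewrite /cres; case: ifP.
have -> : (fun x => Im (cres Q (fun=> c) x)) = (fun x => if x \in Q then Im c else 0).
  by apply/funext => x; rewrite /cres; case: ifP.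
by rewrite !h; case: c => u v; apply/eqP; rewrite eq_complex /= !mul0r subr0 addr0 !eqxx.
Qed.

Lemma normc_real (v : R) : 0 <= v -> normc (Complex v 0 : R[i]) = v.
Proof. by move=> v0; rewrite /= expr0n addr0 sqrtr_sqr ger0_norm. Qed.

(** [2 ^+ n] is the volume ratio of a cube to a child, and 2 the loss in bounding the modulus of a
    complex mean. *)
Definition cz_const : R := 2 * 2 ^+ n.

Lemma cz_const_ge1 : 1 <= cz_const.
Proof.
have : 1 <= 2 ^+ n :> R by rewrite exprn_ege1// ler1n.
by rewrite /cz_const; lra.
Qed.

(** Decomposition at height [t] with good part [g] and finitely many atoms. The 2 is the cost of
    passing to complex means, and 3 = 1 + 2 bounds [f - g]. All bounds are additive over disjoint
    cubes, as the recursion requires. *)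
Definition cz_spec a l (t : R) f g (s : seq atom) :=
  [/\ forall x, f x = g x + \sum_(p <- s) at_fun p x,
      cmeasurable setT g,
      (forall x, normc (g x) <= cz_const * t) /\ (forall x, ~ hcube a l x -> g x = 0),
      (\int[leb]_x (normc (g x))%:E <= 2%:E * \int[leb]_x (normc (f x))%:E)%E &
      (t%:E * (\sum_(p <- s) at_side p ^+ n)%:E <= \int[leb]_x (normc (f x))%:E)%E /\
      (\sum_(p <- s) \int[leb]_x (normc (at_fun p x))%:E <=
        3%:E * \int[leb]_x (normc (f x))%:E)%E].

(** The stopping case: the mean of [|f|] is at least [t], and at most [2 ^+ n * t] since the parent
    was not stopped. The mean of [f] becomes the good part and the remainder is a single atom. *)
Lemma cz_selected a l (t M : R) f : 0 < l -> 0 < t -> cmeasurable setT f ->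
  (forall x, normc (f x) <= M) -> (forall x, ~ hcube a l x -> f x = 0) ->
  ((t * l ^+ n)%:E <= \int[leb]_x (normc (f x))%:E)%E ->
  (\int[leb]_x (normc (f x))%:E <= (t * 2 ^+ n * l ^+ n)%:E)%E ->
  exists g s, cz_spec a l t f g s.
Proof.
move=> l0 t0 mf fM fa tf ft.
have fi : cintegrable leb f.
  apply: Linfc_integrable; apply: (bounded_cube_integrable l0 mf fM) => x xa.
  by apply: fa => /hcube_cube /xa.
pose V := l ^+ n; have V0 : 0 < V by rewrite exprn_gt0.
have mQ : measurable (hcube a l) by exact: measurable_hcube.
have QV : leb (hcube a l) = V%:E by rewrite lebesgue_hcube// ltW.
pose c := Complex V^-1 0 * cintegral leb setT f.
pose g := cres (hcube a l) (fun=> c).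
have mg : cmeasurable setT g by apply: cmeasurable_res => //; exact: (cmeasurable_cst _ c).
have nc : ((normc c * V)%:E <= 2%:E * \int[leb]_x (normc (f x))%:E)%E.
  apply: le_trans (normc_cintegral_le fi); rewrite lee_fin /c normcM normc_real ?invr_ge0 ?(ltW V0)//.
  by rewrite mulrAC mulVf ?mul1r// gt_eqF.
have Ig := integral_cres_cst c mQ QV.
have gle : (\int[leb]_x (normc (g x))%:E <= 2%:E * \int[leb]_x (normc (f x))%:E)%E by rewrite Ig.
have ct : normc c <= cz_const * t.
  rewrite -(ler_pM2r V0) -lee_fin; apply: le_trans nc _.
  apply: le_trans (lee_wpmul2l _ ft) _ => //.
  by rewrite -EFinM lee_fin /cz_const /V le_eqVlt; apply/orP; left; apply/eqP; ring.
have gc x : normc (g x) <= normc c.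
  by rewrite /g /cres; case: ifP => // _; rewrite normc0 normc_ge0.
have ga x : ~ hcube a l x -> g x = 0 by move=> xa; rewrite /g /cres memNset.
have gi : cintegrable leb g.
  apply: Linfc_integrable; apply: (bounded_cube_integrable l0 mg gc) => x xa.
  by apply: ga => /hcube_cube /xa.
have bm : cmeasurable setT (fun x => f x - g x) by exact: cmeasurableB.
have bb : exists M, forall x, normc (f x - g x) <= M.
  by exists (M + normc c) => x; rewrite (le_trans (le_normcB _ _))// lerD.
have boff x : ~ cube a l x -> f x - g x = 0.
  by move=> xa; rewrite fa ?ga ?subrr// => /hcube_cube /xa.
have b0 : cintegral leb setT (fun x => f x - g x) = 0.
  rewrite cintegralB// (cintegral_cres_cst c mQ QV) /c mulrA.
  rewrite (_ : Complex V 0 * Complex V^-1 0 = 1) ?mul1r ?subrr//.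
  rewrite -[LHS]/(Complex (V / V - 0 * 0) (V * 0 + 0 * V^-1)).
  by rewrite !mulr0 mul0r subr0 addr0 divff// gt_eqF.
exists g, [:: Atom l0 bm bb boff b0]; split => //.
- by move=> x; rewrite big_seq1 /=; ring.
- by split => // x; exact: le_trans (gc x) ct.
- rewrite !big_seq1 -[at_side _]/l -[at_fun _]/(fun x => f x - g x).
  split; first by rewrite -EFinM.
  apply: le_trans (integral_normcD leb measurableT mf (cmeasurableN mg)) _.
  under [X in (_ + X)%E]eq_integral do rewrite normcN.
  rewrite (_ : 3%:E = 1 + 2%:E)%E; last by rewrite -EFinD; congr EFin; ring.
  by rewrite ge0_muleDl// mul1e; exact: leeD.
Qed.

(** Induction on the generation: children of mean at most [t] are decomposed further, the others are
    stopped. At generation 0 the function is a constant of size at most [t], hence good; this takes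
    the place of Lebesgue differentiation. *)
Lemma calderon_zygmund d a l (t M : R) f : 0 < l -> 0 < t -> cmeasurable setT f ->
  (forall x, normc (f x) <= M) -> stepf d a l f ->
  (\int[leb]_x (normc (f x))%:E <= (t * l ^+ n)%:E)%E ->
  exists g s, cz_spec a l t f g s.
Proof.
elim: d a l f => [|d ih] a l f l0 t0 mf fM sf ft.
  have [c fE] := stepf0_cst l0 sf.
  have ln0 : 0 < l ^+ n by rewrite exprn_gt0.
  have ct : normc c <= t.
    move: ft; rewrite fE (integral_cres_cst _ (measurable_hcube _ _) (lebesgue_hcube _ (ltW l0))).
    by rewrite lee_fin ler_pM2r.
  exists f, [::]; split => //.
  - by move=> x; rewrite big_nil addr0.
  - split; last by case: sf.
    move=> x; apply: (@le_trans _ _ t).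
      by rewrite fE /cres; case: ifP => // _; rewrite normc0 ltW.
    by rewrite ler_peMl ?cz_const_ge1 ?(ltW t0).
  - by rewrite lee_pemull ?integral_normc_ge0// lee_fin ler1n.
  - rewrite !big_nil mule0; split; first exact: integral_normc_ge0.
    by rewrite mule_ge0// integral_normc_ge0.
pose Q s := hcube (sub_corner a l s) (l / 2).
pose fs s := cres (Q s) f.
have mQ s : measurable (Q s) by exact: measurable_hcube.
have l20 : 0 < l / 2 by rewrite divr_gt0.
have mfs s : cmeasurable setT (fs s) by exact: cmeasurable_res.
have fsM s x : normc (fs s x) <= M.
  rewrite /fs /cres; case: ifP => // _; rewrite normc0.
  by apply: le_trans (fM 0); exact: normc_ge0.
(* The children are disjoint, so a sum over them has at most one nonzero term at each point. Hence
   L^1 norms add up and sup bounds do not accumulate. *)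
have one (G : {ffun 'I_n -> bool} -> F) x s : (forall t x, ~ Q t x -> G t x = 0) -> Q s x ->
    forall t, t != s -> G t x = 0.
  move=> G0 xs u us; apply: G0 => xu; move/eqP: us; apply.
  exact: sub_hcube_inj xu xs.
have sumG (G : {ffun 'I_n -> bool} -> F) x s : (forall t x, ~ Q t x -> G t x = 0) -> Q s x ->
    \sum_t G t x = G s x.
  move=> G0 xs; rewrite (bigD1 s)//= big1 ?addr0// => u us; exact: one G0 xs _ us.
have fs0 s x : ~ Q s x -> fs s x = 0 by move=> xs; rewrite /fs /cres memNset.
have Qdec x : (exists s, Q s x) \/ (forall s, ~ Q s x).
  by have [?|/forallNP] := pselect (exists s, Q s x); [left|right].
have fE x : f x = \sum_s fs s x.
  have [[s xs]|nx] := Qdec x; first by rewrite (sumG _ _ _ fs0 xs) /fs /cres mem_set.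
  rewrite big1; last by move=> s _; exact: fs0.
  by case: sf => f0 _; apply: f0 => /sub_hcube_ex[s]; exact: nx.
have If : (\int[leb]_x (normc (f x))%:E = \sum_s \int[leb]_x (normc (fs s x))%:E)%E.
  rewrite -ge0_integral_sum//.
  - apply: eq_integral => x _; rewrite sumEFin; congr EFin.
    have [[s xs]|nx] := Qdec x.
      rewrite fE (sumG _ _ _ fs0 xs) (bigD1 s)//= big1 ?addr0// => u us.
      by rewrite (one _ _ _ fs0 xs _ us) normc0.
    rewrite fE !big1 ?normc0// => s _; last exact: fs0.
    by rewrite fs0// normc0.
  - by move=> s; exact: measurable_enormc.
  - by move=> s x _; rewrite lee_fin normc_ge0.
have fsle s : (\int[leb]_x (normc (fs s x))%:E <= \int[leb]_x (normc (f x))%:E)%E.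
  rewrite If (bigD1 s)//= leeDl// sume_ge0// => u _; exact: integral_normc_ge0.
have /choice[gs /choice[ss H]] : forall s, exists g S, cz_spec (sub_corner a l s) (l / 2) t (fs s) g S.
  move=> s.
  have [h|h] := leP (\int[leb]_x (normc (fs s x))%:E)%E (t * (l / 2) ^+ n)%:E.
    by apply: ih => //; exact: stepf_sub.
  apply: (cz_selected l20 t0 (mfs s) (fsM s) (fs0 s) (ltW h)).
  (* The whole cube has mean at most [t], and a child has [2 ^- n] of its volume. *)
  apply: le_trans (fsle s) _; apply: le_trans ft _.
  by rewrite lee_fin -mulrA -exprMn mulrCA divff// mulr1.
exists (fun x => \sum_s gs s x), (flatten [seq ss s | s <- index_enum _]).
have gs0 s x : ~ Q s x -> gs s x = 0 by case: (H s) => _ _ [_ h] _ _; exact: h.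
split.
- move=> x; rewrite big_flatten big_map -big_split /= fE; apply: eq_bigr => s _.
  by case: (H s).
- by apply: cmeasurable_sum => s; case: (H s).
- split=> x.
    have [[s xs]|nx] := Qdec x; first by rewrite (sumG _ _ _ gs0 xs); case: (H s) => _ _ [].
    rewrite big1 ?normc0 ?mulr_ge0 ?(ltW t0)// ?(le_trans ler01 cz_const_ge1)// => s _; exact: gs0.
  move=> xa; rewrite big1// => s _; apply: gs0 => /sub_hcube; apply: contra_not xa; exact.
- rewrite If ge0_sume_distrr; last by move=> s _; exact: integral_normc_ge0.
  apply: (@le_trans _ _ (\int[leb]_x \sum_s (normc (gs s x))%:E)%E).
    apply: ge0_le_integral => //.
    + by move=> x _; rewrite lee_fin normc_ge0.
    + by apply: measurable_enormc; apply: cmeasurable_sum => s; case: (H s).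
    + by apply: emeasurable_sum => s; apply: measurable_enormc; case: (H s).
    + by move=> x _; rewrite sumEFin lee_fin le_normc_sum.
  rewrite ge0_integral_sum//.
  + by apply: lee_sum => s _; case: (H s).
  + by move=> s; apply: measurable_enormc; case: (H s).
  + by move=> s x _; rewrite lee_fin normc_ge0.
- split.
    rewrite big_flatten big_map -sumEFin ge0_sume_distrr; last first.
      move=> s _; rewrite lee_fin sumr_ge0// => p _.
      by rewrite exprn_ge0// ltW// at_side_gt0.
    by rewrite If; apply: lee_sum => s _; case: (H s) => _ _ _ _ [].
  rewrite big_flatten big_map If ge0_sume_distrr; last by move=> s _; exact: integral_normc_ge0.
  by apply: lee_sum => s _; case: (H s) => _ _ _ _ [].
Qed.

End calderon_zygmund.

(** * Comparison of measures and Chebyshev's inequality *)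

Section measure_helpers.
Context d (T : measurableType d) (R : realType) (mu : {measure set T -> \bar R}).
Local Open Scope ereal_scope.

Lemma le_measure_ae (S S' : set T) : measurable S -> measurable S' ->
  (\forall x \ae mu, S x -> S' x) -> mu S <= mu S'.
Proof.
move=> mS mS' SS'; rewrite -(setIT S) -(setIT S') -!integral_indic//.
apply: ae_ge0_le_integral => //.
- by apply/measurable_EFinP; exact: measurable_indic.
- by apply/measurable_EFinP; exact: measurable_indic.
apply: filterS SS' => x h _; rewrite lee_fin !indicE.
by case: (boolP (x \in S)) => // /set_mem/h xS'; rewrite mem_set.
Qed.

Lemma chebyshev_gt (D : set T) (h : T -> R) (c : R) : measurable D -> (0 <= c)%R ->
  measurable_fun setT h -> (forall x, 0 <= h x)%R ->
  c%:E * mu (D `&` [set x | (c < h x)%R]) <= \int[mu]_(x in D) (h x)%:E.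
Proof.
move=> mD c0 mh h0.
have mE : measurable [set x | (c < h x)%R] by exact: measurable_gt.
have mi : measurable_fun D (fun x => (\1_[set x | (c < h x)%R] x)%:E : \bar R).
  by apply/measurable_EFinP; exact: measurable_indic.
rewrite setIC -integral_indic// -ge0_integralZl//.
apply: ge0_le_integral => //.
- by move=> x _; rewrite mule_ge0// lee_fin.
- exact: measurable_funeM.
- by apply/measurable_EFinP; exact: measurable_funTS.
move=> x _; rewrite -EFinM lee_fin indicE.
by case: (boolP (x \in _)) => [/set_mem/ltW|_]; rewrite ?mulr1 ?mulr0.
Qed.

End measure_helpers.

(** * Density of dyadic step functions in L^1 *)

Section density.
Context (R : realType) (n : nat).
Local Notation leb := (lebesgue_mx R 1 n).
Local Notation F := ('rV[R]_n -> R[i]).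
Variables (a : 'rV[R]_n) (l : R).
Hypothesis l0 : 0 < l.
Let Q := hcube a l.

Let mQ : measurable Q. Proof. exact: measurable_hcube. Qed.
Let QV : leb Q = (l ^+ n)%:E. Proof. by rewrite lebesgue_hcube// ltW. Qed.

Lemma leb_le (A E : set 'rV[R]_n) : measurable A -> measurable E -> A `<=` E ->
  (leb A <= leb E)%E.
Proof. by move=> mA mE AE; apply: le_measure; rewrite ?inE. Qed.

Lemma same_le d d' x y : (d <= d')%N -> same d' a l x y -> same d a l x y.
Proof.
move=> dd' xy j k; have := xy j (k * 2 ^ (d' - d))%N.
rewrite natrM natrX (_ : k%:R * 2 ^+ (d' - d) * (l / 2 ^+ d') = k%:R * (l / 2 ^+ d))//.
rewrite -mulrA; congr (_ * _); rewrite -{2}(subnK dd') exprD.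
by field; rewrite !gt_eqF ?exprn_gt0.
Qed.

(* Within Q, a union of dyadic subcubes of generation d. *)
Definition det (d : nat) (E : set 'rV[R]_n) := measurable E /\
  forall x y, Q x -> Q y -> same d a l x y -> E x -> E y.

Lemma same_sym d x y : same d a l x y -> same d a l y x.
Proof. by move=> xy j k; rewrite xy. Qed.

Lemma det_le d d' E : (d <= d')%N -> det d E -> det d' E.
Proof. by move=> dd' [mE dE]; split=> // x y xQ yQ /(same_le dd'); exact: dE. Qed.

Lemma detC d E : det d E -> det d (~` E).
Proof.
move=> [mE dE]; split; first exact: measurableC.
by move=> x y xQ yQ xy nE Ey; apply: nE; exact: dE yQ xQ (same_sym xy) Ey.
Qed.

Lemma detU d E E' : det d E -> det d E' -> det d (E `|` E').
Proof.
move=> [mE dE] [mE' dE']; split; first exact: measurableU.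
by move=> x y xQ yQ xy [Ex|Ex]; [left; exact: dE Ex|right; exact: dE' Ex].
Qed.

Definition symd (A E : set 'rV[R]_n) : set 'rV[R]_n := (A `\` E) `|` (E `\` A).

Lemma measurable_symd A E : measurable A -> measurable E -> measurable (symd A E).
Proof. by move=> mA mE; apply: measurableU; exact: measurableD. Qed.

(** Sets approximable in measure on [Q] by dyadic sets. They form a sigma-algebra containing the
    coordinate half-spaces, hence all Borel sets. *)
Definition apx (A : set 'rV[R]_n) := measurable A /\
  forall e, 0 < e -> exists d E, det d E /\ (leb (symd A E `&` Q) <= e%:E)%E.

Lemma det_apx d E : det d E -> apx E.
Proof.
move=> dE; split; first by case: dE.
move=> e e0; exists d, E; split => //.
by rewrite (_ : symd _ _ `&` Q = set0) ?measure0 ?lee_fin ?ltW// /symd setDv setU0 set0I.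
Qed.

Lemma apx0 : apx set0.
Proof. by apply: (@det_apx 0); split. Qed.

Lemma apxC A : apx A -> apx (~` A).
Proof.
move=> [mA hA]; split; first exact: measurableC.
move=> e e0; have [d [E [dE AE]]] := hA e e0; exists d, (~` E); split; first exact: detC.
by rewrite (_ : symd _ _ = symd A E)// /symd setDE setCK setIC setUC [~` E `\` _]setDE setCK [~` E `&` _]setIC.
Qed.

Lemma apxU A B : apx A -> apx B -> apx (A `|` B).
Proof.
move=> [mA hA] [mB hB]; split; first exact: measurableU.
move=> e e0; have e20 : 0 < e / 2 by rewrite divr_gt0.
have [d [E [dE AE]]] := hA _ e20; have [d' [E' [dE' BE]]] := hB _ e20.
exists (maxn d d'), (E `|` E'); split.
  by apply: detU; [exact: det_le (leq_maxl _ _) dE|exact: det_le (leq_maxr _ _) dE'].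
have mAE : measurable (symd A E `&` Q) by apply: measurableI => //; apply: measurable_symd => //; case: dE.
have mBE : measurable (symd B E' `&` Q) by apply: measurableI => //; apply: measurable_symd => //; case: dE'.
apply: (@le_trans _ _ (leb ((symd A E `&` Q) `|` (symd B E' `&` Q)))).
  apply: leb_le.
  - apply: measurableI => //; apply: measurable_symd; first exact: measurableU.
    by apply: measurableU; [case: dE|case: dE'].
  - exact: measurableU.
  move=> x [[[[Ax|Bx] nE]|[[Ex|Ex] nA]] xQ].
  - by left; split=> //; left; split=> // Ex; apply: nE; left.
  - by right; split=> //; left; split=> // Ex; apply: nE; right.
  - by left; split=> //; right; split=> // Ax; apply: nA; left.
  - by right; split=> //; right; split=> // Ax; apply: nA; right.
apply: le_trans (measureU2 _ mAE mBE) _.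
by rewrite [e](splitr e) EFinD; exact: leeD.
Qed.

(** [Q] has finite measure, so a finite union [B k] misses little of the whole union inside [Q]; a
    dyadic set close to [B k] then serves. *)
Lemma apx_bigcup (A : (set 'rV[R]_n)^nat) : (forall k, apx (A k)) -> apx (\bigcup_k A k).
Proof.
move=> hA; have mA k : measurable (A k) by case: (hA k).
have mU : measurable (\bigcup_k A k) by exact: bigcupT_measurable.
split => // e e0; have e20 : 0 < e / 2 by rewrite divr_gt0.
pose B k := \big[setU/set0]_(j < k) A j.
have apxB k : apx (B k).
  rewrite /B; elim: k => [|k ih]; first by rewrite big_ord0; exact: apx0.
  by rewrite big_ord_recr /=; exact: apxU.
have mB k : measurable (B k) by case: (apxB k).
have BU k : B k `<=` \bigcup_k A k.
  by rewrite /B -bigcup_mkord => x [j _ Ajx]; exists j.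
pose C k := ((\bigcup_k A k) `\` B k) `&` Q.
have mC k : measurable (C k) by apply: measurableI => //; exact: measurableD.
have C0 : \bigcap_k C k = set0.
  apply/seteqP; split=> // x Cx; have [[[k _ Akx] _] _] := Cx 0%N I.
  have [[_ nB] _] := Cx k.+1 I; apply: nB.
  by rewrite /B -bigcup_mkord; exists k => //=.
have C0fin : (leb (C 0%N) < +oo)%E.
  apply: (@le_lt_trans _ _ (leb Q)); last by have /= -> := QV; rewrite ltry.
  by apply: leb_le => //; exact: subIsetr.
have hCs k j : (k <= j)%N -> C j `<=` C k.
  move=> kj x [[Ux nB] Qx]; split=> //; split=> // Bx; apply: nB.
  move: Bx; rewrite /B -!bigcup_mkord => -[p /= pk Ap]; exists p => //=; exact: leq_trans pk kj.
have hC : {homo C : k j / (k <= j)%N >-> (j <= k)%O} by move=> k j /hCs/subsetPset.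
have := nonincreasing_cvg_mu C0fin mC _ hC; rewrite C0 measure0 => /(_ measurable0).
move=> /fine_cvgP[_ /cvgrPdist_le /(_ _ e20)] [k _ /(_ k (leqnn k))] /=.
rewrite sub0r normrN ger0_norm ?fine_ge0// => Ck.
have Cke : (leb (C k) <= (e / 2)%:E)%E.
  have kC : (leb (C k) <= leb (C 0%N))%E.
    exact: (leb_le (mC _) (mC _) (hCs _ _ (leq0n k))).
  have fk : leb (C k) \is a fin_num.
    by rewrite ge0_fin_numE; [exact: le_lt_trans kC C0fin|exact: measure_ge0].
  by rewrite -(fineK fk) lee_fin.
have [_ /(_ _ e20)[d [E [dE BE]]]] := apxB k; exists d, E; split => //.
have mE : measurable E by case: dE.
have mBE : measurable (symd (B k) E `&` Q).
  exact: (measurableI _ _ (measurable_symd (mB k) mE) mQ).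
apply: (@le_trans _ _ (leb (C k `|` (symd (B k) E `&` Q)))).
  apply: leb_le.
  - exact: (measurableI _ _ (measurable_symd mU mE) mQ).
  - exact: measurableU.
  move=> x [[[Ux nE]|[Ex nU]] Qx].
    have [Bx|nB] := pselect (B k x); first by right; split=> //; left.
    by left.
  by right; split=> //; right; split=> // /BU.
apply: le_trans (measureU2 _ (mC k) mBE) _.
by rewrite [e](splitr e) EFinD; exact: leeD.
Qed.

(** Below the corner the half-space misses [Q]. Otherwise it is the union over [N] of the
    half-spaces cut at the last grid line of mesh [l / 2 ^+ N] not exceeding [c], and each of these
    is dyadic. *)
Lemma apx_halfspace (j : 'I_n) (c : R) : apx [set x | x 0 j < c].
Proof.
have mlt (z : R) : measurable [set x : 'rV[R]_n | x 0 j < z].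
  by apply: measurable_of_bool; apply: measurable_fun_ltr => //; exact: measurable_entry.
have [ca|ac] := ltP c (a 0 j).
  split; first exact: mlt.
  move=> e e0; exists 0%N, set0; split; first by split.
  rewrite (_ : _ `&` Q = set0) ?measure0 ?lee_fin ?ltW//.
  apply/seteqP; split=> // x [[[/= xc _]|[]]//] Qx.
  by have /andP[h _] := Qx j; have := lt_trans xc ca; rewrite ltNge h.
pose h (N : nat) := l / 2 ^+ N.
have h0 N : 0 < h N by rewrite divr_gt0// exprn_gt0.
pose k N := Num.truncn ((c - a 0 j) / h N).
have k1 N : (k N)%:R * h N <= c - a 0 j.
  by rewrite -ler_pdivlMr// truncn_le divr_ge0 ?(ltW (h0 N))// subr_ge0.
have k2 N : c - a 0 j < (k N)%:R * h N + h N.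
  have /truncn_itv/andP[_] : 0 <= (c - a 0 j) / h N.
    by rewrite divr_ge0 ?(ltW (h0 N))// subr_ge0.
  by rewrite ltr_pdivrMr// -natr1 mulrDl mul1r.
rewrite [X in apx X](_ : _ = \bigcup_N [set x : 'rV[R]_n | x 0 j < a 0 j + (k N)%:R * h N]).
  apply: apx_bigcup => N; apply: (@det_apx N); split; first exact: mlt.
  move=> x y xQ yQ xy /=.
  by have := xy j (k N); rewrite -/(h N) !lerBrDl => e; rewrite !ltNge e.
apply/seteqP; split => [x /= xc|x [N _ /= xN]]; last first.
  by apply: lt_le_trans xN _; rewrite -lerBrDl.
have d0 : 0 < c - x 0 j by rewrite subr_gt0.
pose N := Num.truncn (l / (c - x 0 j)); exists N => //=.
have hN : h N < c - x 0 j.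
  rewrite /h ltr_pdivrMr ?exprn_gt0// mulrC -ltr_pdivrMr//.
  have /truncn_itv/andP[_ h1] : 0 <= l / (c - x 0 j) by rewrite divr_ge0// ltW.
  apply: lt_le_trans h1 _; rewrite -natrX ler_nat; exact: ltn_expl.
have := k2 N; lra.
Qed.

Lemma apx_measurable A : measurable A -> apx A.
Proof.
move=> mA.
have sa : sigma_algebra setT apx.
  split; [exact: apx0|by move=> B hB; rewrite setTD; exact: apxC|exact: apx_bigcup].
pose S : measurableType _ := g_sigma_algebraType apx.
(* With [apx] as sigma-algebra on the source, measurability of the identity says that every Borel
   set is in [apx]. It is checked on entries, where open half-lines generate. *)
have mid : measurable_fun setT (id : S -> 'rV[R]_n).
  apply: measurable_mx => i j; rewrite (ord1 i).
  apply: (measurability _ (RGenInftyO.measurableE R)) => _ [_ [c ->] <-].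
  rewrite setTI; apply: sub_sigma_algebra.
  rewrite (_ : _ @^-1` _ = [set x : 'rV[R]_n | x 0 j < c]); first exact: apx_halfspace.
  by apply/seteqP; split => x /=; rewrite in_itv.
have := mid measurableT A mA; rewrite setTI.
by rewrite -[measurable _]/(<<s apx >> A) sigma_algebra_id.
Qed.

Definition detf (d : nat) (v : F) := forall x y, Q x -> Q y -> same d a l x y -> v x = v y.

Lemma detf_le d d' v : (d <= d')%N -> detf d v -> detf d' v.
Proof. by move=> dd' dv x y xQ yQ /(same_le dd'); exact: dv. Qed.

Definition fapx (w : F) := cmeasurable setT w /\
  forall e, 0 < e -> exists d v, [/\ detf d v, cmeasurable setT v &
    (\int[leb]_(x in Q) (normc (w x - v x))%:E <= e%:E)%E].

Lemma fapxD w w' : fapx w -> fapx w' -> fapx (fun x => w x + w' x).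
Proof.
move=> [mw hw] [mw' hw']; split; first exact: cmeasurableD.
move=> e e0; have e20 : 0 < e / 2 by rewrite divr_gt0.
have [d [v [dv mv vw]]] := hw _ e20; have [d' [v' [dv' mv' vw']]] := hw' _ e20.
exists (maxn d d'), (fun x => v x + v' x); split.
- move=> x y xQ yQ xy; congr (_ + _).
    exact: (detf_le (leq_maxl _ _) dv).
  exact: (detf_le (leq_maxr _ _) dv').
- exact: cmeasurableD.
have -> : (fun x => (normc (w x + w' x - (v x + v' x)))%:E) =
    (fun x => (normc ((w x - v x) + (w' x - v' x)))%:E).
  by apply/funext => x; congr (normc _)%:E; ring.
apply: le_trans (integral_normcD leb mQ (cmeasurableB mw mv) (cmeasurableB mw' mv')) _.
by rewrite [e](splitr e) EFinD; exact: leeD.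
Qed.

Lemma fapxZ (c : R[i]) w : fapx w -> fapx (fun x => c * w x).
Proof.
move=> [mw hw]; split; first exact: cmeasurableZ.
move=> e e0; have c1 : 0 < normc c + 1 by rewrite ltr_wpDl// normc_ge0.
have e20 : 0 < e / (normc c + 1) by rewrite divr_gt0.
have [d [v [dv mv vw]]] := hw _ e20; exists d, (fun x => c * v x); split.
- by move=> x y xQ yQ xy; rewrite (dv x y).
- exact: cmeasurableZ.
have mB : cmeasurable Q (fun x => w x - v x).
  by have [m1 m2] := cmeasurableB mw mv; split; exact: measurable_funTS.
under eq_integral do rewrite -mulrBr.
rewrite integral_normcZ//.
apply: le_trans (lee_wpmul2l _ vw) _; first by rewrite lee_fin normc_ge0.
by rewrite -EFinM lee_fin mulrCA ler_piMr ?(ltW e0)// ler_pdivrMr// mul1r lerDl.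
Qed.

Lemma fapx_cst (c : R[i]) : fapx (fun=> c).
Proof.
split; first exact: (cmeasurable_cst _ c).
move=> e e0; exists 0%N, (fun=> c); split => //.
by under eq_integral do rewrite subrr normc0; rewrite integral0 lee_fin ltW.
Qed.

Lemma fapx_sum (k : nat) (w : 'I_k -> F) : (forall j, fapx (w j)) ->
  fapx (fun x => \sum_j w j x).
Proof.
move=> hw; rewrite (_ : (fun x => _) = \big[(fun f g x => f x + g x)/(fun=> 0)]_j w j).
  by apply: (big_ind fapx) => //; [exact: fapx_cst|exact: fapxD].
by apply/funext => x; elim/big_rec2 : _ => // i y1 y2 _ ->.
Qed.

Lemma fapx_ind (A : set 'rV[R]_n) : measurable A -> fapx (cres A (fun=> 1)).
Proof.
move=> mA; have m1 E : measurable E -> cmeasurable setT (cres E (fun _ : 'rV[R]_n => 1 : R[i])).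
  by move=> mE; apply: cmeasurable_res => //; exact: (cmeasurable_cst _ 1).
split; first exact: m1.
move=> e e0; have [_ /(_ e e0)[d [E [[mE dE] AE]]]] := apx_measurable mA.
exists d, (cres E (fun=> 1)); split.
- move=> x y xQ yQ xy; rewrite /cres.
  case: (boolP (x \in E)) => [/set_mem Ex|/negP nEx].
    by rewrite mem_set//; exact: dE xQ yQ xy Ex.
  case: ifP => // /set_mem Ey; case: nEx; apply: mem_set.
  exact: dE yQ xQ (same_sym xy) Ey.
- exact: m1.
apply: le_trans AE; rewrite -integral_indic//; last exact: measurable_symd.
rewrite le_eqVlt; apply/orP; left; apply/eqP; apply: eq_integral => x _.
rewrite /cres indicE /symd; congr EFin.
case: (boolP (x \in A)) => [/set_mem Ax|/negP nA]; case: (boolP (x \in E)) => [/set_mem Ex|/negP nE].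
- by rewrite subrr normc0 memNset// => -[[_]|[_]].
- by rewrite subr0 normc1 mem_set//; left; split => // Ex; apply: nE; exact: mem_set.
- by rewrite sub0r normcN normc1 mem_set//; right; split => // Ax; apply: nA; exact: mem_set.
- by rewrite subrr normc0 memNset// => -[[Ax]|[Ex]] _; [apply: nA|apply: nE]; exact: mem_set.
Qed.

Lemma fapx_unif (w : F) : cmeasurable setT w ->
  (forall e, 0 < e -> exists2 w', fapx w' & forall x, normc (w x - w' x) <= e) -> fapx w.
Proof.
move=> mw hw; split => // e e0.
have L0 : 0 < l ^+ n by rewrite exprn_gt0.
have e10 : 0 < e / 2 / l ^+ n by rewrite !divr_gt0.
have e20 : 0 < e / 2 by rewrite divr_gt0.
have [w' [mw' hw'] ww'] := hw _ e10; have [d [v [dv mv wv]]] := hw' _ e20.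
exists d, v; split => //.
have -> : (fun x => (normc (w x - v x))%:E) =
    (fun x => (normc ((w x - w' x) + (w' x - v x)))%:E).
  by apply/funext => x; congr (normc _)%:E; ring.
apply: le_trans (integral_normcD leb mQ (cmeasurableB mw mw') (cmeasurableB mw' mv)) _.
rewrite [X in (_ <= X%:E)%E](splitr e) EFinD; apply: leeD => //.
apply: (@le_trans _ _ (\int[leb]_(x in Q) (e / 2 / l ^+ n)%:E)%E).
  apply: ge0_le_integral => //.
  - by move=> x _; rewrite lee_fin normc_ge0.
  - by apply: measurable_funTS; apply: measurable_enormc; exact: cmeasurableB.
  - by move=> x _; rewrite lee_fin.
rewrite integral_cst//; have /= -> := QV.
by rewrite -EFinM lee_fin divfK// gt_eqF.
Qed.

Lemma sum_ltn_min (L p : nat) : \sum_(k < L) (k < p)%N%:R = (minn p L)%:R :> R.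
Proof.
elim: L => [|L ih]; first by rewrite big_ord0 minn0.
rewrite big_ord_recr /= ih -natrD; congr (_%:R).
by have [h|h] := ltnP L p; rewrite /minn; case: ltnP; lia.
Qed.

(** Layer-cake: after a shift and scaling to [t >= 0], the integer part of [t] counts the levels
    [k.+1 <= t]. So [v] is within [1 / N] of a finite combination of indicators. *)
Lemma fapx_real (v : 'rV[R]_n -> R) (M : R) : measurable_fun setT v ->
  (forall x, `|v x| <= M) -> fapx (fun x => Complex (v x) 0).
Proof.
move=> mv vM; have M0 : 0 <= M by apply: le_trans (vM 0).
apply: fapx_unif; first by split => //=; exact: measurable_cst.
move=> e e0; pose N := (Num.truncn e^-1).+1.
have N0 : 0 < N%:R :> R by rewrite ltr0n.
have Ne : N%:R^-1 < e.
  rewrite invf_plt ?posrE//.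
  by have /truncn_itv/andP[] : 0 <= e^-1 by rewrite invr_ge0 ltW.
pose t x := (v x + M) * N%:R.
have t0 x : 0 <= t x.
  by rewrite mulr_ge0// -lerBlDr sub0r; have := vM x; rewrite ler_norml => /andP[].
pose L := (Num.truncn (2 * M * N%:R)).+1.
have tL x : (Num.truncn (t x) <= L)%N.
  apply: leqW; apply: le_truncn; rewrite ler_wpM2r//.
  by have := vM x; rewrite ler_norml => /andP[_]; lra.
pose A (k : nat) := [set x | k.+1%:R <= t x].
have mt : measurable_fun setT t.
  by apply: measurable_funM => //; exact: measurable_funD.
have mA k : measurable (A k) by exact: measurable_ge.
exists (fun x => Complex N%:R^-1 0 * (\sum_(k < L) cres (A k) (fun=> 1) x) + Complex (- M) 0).
  apply: fapxD; last exact: fapx_cst.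
  by apply: fapxZ; apply: fapx_sum => k; exact: fapx_ind.
move=> x.
have -> : \sum_(k < L) cres (A k) (fun=> 1) x = Complex (Num.truncn (t x))%:R 0 :> R[i].
  transitivity (\sum_(k < L) Complex (k < Num.truncn (t x))%N%:R 0 : R[i]).
    apply: eq_bigr => k _; rewrite /cres truncn_gt_nat.
    case: (boolP (x \in A k)) => [/set_mem|/negP nA]; first by rewrite /A /= => ->.
    by case: (boolP (k.+1%:R <= t x)) => // h; case: nA; apply: mem_set.
  transitivity (Complex (\sum_(k < L) (k < Num.truncn (t x))%N%:R) 0 : R[i]).
    by elim/big_rec2 : _ => // k y1 y2 _ ->; apply/eqP; rewrite eq_complex /= addr0 !eqxx.
  by rewrite sum_ltn_min (minn_idPl (tL x)).
set p := Num.truncn (t x).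
rewrite (_ : _ - _ = Complex (v x - (N%:R^-1 * p%:R - M)) 0); last first.
  by apply/eqP; rewrite eq_complex /=; apply/andP; split; apply/eqP; ring.
have /truncn_itv/andP[p1 p2] := t0 x.
have -> : v x - (N%:R^-1 * p%:R - M) = (t x - p%:R) / N%:R.
  by rewrite /t; field; rewrite gt_eqF.
rewrite normc_real; last by rewrite divr_ge0// subr_ge0.
apply: le_trans (ltW Ne); rewrite ler_pdivrMr// mulVf ?gt_eqF//.
by rewrite lerBlDr addrC natr1 ltW.
Qed.

Lemma fapx_bounded (u : F) (M : R) : cmeasurable setT u -> (forall x, normc (u x) <= M) -> fapx u.
Proof.
move=> [mr mi] uM.
rewrite (_ : u = fun x => Complex (Re (u x)) 0 + Complex 0 1 * Complex (Im (u x)) 0).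
  apply: fapxD; last apply: fapxZ.
    by apply: (fapx_real (M := M)) => // x; exact: le_trans (normRe_le _) (uM x).
  by apply: (fapx_real (M := M)) => // x; exact: le_trans (normIm_le _) (uM x).
apply/funext => x; case: (u x) => p q; apply/eqP; rewrite eq_complex /=.
by apply/andP; split; apply/eqP; ring.
Qed.

(** The approximant is set to 0 where it exceeds [2 * M]. There its distance to [u] was more than
    [M], so the cut does not increase the error, and it depends only on values of the approximant,
    so the step property survives. *)
Lemma density_stepf (u : F) (M e : R) : cmeasurable setT u -> (forall x, normc (u x) <= M) ->
  (forall x, ~ Q x -> u x = 0) -> 0 < e ->
  exists d v, [/\ stepf d a l v, cmeasurable setT v, (forall x, normc (v x) <= 2 * M) &
    (\int[leb]_x (normc (u x - v x))%:E <= e%:E)%E].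
Proof.
move=> mu uM uQ e0; have M0 : 0 <= M by apply: le_trans (uM 0); exact: normc_ge0.
have [_ /(_ e e0)[d [v [dv mv uv]]]] := fapx_bounded mu uM.
pose v' := cres Q (cres [set x | normc (v x) <= 2 * M] v).
have v'M x : normc (v' x) <= 2 * M.
  rewrite /v' /cres; case: ifP => _; last by rewrite normc0 mulr_ge0.
  by case: ifP => [/set_mem//|_]; rewrite normc0 mulr_ge0.
have mv' : cmeasurable setT v'.
  by apply: cmeasurable_res => //; apply: cmeasurable_res => //; exact: measurable_normc_le.
exists d, v'; split => //.
  split=> [x nQ|x y xQ yQ xy]; first by rewrite /v' /cres memNset.
  rewrite /v' /cres (mem_set xQ) (mem_set yQ).
  have e1 := dv x y xQ yQ xy.
  case: (boolP (x \in _)) => [/set_mem /= h|/negP nh].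
    by rewrite mem_set//= -e1.
  by case: ifP => // /set_mem /= h; case: nh; apply: mem_set; rewrite /= e1.
apply: le_trans uv; rewrite [leRHS]integral_mkcond.
apply: ge0_le_integral => //.
- by move=> x _; rewrite lee_fin normc_ge0.
- by apply: measurable_enormc; exact: cmeasurableB.
- apply/(measurable_restrictT _ mQ); apply: measurable_funTS.
  by apply: measurable_enormc; exact: cmeasurableB.
move=> x _; rewrite patchE /v'.
case: (boolP (x \in Q)) => [/set_mem xQ|/negP nQ]; last first.
  have nQ' : ~ Q x by move=> h; apply: nQ; exact: mem_set.
  by rewrite uQ// /cres memNset// subrr normc0.
rewrite lee_fin /cres (mem_set xQ).
case: (boolP (x \in _)) => [//|/negP nh]; rewrite subr0.
have h : 2 * M < normc (v x) by rewrite ltNge; apply/negP => h; apply: nh; exact: mem_set.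
have := le_normcD (v x - u x) (u x); rewrite subrK normcB_sym => h2.
have := uM x; lra.
Qed.

End density.

(** * Calculus of weak L^1 bounds *)

Section weak_quasinorm.
Context (R : realType) (n : nat).
Local Notation leb := (lebesgue_mx R 1 n).
Local Notation F := ('rV[R]_n -> R[i]).
Implicit Types (X Y : F) (c e : R).

Definition weakL1_le X c := forall lam, 0 < lam ->
  (lam%:E * leb [set x | (lam < normc (X x))%R] <= c%:E)%E.

Lemma weakL1_le_mono X c e : c <= e -> weakL1_le X c -> weakL1_le X e.
Proof. by move=> ce Xc lam l0; apply: le_trans (Xc _ l0) _; rewrite lee_fin. Qed.

Lemma weakL1_le_ae X Y c : cmeasurable setT X -> cmeasurable setT Y -> (\forall x \ae leb, X x = Y x) ->
  weakL1_le X c -> weakL1_le Y c.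
Proof.
move=> mX mY XY Xc lam l0; apply: le_trans (Xc _ l0).
apply: lee_wpmul2l; first by rewrite lee_fin ltW.
apply: le_measure_ae; [exact: measurable_normc_gt..|].
by apply: filterS XY => x /= ->.
Qed.

(** Splitting the level [lam] into halves costs the factor 2 of a quasinorm. *)
Lemma weakL1_leD X Y c e : cmeasurable setT X -> cmeasurable setT Y -> weakL1_le X c -> weakL1_le Y e ->
  weakL1_le (fun x => X x + Y x) (2 * (c + e)).
Proof.
move=> mX mY Xc Ye lam l0; have l20 : 0 < lam / 2 by rewrite divr_gt0.
have m1 := measurable_normc_gt (lam / 2) mX; have m2 := measurable_normc_gt (lam / 2) mY.
have h : (leb [set x | (lam < normc (X x + Y x))%R] <=
   leb [set x | (lam / 2 < normc (X x))%R] + leb [set x | (lam / 2 < normc (Y x))%R])%E.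
  apply: le_trans (measureU2 _ m1 m2); apply: le_measure_ae.
  - by apply: (measurable_normc_gt (f := fun x => X x + Y x)); exact: cmeasurableD.
  - exact: measurableU.
  apply: nearW => x /= xl; have := le_normcD (X x) (Y x).
  by have [?|?] := ltP (lam / 2) (normc (X x)); [left|right; rewrite /=; lra].
apply: le_trans (lee_wpmul2l _ h) _; first by rewrite lee_fin ltW.
have E : lam%:E = (2%:E * (lam / 2)%:E)%E by rewrite -EFinM; congr EFin; field.
rewrite ge0_muleDr// mulrDr EFinD E; apply: leeD; rewrite -muleA [leRHS]EFinM.
  by apply: lee_wpmul2l => //; exact: Xc.
by apply: lee_wpmul2l => //; exact: Ye.
Qed.

Lemma weakL1_leZ (a : R[i]) X c : weakL1_le X c -> weakL1_le (fun x => a * X x) (normc a * c).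
Proof.
move=> Xc lam l0; have [->|a0] := eqVneq a 0.
  rewrite (_ : [set x | _] = set0) ?measure0 ?mule0 ?normc0 ?mul0r//.
  by apply/seteqP; split => // x /=; rewrite mul0r normc0; lra.
have na : 0 < normc a by rewrite lt_def normc_eq0 a0 normc_ge0.
rewrite (_ : [set x | _] = [set x | lam / normc a < normc (X x)]); last first.
  by apply/seteqP; split => x /=; rewrite normcM ltr_pdivrMr// mulrC.
have E : lam%:E = ((normc a)%:E * (lam / normc a)%:E)%E.
  by rewrite -EFinM; congr EFin; field; rewrite gt_eqF.
rewrite E -muleA [leRHS]EFinM; apply: lee_wpmul2l; first by rewrite lee_fin ltW.
by apply: Xc; rewrite divr_gt0.
Qed.

Lemma weakL1_le0_ae X : cmeasurable setT X -> (forall e, 0 < e -> weakL1_le X e) -> \forall x \ae leb, X x = 0.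
Proof.
move=> mX Xe.
have h (k : nat) : \forall x \ae leb, normc (X x) <= k.+1%:R^-1.
  have k0 : 0 < k.+1%:R^-1 :> R by rewrite invr_gt0 ltr0n.
  have mE := measurable_normc_gt k.+1%:R^-1 mX.
  exists [set x | k.+1%:R^-1 < normc (X x)]; split => //.
    apply/eqP; rewrite eq_le measure_ge0 andbT; apply/lee_addgt0Pr => e e0.
    have e1 : 0 < k.+1%:R^-1 * e by rewrite mulr_gt0.
    by have := Xe _ e1 _ k0; rewrite EFinM lee_pmul2l// add0e.
  by move=> x /= /negP; rewrite -ltNge.
apply: filterS (ae_foralln h) => x xh; apply/eqP; rewrite -normc_eq0 eq_le normc_ge0 andbT.
apply/ler_addgt0Pr => e e0; rewrite add0r.
have := xh (Num.truncn e^-1) => /le_trans; apply.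
rewrite invf_ple ?posrE ?ltr0n//.
by have /truncn_itv/andP[_ /ltW] : 0 <= e^-1 by rewrite invr_ge0 ltW.
Qed.

End weak_quasinorm.

(** * Almost everywhere limits of fast Cauchy sequences *)

Section limits.
Context (R : realType).

(* Adding the geometric tail [2 / 2 ^ k] to [u] makes it nonincreasing. *)
Lemma geometric_steps_cvg (u : R^nat) (N : nat) :
  (forall k, (N <= k)%N -> `|u k.+1 - u k| <= (2 ^+ k)^-1) -> exists L : R, u @ \oo --> L.
Proof.
move=> uN; have p0 k : 0 < (2 ^+ k)^-1 :> R by rewrite invr_gt0 exprn_gt0.
have pS k : (2 ^+ k.+1)^-1 = (2 ^+ k)^-1 / 2 :> R by rewrite exprS invfM mulrC.
pose v k := u (k + N)%N + 2 * (2 ^+ (k + N))^-1.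
pose w k := u (k + N)%N - 2 * (2 ^+ (k + N))^-1.
have step k : `|u (k + N).+1 - u (k + N)%N| <= (2 ^+ (k + N))^-1 by apply: uN; exact: leq_addl.
have vS k : v k.+1 <= v k.
  by have := step k; rewrite ler_norml /v addSn pS => /andP[h1 h2]; lra.
have wS k : w k <= w k.+1.
  by have := step k; rewrite ler_norml /w addSn pS => /andP[h1 h2]; lra.
have wv k : w 0%N <= v k.
  apply: (@le_trans _ _ (w k)); last by have := p0 (k + N)%N; rewrite /w /v; lra.
  by elim: k => // k ih; exact: le_trans ih (wS k).
have cv : cvgn v.
  apply: nonincreasing_is_cvgn; first exact/nonincreasing_seqP.
  by exists (w 0%N) => _ [k _ <-].
pose p (k : nat) : R := 2 * (2 ^+ (k + N))^-1.
pose z : R := 2 * ((2 ^+ N)^-1 * 0).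
have cp : p @ \oo --> z.
  apply: cvgM; first exact: cvg_cst.
  rewrite (_ : (fun k => _) = (fun k => (2 ^+ N)^-1 * (2^-1) ^+ k)); last first.
    by apply/funext => k; rewrite exprD invfM mulrC exprVn.
  apply: cvgM; first exact: cvg_cst.
  by apply: cvg_expr; rewrite ger0_norm// invf_lt1// ltr1n.
exists (limn v - z); rewrite -(cvg_shiftn N).
rewrite (_ : [sequence u (k + N)%N]_k = v \- p); last first.
  by apply/funext => k; rewrite /v /p /=; ring.
exact: cvgB.
Qed.

End limits.

Section weak_limits.
Context (R : realType) (n : nat).
Local Notation leb := (lebesgue_mx R 1 n).
Local Notation F := ('rV[R]_n -> R[i]).

Lemma measure_bigcup_le (B : (set 'rV[R]_n)^nat) (c : \bar R) :
  (forall k, measurable (B k)) -> (forall k j, (k <= j)%N -> B k `<=` B j) ->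
  (forall k, (leb (B k) <= c)%E) -> (leb (\bigcup_k B k) <= c)%E.
Proof.
move=> mB ndB Bc.
have mU : measurable (\bigcup_k B k) by exact: bigcupT_measurable.
have hB : {homo B : k j / (k <= j)%N >-> (k <= j)%O} by move=> k j /ndB/subsetPset.
have cB := nondecreasing_cvg_mu (mu := leb) mB mU hB.
have <- := cvg_lim (@ereal_hausdorff R) cB.
apply: lime_le; first by apply/cvg_ex; eexists; exact: cB.
by apply: nearW => k; exact: Bc.
Qed.

(** Borel-Cantelli: at level [2 ^- k] a step of weak size [c * 4 ^- k] is exceeded on a set of
    measure at most [c * 2 ^- k]. *)
Lemma ae_steps_eventually (h : nat -> F) (c : R) : 0 <= c -> (forall k, cmeasurable setT (h k)) ->
  (forall k, weakL1_le (fun x => h k.+1 x - h k x) (c * (4 ^+ k)^-1)) ->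
  \forall x \ae leb, exists N, forall k, (N <= k)%N -> normc (h k.+1 x - h k x) <= (2 ^+ k)^-1.
Proof.
move=> c0 mh hw.
pose E k := [set x | (2 ^+ k)^-1 < normc (h k.+1 x - h k x)].
have mE k : measurable (E k).
  by apply: (measurable_normc_gt (f := fun x => h k.+1 x - h k x)); exact: cmeasurableB.
have p0 k : 0 < (2 ^+ k)^-1 :> R by rewrite invr_gt0 exprn_gt0.
(* Written in the shape that [epsilon_trick0] sums. *)
have bE k : (leb (E k) <= (2 * c / (2 ^ k.+1)%:R)%:E)%E.
  apply: le_trans (lee_of_scale (p0 k) (hw k _ (p0 k))) _.
  rewrite lee_fin le_eqVlt natrX invrK exprS; apply/orP; left; apply/eqP.
  have -> : 4 ^+ k = 2 ^+ k * 2 ^+ k :> R by rewrite -exprMn; congr (_ ^+ _); ring.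
  by field; rewrite gt_eqF// exprn_gt0.
have sE : (\sum_(k <oo) leb (E k) < +oo)%E.
  apply: (@le_lt_trans _ _ (\sum_(k <oo) (2 * c / (2 ^ k.+1)%:R)%:E)%E).
    by apply: lee_nneseries => k _.
  apply: le_lt_trans (epsilon_trick0 xpredT _) _; first by rewrite mulr_ge0.
  exact: ltry.
exists (lim_sup_set E); split.
- apply: bigcapT_measurable => k; apply: bigcup_measurable => j _; exact: mE.
- exact: (lim_sup_set_cvg0 mE sE).
move=> x /= nx k _; apply: contrapT => nk; apply: nx; exists k => j kj.
by rewrite leNgt; apply/negP => hj; apply: nk; exists j.
Qed.

Lemma ae_limit (h : nat -> F) (c : R) : 0 <= c -> (forall k, cmeasurable setT (h k)) ->
  (forall k, weakL1_le (fun x => h k.+1 x - h k x) (c * (4 ^+ k)^-1)) ->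
  exists s : F, cmeasurable setT s /\
    \forall x \ae leb, forall e, 0 < e -> exists N, forall k, (N <= k)%N -> normc (h k x - s x) <= e.
Proof.
move=> c0 mh hw.
(* The upper limit is measurable everywhere and equals the limit where there is one; [fine] sends
   infinite values, met only on the null set, to 0. *)
pose lr (u : nat -> 'rV[R]_n -> R) x := fine (limn_esup (fun k => (u k x)%:E)).
have mlr u : (forall k, measurable_fun setT (u k)) -> measurable_fun setT (lr u).
  move=> mu; apply: (measurableT_comp (fine_measurable measurableT)).
  by apply: measurable_fun_limn_esup => k; apply/measurable_EFinP.
have lrE u x (L : R) : (fun k => u k x) @ \oo --> L -> lr u x = L.
  move=> uL; have uL' : (u k x)%:E @[k --> \oo] --> L%:E.
    by apply: cvg_EFin => //; exact: nearW.
  by rewrite /lr (cvg_limn_einf_sup uL').2.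
exists (fun x => Complex (lr (fun k x => Re (h k x)) x) (lr (fun k x => Im (h k x)) x)); split.
  by split => /=; apply: mlr => k; case: (mh k).
apply: filterS (ae_steps_eventually c0 mh hw) => x [N hN] e e0.
have [L1 c1] : exists L : R, (fun k => Re (h k x)) @ \oo --> L.
  apply: (@geometric_steps_cvg _ _ N) => k Nk; apply: le_trans (hN k Nk).
  by apply: le_trans (normRe_le _); rewrite ReD ReN.
have [L2 c2] : exists L : R, (fun k => Im (h k x)) @ \oo --> L.
  apply: (@geometric_steps_cvg _ _ N) => k Nk; apply: le_trans (hN k Nk).
  by apply: le_trans (normIm_le _); rewrite ImD ImN.
rewrite (lrE _ _ _ c1) (lrE _ _ _ c2).
have e20 : 0 < e / 2 by rewrite divr_gt0.
move/cvgrPdist_le : c1 => /(_ _ e20)[N1 _ h1]; move/cvgrPdist_le : c2 => /(_ _ e20)[N2 _ h2].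
exists (maxn N1 N2) => k; rewrite geq_max => /andP[k1 k2].
apply: le_trans (normc_le _) _; rewrite ReD ReN ImD ImN /=.
by rewrite [e]splitr lerD// distrC; [exact: h1|exact: h2].
Qed.

(** Fatou for level sets: a strict inequality at the limit holds for all late [h k], so the level
    set lies, up to a null set, in the increasing union of the tail intersections [B k]. Each [B k]
    is bounded through any later index, so [d] has to be near [c] only along arbitrarily late
    indices. *)
Lemma weakL1_le_limit (h : nat -> F) (s t : F) (d : nat -> R) (c : R) :
  (forall k, cmeasurable setT (h k)) -> cmeasurable setT s -> cmeasurable setT t ->
  (\forall x \ae leb, forall e, 0 < e -> exists N, forall k, (N <= k)%N -> normc (h k x - s x) <= e) ->
  (forall k, weakL1_le (fun x => h k x - t x) (d k)) ->
  (forall e, 0 < e -> forall k, exists2 j, (k <= j)%N & d j <= c + e) ->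
  weakL1_le (fun x => s x - t x) c.
Proof.
move=> mh ms mt hs hw hd lam l0.
pose G k := [set x | lam < normc (h k x - t x)].
have mG k : measurable (G k).
  by apply: (measurable_normc_gt (f := fun x => h k x - t x)); exact: cmeasurableB.
pose B k := \bigcap_(j in [set j | (k <= j)%N]) G j.
have mB k : measurable (B k) by apply: bigcap_measurable => [|j _]; [exists k => /=|exact: mG].
have Bc k : (leb (B k) <= (c / lam)%:E)%E.
  apply: lee_of_scale => //; apply/lee_addgt0Pr => e e0.
  have [j kj dj] := hd e e0 k; rewrite -EFinD.
  apply: (@le_trans _ _ (lam%:E * leb (G j))%E).
    apply: lee_wpmul2l; first by rewrite lee_fin ltW.
    by apply: leb_le => // x; exact.
  by apply: le_trans (hw j _ l0) _; rewrite lee_fin.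
have ndB k j : (k <= j)%N -> B k `<=` B j.
  by move=> kj x Bx i /= ji; apply: Bx; exact: leq_trans kj ji.
have mU : measurable (\bigcup_k B k) by exact: bigcupT_measurable.
have ms' : measurable [set x | lam < normc (s x - t x)].
  by apply: (measurable_normc_gt (f := fun x => s x - t x)); exact: cmeasurableB.
have h1 : (leb [set x | (lam < normc (s x - t x))%R] <= leb (\bigcup_k B k))%E.
  apply: le_measure_ae => //; apply: filterS hs => x hx /= lx.
  have g0 : 0 < (normc (s x - t x) - lam) / 2 by rewrite divr_gt0// subr_gt0.
  have [N hN] := hx _ g0; exists N => // k /= Nk; rewrite /G /=.
  have := hN k Nk; rewrite normcB_sym.
  have := le_normcD (s x - h k x) (h k x - t x); rewrite addrA subrK; lra.
have h2 := le_trans h1 (measure_bigcup_le mB ndB Bc).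
apply: le_trans (lee_wpmul2l _ h2) _; first by rewrite lee_fin ltW.
by rewrite -EFinM lee_fin mulrCA divff ?mulr1// gt_eqF.
Qed.

End weak_limits.

(** * Approximation of integrable functions by [Linfc] *)

Section l1_approximation.
Context (R : realType) (n : nat).
Local Notation leb := (lebesgue_mx R 1 n).
Local Notation F := ('rV[R]_n -> R[i]).
Implicit Types u v : F.

Definition L1norm u : R := fine (\int[leb]_x (normc (u x))%:E)%E.

Lemma L1norm_ge0 u : 0 <= L1norm u.
Proof. by rewrite fine_ge0// integral_normc_ge0. Qed.

Lemma L1normE u : cintegrable leb u -> (\int[leb]_x (normc (u x))%:E = (L1norm u)%:E)%E.
Proof. by case=> _ uoo; rewrite fineK// ge0_fin_numE// integral_normc_ge0. Qed.

Lemma L1normD u v : cintegrable leb u -> cintegrable leb v ->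
  L1norm (fun x => u x + v x) <= L1norm u + L1norm v.
Proof.
move=> ui vi; rewrite -lee_fin EFinD -!L1normE//; last exact: cintegrableD.
by apply: integral_normcD => //; [case: ui|case: vi].
Qed.

Lemma cLp1P u : cLp leb 1 u <-> cintegrable leb u.
Proof. by rewrite /cLp /= cLnorm1E. Qed.

(** Truncation in size and in space at [k]; at each point the truncation eventually equals [u], and
    dominated convergence concludes. *)
Lemma Linfc_dense u e : cintegrable leb u -> 0 < e ->
  exists2 v, Linfc v & L1norm (fun x => u x - v x) <= e.
Proof.
move=> ui e0; have [mu uoo] := ui.
pose D (k : nat) := [set x | normc (u x) <= k%:R] `&` cube (const_mx (- k%:R)) (k%:R + k%:R).
have mD k : measurable (D k).
  by apply: measurableI; [exact: measurable_normc_le|exact: measurable_cube].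
pose v k := cres (D k) u.
have mv k : cmeasurable setT (v k) by exact: cmeasurable_res.
have vi k : Linfc (v k).
  apply: (@LinfcI _ _ _ k%:R k%:R) => //.
  - by move=> x; rewrite /v /cres; case: ifP => [/set_mem[]//|_]; rewrite normc0.
  - move=> x; rewrite /v /cres; case: ifP => [/set_mem[_ xc] _ j|]; last by rewrite eqxx.
    by have := xc j; rewrite !mxE addrA addNr add0r -ler_norml.
pose g k x := (normc (u x - v k x))%:E.
have mg k : measurable_fun setT (g k) by apply: measurable_enormc; exact: cmeasurableB.
have gu k x : normc (u x - v k x) <= normc (u x).
  by rewrite /v /cres; case: ifP; rewrite ?subrr ?subr0 ?normc0 ?normc_ge0.
have g0 : \forall x \ae leb, setT x -> (g ^~ x) k @[k --> \oo] --> 0%E.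
  apply: nearW => x _; apply: cvg_near_cst.
  pose N := (Num.truncn (normc (u x) + `|x|)).+1.
  exists N => // k /= Nk; apply/eqP.
  have xk : normc (u x) + `|x| <= k%:R.
    have /truncn_itv/andP[_ /ltW h] : 0 <= normc (u x) + `|x| by rewrite addr_ge0// normc_ge0.
    by apply: le_trans h _; rewrite ler_nat.
  rewrite /g /v /cres mem_set ?subrr ?normc0//; split => /=.
    by apply: le_trans xk; rewrite lerDl.
  move=> j; rewrite !mxE addrA addNr add0r -ler_norml.
  apply: le_trans (entry_le_norm x 0 j) _; apply: le_trans xk.
  by rewrite lerDr normc_ge0.
have iu : leb.-integrable setT (fun x => (normc (u x))%:E).
  apply/integrableP; split; first exact: measurable_enormc.
  by under eq_integral do rewrite gee0_abs ?lee_fin ?normc_ge0//.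
have gb : \forall x \ae leb, forall k, setT x -> (`|g k x| <= (normc (u x))%:E)%E.
  by apply: nearW => x k _; rewrite gee0_abs ?lee_fin ?normc_ge0.
have [_ _] := dominated_convergence measurableT mg (measurable_cst 0%E) g0 iu gb.
rewrite integral0 => /fine_cvgP[_ /cvgrPdist_le /(_ _ e0)] [k _ /(_ k (leqnn k))] /=.
rewrite sub0r normrN => h; exists (v k) => //.
by apply: le_trans h; exact: ler_norm.
Qed.

End l1_approximation.

(** * The BMO estimate *)

Section endpoint_bounds.
Context (R : realType) (n m : nat).
Local Notation leb := (lebesgue_mx R 1 n).
Local Notation lebM := (lebesgue_mx R m n).
Local Notation F := ('rV[R]_n -> R[i]).
Variables (K : 'M[R]_(m, n) -> R[i]) (T : ('I_m -> F) -> F) (A B : R).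
Hypotheses (Kloc : locally_integrable_off0 K) (KT : singular_integral K T).
Hypothesis Tbd : forall q, Lambda 2%:E q -> bounded_by B q 2%:E T.
Hypothesis Khor : coord_Hormander K A.
Hypotheses (n0 : (0 < n)%N) (m0 : (0 < m)%N).

Let Tlin : multilinear_operator (fun=> @Linfc R n) T. Proof. by case: KT. Qed.
Let B0 : 0 <= B. Proof. exact: (B_ge0 Tbd). Qed.
Let A0 : 0 <= A. Proof. exact: (A_ge0 Khor m0). Qed.

(** Separation from one factor excludes [x] from the common support. The slot and margin are
    quantified inside, so one null set serves all of them. *)
Lemma T_repr (f : 'I_m -> F) : (forall i, Linfc (f i)) ->
  \forall x \ae leb, forall i d, 0 < d -> sep x d (f i) ->
    T f x = cintegral lebM setT (integrand K f x).
Proof.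
move=> fi; have [_ /(_ f fi)] := KT; apply: filterS => x h i d d0 xd.
by apply: h => /(_ i I); exact: (sep_supp d0 xd).
Qed.

(** [m] near terms, each half the sum of the relative volumes of dilate and cube, plus the 2 of
    [far_estimate]. *)
Definition bmo_const : R := m%:R * (2^-1 * ((4 * n%:R + 1) ^+ n + 1)) + 2.

Lemma bmo_const_ge0 : 0 <= bmo_const.
Proof. by rewrite addr_ge0// mulr_ge0// mulr_ge0// ?invr_ge0// addr_ge0// exprn_ge0. Qed.

Lemma cLnormy_fineK (f : F) : Linfc f -> (fine (cLnorm leb +oo f))%:E = cLnorm leb +oo f.
Proof. by case=> -[_ foo] _; rewrite fineK// ge0_fin_numE// /cLnorm Lnorm_ge0. Qed.

Lemma cLnormy_fine_ge0 (f : F) : 0 <= fine (cLnorm leb +oo f).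
Proof. by rewrite fine_ge0// /cLnorm Lnorm_ge0. Qed.

Lemma bsupp_unif (f : 'I_m -> F) : (forall i, Linfc (f i)) -> exists r, forall i, bsupp r (f i).
Proof.
move=> fi; have /choice[r fr] : forall i, exists r, bsupp r (f i).
  by move=> i; have /LinfcP[_ _ [r _ h]] := fi i; exists r.
exists (\sum_i `|r i|) => i; apply: bsupp_le (fr i); rewrite (bigD1 i)//=.
by rewrite (le_trans (ler_norm _))// lerDl sumr_ge0.
Qed.

Lemma bmo_cube_bound (f : 'I_m -> F) (N : 'I_m -> R) (a : 'rV[R]_n) (l M : R) :
  (forall i, Linfc (f i)) -> (forall i x, normc (f i x) <= N i) ->
  0 < l -> 0 < M -> (A + B) * \prod_(i < m) N i <= M ->
  exists c, (\int[leb]_(x in cube a l) (normc (T f x - c))%:E <= (bmo_const * M * l ^+ n)%:E)%E.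
Proof.
move=> fi fN l0 M0 NM.
have N0 j : 0 <= N j by apply: le_trans (fN j 0); exact: normc_ge0.
have PN : 0 <= \prod_(i < m) N i by apply: prodr_ge0.
have md : measurable (dil a l) by exact: measurable_cube.
pose g i := cres (~` dil a l) (f i).
have gi i : Linfc (g i) by apply: Linfc_res => //; exact: measurableC.
have gN i x : normc (g i x) <= N i.
  by rewrite /g /cres; case: ifP => // _; rewrite normc0.
have ga i y : dil a l y -> g i y = 0.
  by move=> ya; rewrite /g /cres memNset//= => /(_ ya).
have hN k x : normc (f k x - g k x) <= N k.
  by rewrite /g /cres; case: ifP => _; rewrite ?subrr ?subr0 ?normc0.
pose u (k : 'I_m) := upd (mix f g k) k (fun y => f k y - g k y).
have hi k : Linfc (fun y => f k y - g k y) by exact: LinfcB.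
have ui k j : Linfc (u k j) by apply: upd_Linfc => //; exact: mix_Linfc.
have az : cube a l a by move=> j; rewrite lexx lerDl ltW.
have leQ : leb (cube a l) = (l ^+ n)%:E by rewrite lebesgue_cube// ltW.
have mQ : measurable (cube a l) by exact: measurable_cube.
have ledil : leb (dil a l) = (((4 * n%:R + 1) * l) ^+ n)%:E.
  by rewrite lebesgue_cube// mulr_ge0 ?(ltW l0)// addr_ge0// mulr_ge0.
have [r gr] := bsupp_unif gi.
(* [T g] is determined only almost everywhere, so the kernel integral stands for its value at the
   corner. *)
set c := cintegral lebM setT (integrand K g a); exists c.
(* Slot [k] of [u k] is bounded and lives on the dilate, so [T (u k)] has squared L^2 norm at most
   [M ^+ 2] times the volume of the dilate. *)
have near_k k : (\int[leb]_(x in cube a l) (normc (T (u k) x))%:E <=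
    (2^-1 * M * (l ^+ n + ((4 * n%:R + 1) * l) ^+ n))%:E)%E.
  apply: integral_normc_AMGM => //.
  - exact: (T_meas Tlin).
  - by rewrite leQ.
  apply: le_trans (T_sq Tbd (i := k) (N := N) B0 (ui k) _) _.
    move=> j jk; split => //; apply: cLnormy_le => //; apply: nearW => x.
    by rewrite /u /upd (negbTE jk) /mix; case: ifP.
  rewrite /u /upd eqxx.
  have := @integral_sq_le _ _ (fun y => f k y - g k y) (N k) _ _ md (N0 k) (Linfc_cmeasurable (hi k)) (hN k) _ ledil.
  move=> hh; apply: (@le_trans _ _ (((B * \prod_(j < m | j != k) N j) ^+ 2)%:E *
    (N k ^+ 2 * ((4 * n%:R + 1) * l) ^+ n)%:E)%E).
    rewrite lee_wpmul2l ?lee_fin ?sqr_ge0//; apply: hh => x nx.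
    by rewrite /g /cres mem_set ?subrr.
  rewrite -EFinM lee_fin mulrA -exprMn ler_wpM2r ?exprn_ge0 ?mulr_ge0 ?(ltW l0) ?addr_ge0 ?mulr_ge0//.
  rewrite lerXn2r ?nnegrE ?(ltW M0) ?mulr_ge0//; first by rewrite prodr_ge0.
  rewrite -mulrA [X in B * X](_ : _ = \prod_(i < m) N i); last by rewrite [RHS](bigD1 k)//= mulrC.
  by apply: le_trans NM; rewrite ler_wpM2r// lerDr.
have mTu k : measurable_fun (cube a l) (fun x => (normc (T (u k) x))%:E).
  by apply: measurable_funTS; apply: measurable_enormc; exact: (T_meas Tlin).
apply: (@le_trans _ _ (\int[leb]_(x in cube a l)
    (\sum_(k < m) (normc (T (u k) x))%:E + (2 * M)%:E))%E).
  apply: ae_ge0_le_integral => //.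
  - by move=> x _; rewrite lee_fin normc_ge0.
  - apply: measurable_funTS; apply: measurable_enormc; apply: cmeasurableB; last exact: (cmeasurable_cst _ c).
    exact: (T_meas Tlin).
  - move=> x _; rewrite adde_ge0 ?lee_fin ?mulr_ge0 ?(ltW M0)// sume_ge0// => k _.
    by rewrite lee_fin normc_ge0.
  - by apply: emeasurable_funD => //; apply: emeasurable_sum.
  have d0 : 0 < 2 * n%:R * l by rewrite !mulr_gt0// ltr0n.
  apply: filterS2 (T_telescope Tlin fi gi) (T_repr gi) => x tel rep xQ.
  have -> : T f x - c = \sum_(k < m) T (u k) x + (T g x - c).
    by rewrite -tel; ring.
  rewrite sumEFin -EFinD lee_fin (le_trans (le_normcD _ _))// lerD ?le_normc_sum//.
  rewrite (rep (Ordinal m0) _ d0 (dil_sep xQ (ga _))) /c.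
  apply: le_trans (far_estimate Kloc Khor n0 m0 l0 xQ az _ gN gr ga) _.
    by move=> j; exact: Linfc_cmeasurable.
  rewrite -mulrA ler_pM2l//; apply: le_trans NM; by rewrite ler_wpM2r// lerDl.
rewrite ge0_integralD//; last 3 first.
- by move=> x _; rewrite sume_ge0// => k _; rewrite lee_fin normc_ge0.
- by apply: emeasurable_sum.
- by move=> x _; rewrite lee_fin mulr_ge0// ltW.
rewrite integral_cst// ge0_integral_sum//; last by move=> k x _; rewrite lee_fin normc_ge0.
apply: (@le_trans _ _ (\sum_(k < m) (2^-1 * M * (l ^+ n + ((4 * n%:R + 1) * l) ^+ n))%:E +
   (2 * M)%:E * (l ^+ n)%:E)%E).
  apply: leeD; first by apply: lee_sum => k _; exact: near_k.
  by have /= -> := leQ.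
rewrite sumEFin sumr_const card_ord -EFinM -EFinD lee_fin le_eqVlt; apply/orP; left; apply/eqP.
by rewrite /bmo_const exprMn -[_ *+ m]mulr_natl; ring.
Qed.

(** Truncating the factors turns essential bounds into pointwise ones and alters [T f] only on a
    null set, which the oscillation integrals ignore. *)
Theorem bmo_bound (f : 'I_m -> F) : (forall i, Linfc (f i)) ->
  (BMOnorm (T f) <= (bmo_const * (A + B))%:E * \prod_(i < m) cLnorm leb +oo (f i))%E.
Proof.
move=> fi; pose N i := fine (cLnorm leb +oo (f i)).
have -> : (\prod_(i < m) cLnorm leb +oo (f i) = (\prod_(i < m) N i)%:E)%E.
  by rewrite -prodEFin; apply: eq_bigr => i _; rewrite cLnormy_fineK.
rewrite -EFinM -mulrA; apply: lee_inf_scale.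
- exact: bmo_const_ge0.
- by rewrite mulr_ge0 ?addr_ge0// prodr_ge0// => i _; exact: cLnormy_fine_ge0.
move=> M M0 NM; apply: ub_ereal_sup => _ [a [l [l0 ->]]].
have fti i : Linfc (ftrunc (f i)) by exact: ftrunc_Linfc.
have [c hc] := bmo_cube_bound a fti (fun i => ftrunc_le (f i)) l0 M0 NM.
apply: (@le_trans _ _ ((fine (leb (cube a l)))^-1%:E *
    \int[leb]_(x in cube a l) (normc (T f x - c))%:E)%E).
  by apply: ereal_inf_lbound; exists c.
rewrite (lebesgue_cube _ (ltW l0))/=.
have -> : (\int[leb]_(x in cube a l) (normc (T f x - c))%:E =
  \int[leb]_(x in cube a l) (normc (T (fun i => ftrunc (f i)) x - c))%:E)%E.
  have mm g : (forall i, Linfc (g i)) -> measurable_fun (cube a l) (fun x => (normc (T g x - c))%:E).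
    move=> gi; apply: measurable_funTS; apply: measurable_enormc.
    apply: cmeasurableB; last exact: (cmeasurable_cst _ c).
    exact: (T_meas Tlin).
  apply: ae_eq_integral; [exact: measurable_cube|exact: mm|exact: mm|].
  apply: filterS (T_ae Tlin Tbd B0 fi fti _) => [x /(_ I) -> //|i].
  by apply: filterS (ftrunc_ae (fi i)) => x /(_ I) <-.
apply: (@le_trans _ _ ((l ^+ n)^-1%:E * (bmo_const * M * l ^+ n)%:E)%E).
  by rewrite lee_wpmul2l// lee_fin invr_ge0 exprn_ge0// ltW.
by rewrite -EFinM mulrC mulfK// gt_eqF// exprn_gt0.
Qed.

(** * Weak type (1,1) for step functions and bounded functions *)

Section weak_step.
Variables (i : 'I_m) (f : 'I_m -> F) (N : 'I_m -> R).
Hypotheses (fi : forall j, Linfc (f j)).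
Hypothesis fN : forall j, j != i -> forall x, normc (f j x) <= N j.

Let P := \prod_(j < m | j != i) N j.

Let P0 : 0 <= P.
Proof. by apply: prodr_ge0 => j ji; apply: le_trans (fN ji 0); exact: normc_ge0. Qed.

(** Chebyshev on squares; the sup bound trades the L^2 norm of [u] for its L^1 norm through
    [|u| ^+ 2 <= U * |u|]. *)
Lemma T_L2_tail (u : F) (U M lam : R) : Linfc u -> (forall x, normc (u x) <= U) ->
  0 < lam -> 0 <= M -> B * P <= M ->
  ((lam ^+ 2)%:E * leb [set x | (lam < normc (T (upd f i u) x))%R] <=
   (M ^+ 2 * U)%:E * \int[leb]_x (normc (u x))%:E)%E.
Proof.
move=> ui uU lam0 M0 PM.
have mu := Linfc_cmeasurable ui; have nu := measurable_normc mu.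
have U0 : 0 <= U by apply: le_trans (uU 0); exact: normc_ge0.
rewrite [X in leb X](_ : _ = setT `&` [set x | lam ^+ 2 < normc (T (upd f i u) x) ^+ 2]); last first.
  by rewrite setTI; apply/seteqP; split => x /=; rewrite ltr_pXn2r ?nnegrE ?normc_ge0// ltW.
apply: le_trans (chebyshev_gt leb measurableT (sqr_ge0 _) _ _) _.
- by apply/measurable_funX/measurable_normc/(T_meas Tlin)/upd_Linfc.
- by move=> x; exact: sqr_ge0.
apply: le_trans (T_sq Tbd (i := i) (N := N) B0 (upd_Linfc i fi ui) _) _.
  move=> j ji; rewrite /upd (negbTE ji); have N0 : 0 <= N j.
    by apply: le_trans (fN ji 0); exact: normc_ge0.
  by split => //; apply: cLnormy_le => //; apply: nearW => x; exact: fN.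
rewrite /upd eqxx -/P [X in (_ <= X * _)%E]EFinM -muleA; apply: lee_pmul.
- by rewrite lee_fin sqr_ge0.
- by apply: integral_ge0 => x _; rewrite lee_fin sqr_ge0.
- by rewrite lee_fin lerXn2r ?nnegrE ?mulr_ge0.
rewrite -ge0_integralZl//; last 2 first.
- exact: measurable_enormc.
- by move=> x _; rewrite lee_fin normc_ge0.
apply: ge0_le_integral => //.
- by move=> x _; rewrite lee_fin sqr_ge0.
- by apply/measurable_EFinP; exact: measurable_funX.
- by apply: measurable_funeM; exact: measurable_enormc.
- by move=> x _; rewrite -EFinM lee_fin expr2 ler_wpM2r// normc_ge0.
Qed.

Lemma atom_Linfc (p : atom R n) : Linfc (at_fun p).
Proof.
have [M pM] := at_bounded p.
exact: (bounded_cube_integrable (at_side_gt0 p) (at_meas p) pM (@at_off _ _ p)).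
Qed.

Lemma atom_outside (p : atom R n) :
  (\int[leb]_(x in ~` dil (at_corner p) (at_side p)) (normc (T (upd f i (at_fun p)) x))%:E <=
   (2 * A * P)%:E * \int[leb]_x (normc (at_fun p x))%:E)%E.
Proof.
set a := at_corner p; set l := at_side p; set b := at_fun p.
have l0 : 0 < l := at_side_gt0 p.
(* The corner is the point at which [y_i] is frozen. *)
have aa : cube a l a by move=> j; rewrite lexx lerDl ltW.
have [M bM] := at_bounded p.
have bi := atom_Linfc p.
have mdil : measurable (~` dil a l) by apply: measurableC; exact: measurable_cube.
(* The atom's own bound [M] serves convergence only: it drops out of the product over [j != i]. *)
pose h := upd f i b; pose N' j := if j == i then M else N j.
have hi j : Linfc (h j) by apply: upd_Linfc.
have hN j y : normc (h j y) <= N' j.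
  by rewrite /h /upd /N'; case: eqVneq => [_|ji]; [exact: bM|exact: fN].
have [r hr] := bsupp_unif hi.
have hiE : h i = b by rewrite /h /upd eqxx.
have mh j : cmeasurable setT (h j) by exact: Linfc_cmeasurable.
have ba y : ~ cube a l y -> b y = 0 by exact: at_off.
have := offdiag_integrand Kloc Khor n0 m0 l0 aa mh hN hr _ _ _.
move=> /(_ i); rewrite !hiE => /(_ (Linfc_integrable bi) (at_mean0 p) ba) off.
have PE : \prod_(j < m | j != i) N' j = P.
  by apply: eq_bigr => j ji; rewrite /N' (negbTE ji).
have mok := measurable_fun_fubini_tonelli_F (m2 := lebM) _
  (okernel_meas Kloc i a a l (at_meas p)) (okernel_ge0 K i a a l _).
have ok0 x : (0 <= \int[lebM]_Y okernel K i a a l b (x, Y))%E.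
  by apply: integral_ge0 => Y _; exact: okernel_ge0.
apply: (@le_trans _ _ (\int[leb]_(x in ~` dil a l)
    ((2 * P)%:E * \int[lebM]_Y okernel K i a a l b (x, Y)))%E).
  apply: ae_ge0_le_integral => //.
  - by move=> x _; rewrite lee_fin normc_ge0.
  - by apply: measurable_funTS; apply: measurable_enormc; exact: (T_meas Tlin).
  - by move=> x _; rewrite mule_ge0// lee_fin mulr_ge0.
  - by apply: measurable_funTS; apply: measurable_funeM; exact: mok.
  apply: filterS2 off (T_repr hi) => x offx rep xa.
  have d0 : 0 < 2 * n%:R * l by rewrite !mulr_gt0// ltr0n.
  rewrite (rep i _ d0); first by rewrite -PE; exact: offx.
  by rewrite hiE; exact: (cube_sep xa ba).
apply: (@le_trans _ _ (\int[leb]_x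
    ((2 * P)%:E * \int[lebM]_Y okernel K i a a l b (x, Y)))%E).
  apply: ge0_subset_integral => //.
    by apply: measurable_funeM; exact: mok.
  by move=> x _; rewrite mule_ge0// lee_fin mulr_ge0.
rewrite ge0_integralZl//; last by rewrite lee_fin mulr_ge0.
apply: le_trans (lee_wpmul2l _ (offdiag_estimate Kloc Khor m0 i aa (at_meas p) ba)) _.
  by rewrite lee_fin mulr_ge0.
by rewrite muleA -EFinM mulrAC.
Qed.

Lemma T_upd_sum (u g : F) (s : seq (atom R n)) : Linfc g ->
  (forall x, u x = g x + \sum_(p <- s) at_fun p x) ->
  \forall x \ae leb, T (upd f i u) x = T (upd f i g) x + \sum_(p <- s) T (upd f i (at_fun p)) x.
Proof.
elim: s u => [|p s ih] u gi uE.
  apply: nearW => x; rewrite big_nil addr0; congr (T (upd f i _) x).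
  by apply/funext => y; rewrite uE big_nil addr0.
pose v x := g x + \sum_(p <- s) at_fun p x.
have vi : Linfc v.
  apply: LinfcD => //; elim: s {ih uE v} => [|q s ih].
    by under eq_fun do rewrite big_nil; exact: Linfc0.
  by under eq_fun do rewrite big_cons; apply: LinfcD => //; exact: atom_Linfc.
apply: filterS2 (ih v gi (fun=> erefl)) (T_linear Tlin i 1 fi (atom_Linfc p) vi) => x h1 h2.
rewrite big_cons addrCA -h1 -[X in X + _]mul1r -h2; congr (T (upd f i _) x).
by apply/funext => y; rewrite mul1r uE big_cons /v; ring.
Qed.

Definition atoms_dil (s : seq (atom R n)) : set 'rV[R]_n :=
  \big[setU/set0]_(p <- s) dil (at_corner p) (at_side p).

Lemma measurable_atoms_dil s : measurable (atoms_dil s).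
Proof. by apply: bigsetU_measurable => p _; exact: measurable_cube. Qed.

Lemma atoms_dil_le s :
  (leb (atoms_dil s) <= ((4 * n%:R + 1) ^+ n * \sum_(p <- s) at_side p ^+ n)%:E)%E.
Proof.
elim: s => [|p s ih]; first by rewrite /atoms_dil !big_nil measure0 mulr0.
rewrite /atoms_dil !big_cons -/(atoms_dil s) mulrDr EFinD.
have mp : measurable (dil (at_corner p) (at_side p)) by exact: measurable_cube.
apply: le_trans (measureU2 _ mp (measurable_atoms_dil s)) _.
apply: leeD => //; rewrite /dil; have l0 := at_side_gt0 p.
have n4 : 0 <= 4 * n%:R + 1 :> R by rewrite addr_ge0// mulr_ge0.
have /= -> := @lebesgue_cube R n (at_corner p - const_mx (2 * n%:R * at_side p))
  ((4 * n%:R + 1) * at_side p) (mulr_ge0 n4 (ltW l0)).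
by rewrite exprMn.
Qed.

Lemma atoms_outside s (D : set 'rV[R]_n) : measurable D -> D `<=` ~` atoms_dil s ->
  (\sum_(p <- s) \int[leb]_(x in D) (normc (T (upd f i (at_fun p)) x))%:E <=
   (2 * A * P)%:E * \sum_(p <- s) \int[leb]_x (normc (at_fun p x))%:E)%E.
Proof.
move=> mD; elim: s => [|p s ih]; first by rewrite !big_nil mule0.
rewrite /atoms_dil big_cons -/(atoms_dil s) setCU subsetI => -[Dp Ds].
rewrite !big_cons ge0_muleDr; last 2 first.
- exact: integral_normc_ge0.
- by apply: sume_ge0 => q _; exact: integral_normc_ge0.
apply: leeD; last exact: ih.
apply: le_trans (atom_outside p); apply: ge0_subset_integral => //.
- by apply: measurableC; exact: measurable_cube.
- apply: measurable_funTS; apply: measurable_enormc; apply: (T_meas Tlin).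
  by apply: upd_Linfc => //; exact: atom_Linfc.
- by move=> x _; rewrite lee_fin normc_ge0.
Qed.

(** Good part: 4 from squaring half the level, 2 from the L^1 norm of [g]. Then the volume ratio of
    the dilates. Bad part: 12 = 2 * 3 * 2, from [atom_outside], the atoms' total L^1 norm and
    halving the level. *)
Definition weak_const : R := 8 * cz_const R n + (4 * n%:R + 1) ^+ n + 12.

Lemma weak_step d a l (u : F) (M0 M lam : R) : 0 < l -> 0 < M -> 0 < lam ->
  (A + B) * P <= M -> cmeasurable setT u -> (forall x, normc (u x) <= M0) -> stepf d a l u ->
  (\int[leb]_x (normc (u x))%:E <= (lam / M * l ^+ n)%:E)%E ->
  (lam%:E * leb [set x | (lam < normc (T (upd f i u) x))%R] <=
   (weak_const * M)%:E * \int[leb]_x (normc (u x))%:E)%E.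
Proof.
move=> l0 Mp lam0 PM mu uM su ul.
(* At height [lam / M] both the L^2 tail of the good part and the volume of the dilates become
   multiples of [M / lam]. *)
have t0 : 0 < lam / M by rewrite divr_gt0.
have [g [s [uE mg [gt g0] gi1 [s1 s2]]]] := calderon_zygmund l0 t0 mu uM su ul.
have ui : Linfc u.
  apply: (bounded_cube_integrable l0 mu uM) => x xa; case: su => u0 _.
  by apply: u0 => /hcube_cube/xa.
have gi : Linfc g.
  by apply: (bounded_cube_integrable l0 mg gt) => x xa; apply: g0 => /hcube_cube/xa.
have [_ ufin] := Linfc_integrable ui.
set I := (\int[leb]_x (normc (u x))%:E)%E in ufin gi1 s1 s2 ul *.
have I0 : (0 <= I)%E by exact: integral_normc_ge0.
pose r := fine I; have IE : I = r%:E by rewrite fineK// ge0_fin_numE.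
have r0 : 0 <= r by rewrite -lee_fin -IE.
rewrite IE in gi1 s1 s2 *.
have mT v : Linfc v -> cmeasurable setT (T (upd f i v)).
  by move=> vi; apply: (T_meas Tlin); exact: upd_Linfc.
have mTn v : Linfc v -> measurable_fun setT (fun x => normc (T (upd f i v) x)).
  by move=> vi; apply: measurable_normc; exact: mT.
pose E := atoms_dil s; have mE : measurable E by exact: measurable_atoms_dil.
pose bsum x := \sum_(p <- s) normc (T (upd f i (at_fun p)) x).
have mbsum : measurable_fun setT bsum.
  by apply: measurable_sum => p; exact: mTn (atom_Linfc p).
pose S1 := [set x | lam / 2 < normc (T (upd f i g) x)].
pose S3 := ~` E `&` [set x | lam / 2 < bsum x].
have mS1 : measurable S1 by apply: measurable_gt; exact: mTn.
have mS3 : measurable S3.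
  by apply: measurableI; [exact: measurableC|exact: measurable_gt].
have lam20 : 0 <= lam / 2 by rewrite divr_ge0// ltW.
have MV : M != 0 by rewrite gt_eqF.
have lV : lam != 0 by rewrite gt_eqF.
have bS1 : (leb S1 <= (8 * cz_const R n * M / lam * r)%:E)%E.
  have l20 : 0 < lam / 2 by rewrite divr_gt0.
  have BM : B * P <= M by apply: le_trans PM; rewrite ler_wpM2r// lerDr.
  have := T_L2_tail gi gt l20 (ltW Mp) BM; rewrite -/S1 => h.
  have U0 : (0 <= (M ^+ 2 * (cz_const R n * (lam / M)))%:E)%E.
    by rewrite lee_fin mulr_ge0 ?sqr_ge0// mulr_ge0 ?(ltW t0)// (le_trans ler01 (cz_const_ge1 R n)).
  have := le_trans h (lee_wpmul2l U0 gi1); rewrite -!EFinM => {}h.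
  apply: le_trans (lee_of_scale _ h) _; first by rewrite exprn_gt0.
  by rewrite lee_fin le_eqVlt; apply/orP; left; apply/eqP; field; rewrite lV MV.
have bE : (leb E <= ((4 * n%:R + 1) ^+ n * M / lam * r)%:E)%E.
  apply: le_trans (atoms_dil_le s) _; rewrite lee_fin -!mulrA; apply: ler_wpM2l.
    by rewrite exprn_ge0// addr_ge0// mulr_ge0.
  move: s1; rewrite -EFinM lee_fin mulrC -ler_pdivlMr// => s1; apply: le_trans s1 _.
  by rewrite le_eqVlt; apply/orP; left; apply/eqP; field; rewrite lV MV.
have bS3 : (leb S3 <= (12 * M / lam * r)%:E)%E.
  have l2 : 0 < lam / 2 by rewrite divr_gt0.
  have h : ((lam / 2)%:E * leb S3 <= (2 * A * P * (3 * r))%:E)%E.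
    have mCE : measurable (~` E) by exact: measurableC.
    apply: le_trans (chebyshev_gt leb mCE lam20 mbsum _) _.
      by move=> x; apply: sumr_ge0 => p _; exact: normc_ge0.
    under eq_integral do rewrite -sumEFin.
    rewrite ge0_integral_sum//; last 2 first.
    - by move=> p; apply: measurable_funTS; apply/measurable_EFinP; exact: mTn (atom_Linfc p).
    - by move=> p x _; rewrite lee_fin normc_ge0.
    apply: le_trans (atoms_outside (s := s) mCE (fun=> id)) _.
    by rewrite [leRHS]EFinM lee_wpmul2l ?lee_fin ?mulr_ge0// EFinM.
  apply: le_trans (lee_of_scale l2 h) _.
  have -> : 2 * A * P * (3 * r) / (lam / 2) = 12 * (A * P) / lam * r by field.
  rewrite lee_fin ler_wpM2r// ler_wpM2r ?invr_ge0 ?(ltW lam0)// ler_pM2l//.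
  by apply: le_trans PM; rewrite ler_wpM2r// lerDl.
have sub : \forall x \ae leb, lam < normc (T (upd f i u) x) -> (S1 `|` E `|` S3) x.
  apply: filterS (T_upd_sum gi uE) => x -> h.
  have [S1x|nS1] := pselect (S1 x); first by left; left.
  have [Ex|nE] := pselect (E x); first by left; right.
  right; split => //; move/negP: nS1; rewrite -leNgt => h1 /=.
  have := lt_le_trans h (le_normcD _ _); have := le_normc_sum s (fun p => T (upd f i (at_fun p)) x).
  rewrite -/(bsum x) => h2 h3; lra.
have mU : measurable (S1 `|` E) by exact: measurableU.
have mL : measurable [set x | lam < normc (T (upd f i u) x)] by apply: measurable_gt; exact: mTn.
have tot : (leb [set x | (lam < normc (T (upd f i u) x))%R] <=
    (8 * cz_const R n * M / lam * r + (4 * n%:R + 1) ^+ n * M / lam * r + 12 * M / lam * r)%:E)%E.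
  apply: le_trans (le_measure_ae mL (measurableU _ _ mU mS3) sub) _.
  apply: le_trans (measureU2 _ mU mS3) _; rewrite EFinD; apply: leeD => //.
  by apply: le_trans (measureU2 _ mS1 mE) _; rewrite EFinD; exact: leeD.
apply: le_trans (lee_wpmul2l _ tot) _; first by rewrite lee_fin ltW.
rewrite -!EFinM lee_fin le_eqVlt; apply/orP; left; apply/eqP.
by rewrite /weak_const; field.
Qed.

End weak_step.

(** The 2 pays for halving the level between a step approximant and its error. *)
Definition weak_type_const : R := 2 * weak_const.

Lemma weak_const_ge0 : 0 <= weak_const.
Proof.
have := cz_const_ge1 R n; have : 0 <= (4 * n%:R + 1) ^+ n :> R.
  by rewrite exprn_ge0// addr_ge0// mulr_ge0.
by rewrite /weak_const; lra.
Qed.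

(** Write [u] as a step function plus an error of L^1 norm at most [e] and sup at most [3 * M0]. The
    L^2 tail of the error tends to 0 with [e], so [M0] leaves no trace in the bound. *)
Lemma weak_bounded (i : 'I_m) (f : 'I_m -> F) (N : 'I_m -> R) (u : F) (M0 M : R) :
  (forall j, Linfc (f j)) -> (forall j, j != i -> forall x, normc (f j x) <= N j) ->
  Linfc u -> (forall x, normc (u x) <= M0) ->
  0 < M -> (A + B) * \prod_(j < m | j != i) N j <= M ->
  weakL1_le (T (upd f i u)) (weak_type_const * M * fine (\int[leb]_x (normc (u x))%:E)%E).
Proof.
move=> fi fN ui uM Mp PM lam l0.
have [mu ufin] := Linfc_integrable ui.
set I := (\int[leb]_x (normc (u x))%:E)%E in ufin *.
have I0 : (0 <= I)%E by exact: integral_normc_ge0.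
pose r := fine I; have IE : I = r%:E by rewrite fineK// ge0_fin_numE.
have r0 : 0 <= r by rewrite -lee_fin -IE.
rewrite -/r; have M00 : 0 <= M0 by apply: le_trans (uM 0); exact: normc_ge0.
have /LinfcP[_ _ [s s0 us]] := ui.
have l20 : 0 < lam / 2 by rewrite divr_gt0.
have t0 : 0 < lam / 2 / M by rewrite divr_gt0.
(* The terms [2 * s + 1] make the half-open cube contain the support. The last term brings the mean
   of every approximant, of norm at most [r + 1], below the height, since [l <= l ^+ n]. *)
pose l := 2 * s + 1 + (r + 1) / (lam / 2 / M).
have q0 : 0 <= (r + 1) / (lam / 2 / M) by rewrite divr_ge0 ?(ltW t0)// addr_ge0.
have l1 : 1 <= l by rewrite /l; lra.
have ll : 0 < l by lra.
have ln : l <= l ^+ n by rewrite -[leLHS]expr1 ler_weXn2l.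
pose a : 'rV[R]_n := const_mx (- (l / 2)).
have uQ x : ~ hcube a l x -> u x = 0.
  move=> nx; apply: contrapT => /eqP ux; apply: nx => j; rewrite !mxE.
  have := us x ux j; rewrite ler_norml => /andP[h1 h2].
  by apply/andP; split; rewrite /l; lra.
have P0 : 0 <= \prod_(j < m | j != i) N j.
  by apply: prodr_ge0 => j ji; apply: le_trans (fN j ji 0); exact: normc_ge0.
have mT v : Linfc v -> cmeasurable setT (T (upd f i v)).
  by move=> vi; apply: (T_meas Tlin); exact: upd_Linfc.
pose Cw := weak_const; have Cw0 : 0 <= Cw := weak_const_ge0.
have main e : 0 < e -> e <= 1 -> (leb [set x | (lam < normc (T (upd f i u) x))%R] <=
   (Cw * M * (r + e) / (lam / 2) + M ^+ 2 * (3 * M0 * e) / (lam / 2) ^+ 2)%:E)%E.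
  move=> e0 e1; have [d [v [sv mv vM uv]]] := density_stepf ll mu uM uQ e0.
  have vi : Linfc v.
    apply: (bounded_cube_integrable ll mv vM) => x nx; case: sv => + _; apply.
    by move=> /hcube_cube/nx.
  have uvi : Linfc (fun x => u x - v x) by exact: LinfcB.
  have vr : (\int[leb]_x (normc (v x))%:E <= (r + e)%:E)%E.
    have -> : (\int[leb]_x (normc (v x))%:E = \int[leb]_x (normc (u x + (- (u x - v x))))%:E)%E.
      by apply: eq_integral => x _; congr (normc _)%:E; ring.
    apply: le_trans (integral_normcD leb measurableT mu (cmeasurableN (cmeasurableB mu mv))) _.
    rewrite -/I IE EFinD; apply: leeD => //.
    by under eq_integral do rewrite normcN.
  have b1 : ((lam / 2)%:E * leb [set x | (lam / 2 < normc (T (upd f i v) x))%R] <= (Cw * M * (r + e))%:E)%E.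
    apply: le_trans (weak_step fi fN ll Mp l20 PM mv vM sv _) _.
      apply: le_trans vr _; rewrite lee_fin.
      have h : r + 1 <= lam / 2 / M * l.
        rewrite mulrC -ler_pdivrMr// /l; lra.
      apply: (@le_trans _ _ (lam / 2 / M * l)); first lra.
      by rewrite ler_wpM2l// ltW.
    by rewrite [leRHS]EFinM lee_wpmul2l// lee_fin mulr_ge0// ltW.
  have b2 : (((lam / 2) ^+ 2)%:E * leb [set x | (lam / 2 < normc (T (upd f i (fun x => u x - v x)) x))%R] <=
      (M ^+ 2 * (3 * M0 * e))%:E)%E.
    have uvM x : normc (u x - v x) <= 3 * M0.
      have := le_normcB (u x) (v x); have := uM x; have := vM x; lra.
    have BM : B * \prod_(j < m | j != i) N j <= M by apply: le_trans PM; rewrite ler_wpM2r// lerDr.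
    have c0 : 0 <= M ^+ 2 * (3 * M0) by rewrite mulr_ge0 ?sqr_ge0// mulr_ge0.
    apply: le_trans (T_L2_tail fi fN uvi uvM l20 (ltW Mp) BM) _.
    by rewrite [in leRHS]mulrA [leRHS]EFinM; apply: lee_wpmul2l => //; rewrite lee_fin.
  have m1 := measurable_normc_gt (lam / 2) (mT _ vi).
  have m2 := measurable_normc_gt (lam / 2) (mT _ uvi).
  apply: (@le_trans _ _ (leb [set x | (lam / 2 < normc (T (upd f i v) x))%R] +
    leb [set x | (lam / 2 < normc (T (upd f i (fun x => u x - v x)) x))%R])%E).
    apply: le_trans (measureU2 _ m1 m2); apply: le_measure_ae.
    - by apply: measurable_normc_gt; exact: mT.
    - exact: measurableU.
    apply: filterS (T_sub Tlin i fi ui vi) => x /= h xl; rewrite h.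
    have := le_normcD (T (upd f i v) x) (T (upd f i u) x - T (upd f i v) x); rewrite addrC subrK => h'.
    by have [?|?] := ltP (lam / 2) (normc (T (upd f i v) x)); [left|right; lra].
  by rewrite EFinD; apply: leeD; apply: lee_of_scale => //; rewrite exprn_gt0.
have fin : (leb [set x | (lam < normc (T (upd f i u) x))%R] <= (weak_type_const * M * r / lam)%:E)%E.
  apply/lee_addgt0Pr => e e0.
  (* [D - 1] is the total coefficient of the approximation error; adding 1 makes it a positive
     divisor. *)
  pose D := Cw * M / (lam / 2) + M ^+ 2 * (3 * M0) / (lam / 2) ^+ 2 + 1.
  have h1 : 0 <= Cw * M / (lam / 2) by rewrite divr_ge0 ?(ltW l20)// mulr_ge0// ltW.
  have h2 : 0 <= M ^+ 2 * (3 * M0) / (lam / 2) ^+ 2.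
    by rewrite divr_ge0 ?sqr_ge0// mulr_ge0 ?sqr_ge0// mulr_ge0.
  have D0 : 0 < D by rewrite /D; lra.
  pose e' := Num.min 1 (e / D).
  have e'0 : 0 < e' by rewrite lt_min ltr01 divr_gt0.
  have e'1 : e' <= 1 by rewrite ge_min lexx.
  apply: le_trans (main e' e'0 e'1) _; rewrite -EFinD lee_fin.
  have -> : Cw * M * (r + e') / (lam / 2) + M ^+ 2 * (3 * M0 * e') / (lam / 2) ^+ 2 =
      weak_type_const * M * r / lam + e' * (D - 1).
    by rewrite /D /weak_type_const -/Cw; field; rewrite gt_eqF.
  rewrite lerD2l; apply: (@le_trans _ _ (e' * D)); first by rewrite ler_wpM2l ?(ltW e'0)//; lra.
  by rewrite -ler_pdivlMr// ge_min lexx orbT.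
apply: le_trans (lee_wpmul2l _ fin) _; first by rewrite lee_fin ltW.
by rewrite -EFinM lee_fin mulrCA divff ?mulr1// gt_eqF.
Qed.

(** * Extension to L^1 in one slot *)

Definition weak_coef (i : 'I_m) (f : 'I_m -> F) : R :=
  weak_type_const * (A + B) * \prod_(j < m | j != i) fine (cLnorm leb +oo (f j)).

Lemma weak_type_const_ge0 : 0 <= weak_type_const.
Proof. by rewrite /weak_type_const mulr_ge0// weak_const_ge0. Qed.

Let weak_coef_ge0 i f : 0 <= weak_coef i f.
Proof.
apply: mulr_ge0; last by apply: prodr_ge0 => j _; exact: cLnormy_fine_ge0.
by apply: mulr_ge0; [exact: weak_type_const_ge0|exact: addr_ge0].
Qed.

Lemma weak_bound (i : 'I_m) (f : 'I_m -> F) : (forall j, Linfc (f j)) ->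
  weakL1_le (T f) (weak_coef i f * fine (\int[leb]_x (normc (f i x))%:E)%E).
Proof.
move=> fi; pose g j := ftrunc (f j).
have gi j : Linfc (g j) by exact: ftrunc_Linfc.
have gf : T g = T f %[ae leb].
  by apply: (T_ae Tlin Tbd B0 gi fi) => j; exact: ftrunc_ae.
apply: (@weakL1_le_ae _ _ (T g)); [exact: (T_meas Tlin)|exact: (T_meas Tlin)| |].
  by apply: filterS gf => x /(_ I).
have -> : (\int[leb]_x (normc (f i x))%:E = \int[leb]_x (normc (g i x))%:E)%E.
  apply: ae_eq_integral => //; try by apply: measurable_enormc; exact: Linfc_cmeasurable.
  by apply: filterS (ftrunc_ae (fi i)) => x /(_ I) h _; rewrite /g h.
set r := fine _; have r0 : 0 <= r by rewrite fine_ge0// integral_normc_ge0.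
move=> lam l0.
pose P := \prod_(j < m | j != i) fine (cLnorm leb +oo (f j)).
have P0 : 0 <= P by apply: prodr_ge0 => j _; exact: cLnormy_fine_ge0.
have -> : weak_coef i f * r = (weak_type_const * r) * ((A + B) * P) by rewrite /weak_coef -/P; ring.
apply: lee_inf_scale.
- by rewrite mulr_ge0// weak_type_const_ge0.
- by rewrite mulr_ge0// addr_ge0.
move=> M M0 PM.
have := @weak_bounded i g (fun j => fine (cLnorm leb +oo (f j))) (g i) _ M gi _ (gi i) (ftrunc_le (f i)) M0 PM.
rewrite upd_id => /(_ (fun j _ => ftrunc_le (f j)) lam l0).
by rewrite -/r mulrAC.
Qed.

Lemma weak_coef_upd (i : 'I_m) (f : 'I_m -> F) (u : F) : weak_coef i (upd f i u) = weak_coef i f.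
Proof.
by rewrite /weak_coef; congr (_ * _); apply: eq_bigr => j ji; rewrite /upd (negbTE ji).
Qed.

Lemma weak_bound_diff (i : 'I_m) (f : 'I_m -> F) (u v : F) : (forall j, j != i -> Linfc (f j)) ->
  Linfc u -> Linfc v ->
  weakL1_le (fun x => T (upd f i u) x - T (upd f i v) x) (weak_coef i f * L1norm (fun x => u x - v x)).
Proof.
move=> fi ui vi.
(* Slot [i] of [f] is arbitrary here and is overwritten anyway, so it may be put to 0 to land in
   [Linfc]. *)
pose f0 := upd f i (fun=> 0); have f0i : forall j, Linfc (f0 j) := upd0_Linfc fi.
have uf w : upd f i w = upd f0 i w by rewrite /f0 upd_upd.
have mT w : Linfc w -> cmeasurable setT (T (upd f i w)).
  by move=> wi; rewrite uf; apply: (T_meas Tlin); exact: upd_Linfc.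
have uvi : Linfc (fun x => u x - v x) by exact: LinfcB.
apply: (@weakL1_le_ae _ _ (T (upd f i (fun x => u x - v x)))).
- exact: mT.
- by apply: cmeasurableB; exact: mT.
- by rewrite !uf; exact: (T_sub Tlin i f0i ui vi).
have := weak_bound i (upd_Linfc i f0i uvi).
by rewrite weak_coef_upd /f0 weak_coef_upd upd_upd {2}/upd eqxx.
Qed.

(** The limit is recorded by its weak distance to [T] at every bounded [u], without reference to the
    approximating sequence. This is the form from which linearity and the bound follow. *)
Lemma extension_at (i : 'I_m) (f : 'I_m -> F) : (forall j, L1_Linfc i j (f j)) ->
  exists s : F, cmeasurable setT s /\ forall u, Linfc u ->
    weakL1_le (fun x => s x - T (upd f i u) x) (weak_coef i f * L1norm (fun x => f i x - u x)).
Proof.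
move=> fL; have fi j : j != i -> Linfc (f j).
  by move=> ji; have := fL j; rewrite /L1_Linfc (negbTE ji).
have fii : cintegrable leb (f i) by apply/cLp1P; have := fL i; rewrite /L1_Linfc eqxx.
have p0 k : 0 < (4 ^+ k)^-1 :> R by rewrite invr_gt0 exprn_gt0.
(* The rate [4 ^- k] is the one required by [ae_limit]. *)
have /choice[v hv] : forall k, exists v, Linfc v /\ L1norm (fun x => f i x - v x) <= (4 ^+ k)^-1.
  by move=> k; have [v vi hv] := Linfc_dense fii (p0 k); exists v.
have vi k : Linfc (v k) by case: (hv k).
have vle k : L1norm (fun x => f i x - v k x) <= (4 ^+ k)^-1 by case: (hv k).
pose h k := T (upd f i (v k)).
have mT w : Linfc w -> cmeasurable setT (T (upd f i w)).
  move=> wi; apply: (T_meas Tlin) => j; rewrite /upd; case: eqVneq => // ji; exact: fi.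
have mh k : cmeasurable setT (h k) by exact: mT.
have tri u k : cintegrable leb u -> L1norm (fun x => v k x - u x) <= L1norm (fun x => f i x - u x) + (4 ^+ k)^-1.
  move=> ui; have vki := Linfc_integrable (vi k).
  have -> : (fun x => v k x - u x) = (fun x => (f i x - u x) + - (f i x - v k x)).
    by apply/funext => x; ring.
  apply: le_trans (L1normD (cintegrableB fii ui) (cintegrableN (cintegrableB fii vki))) _.
  by rewrite lerD2l; apply: le_trans (vle k); rewrite /L1norm; under eq_integral do rewrite normcN.
have steps k : weakL1_le (fun x => h k.+1 x - h k x) (2 * weak_coef i f * (4 ^+ k)^-1).
  apply: weakL1_le_mono (weak_bound_diff fi (vi k.+1) (vi k)); rewrite -mulrA mulrCA ler_wpM2l//.
  apply: le_trans (tri _ k.+1 (Linfc_integrable (vi k))) _.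
  have h4 : (4 ^+ k.+1)^-1 <= (4 ^+ k)^-1 :> R.
    by rewrite exprS invfM ler_piMl ?(ltW (p0 k))// invf_le1// ler1n.
  have := vle k; lra.
have c0 : 0 <= 2 * weak_coef i f by rewrite mulr_ge0.
have [s [ms hs]] := ae_limit c0 mh steps; exists s; split => // u ui.
apply: (weakL1_le_limit (d := fun k => weak_coef i f * L1norm (fun x => v k x - u x)) mh ms (mT _ ui) hs).
  by move=> k; exact: weak_bound_diff.
move=> e e0 k.
have D1 : 0 < weak_coef i f + 1 by rewrite ltr_wpDl.
pose N := Num.truncn ((weak_coef i f + 1) / e).
exists (maxn k N.+1); first exact: leq_maxl.
apply: (@le_trans _ _ (weak_coef i f * (L1norm (fun x => f i x - u x) + (4 ^+ maxn k N.+1)^-1))).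
  by rewrite ler_wpM2l//; exact: tri (Linfc_integrable ui).
rewrite mulrDr lerD2l.
have N4 : N.+1%:R <= 4 ^+ maxn k N.+1 :> R.
  rewrite -natrX ler_nat; apply: leq_trans (ltnW (ltn_expl N.+1 (isT : (1 < 4)%N))) _.
  by rewrite leq_exp2l// leq_maxr.
rewrite ler_pdivrMr ?exprn_gt0//.
have /truncn_itv/andP[_] : 0 <= (weak_coef i f + 1) / e by rewrite divr_ge0 ?ltW.
rewrite -/N ltr_pdivrMr// => h1.
have h2 : e * N.+1%:R <= e * 4 ^+ maxn k N.+1 by rewrite ler_pM2l.
apply: le_trans h2; rewrite mulrC; apply: ltW; apply: lt_trans h1.
by rewrite ltrDl.
Qed.

(** One [S] serves all [i]: a tuple with an entry outside [Linfc] can satisfy [L1_Linfc i] only for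
    the slot [i] of that entry, so the definitions never conflict. Tuples in no domain are sent to
    0. *)
Lemma extension_exists : exists S : ('I_m -> F) -> F,
  (forall f, (forall j, Linfc (f j)) -> S f = T f) /\
  (forall i f, (forall j, L1_Linfc i j (f j)) -> cmeasurable setT (S f) /\
    forall u, Linfc u ->
      weakL1_le (fun x => S f x - T (upd f i u) x) (weak_coef i f * L1norm (fun x => f i x - u x))).
Proof.
suff /choice[S hS] : forall f : 'I_m -> F, exists s : F, ((forall j, Linfc (f j)) -> s = T f) /\
    (forall i, (forall j, L1_Linfc i j (f j)) -> cmeasurable setT s /\
    forall u, Linfc u -> weakL1_le (fun x => s x - T (upd f i u) x) (weak_coef i f * L1norm (fun x => f i x - u x))).
  by exists S; split => [f|i f]; case: (hS f) => h1 h2; [exact: h1|exact: h2].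
move=> f; have [fi|nfi] := pselect (forall j, Linfc (f j)).
  exists (T f); split => // i _; split; first exact: (T_meas Tlin).
  by move=> u ui; have := @weak_bound_diff i f (f i) u (fun j _ => fi j) (fi i) ui; rewrite upd_id.
have [[i fL]|nL] := pselect (exists i, forall j, L1_Linfc i j (f j)); last first.
  by exists (fun=> 0); split => // i fL; case: nL; exists i.
have [s hs] := extension_at fL; exists s; split => // i' fL'.
have [->//|ii'] := eqVneq i' i.
case: nfi => j; have [->|ji] := eqVneq j i.
  by have := fL' i; rewrite /L1_Linfc eq_sym (negbTE ii').
by have := fL j; rewrite /L1_Linfc (negbTE ji).
Qed.

Variable S : ('I_m -> F) -> F.
Hypothesis SL : forall i f, (forall j, L1_Linfc i j (f j)) -> cmeasurable setT (S f) /\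
    forall u, Linfc u -> weakL1_le (fun x => S f x - T (upd f i u) x) (weak_coef i f * L1norm (fun x => f i x - u x)).

Lemma L1_Linfc_upd (i k : 'I_m) (f : 'I_m -> F) (u : F) : (forall j, L1_Linfc i j (f j)) -> L1_Linfc i k u ->
  forall j, L1_Linfc i j (upd f k u j).
Proof. by move=> fL uL j; rewrite /upd; case: eqVneq => [->|]. Qed.

Lemma upd_comm (f : 'I_m -> F) (i k : 'I_m) (u v : F) : i != k -> upd (upd f i u) k v = upd (upd f k v) i u.
Proof.
move=> ik; apply/funext => j; rewrite /upd; case: eqVneq => // ->.
by rewrite eq_sym (negbTE ik).
Qed.

(** Linearity passes from [T] to [S] because weak distances can be made arbitrarily small. If
    [k = i], approximants [u] of [g] and [v] of [h] give [a * u + v] for the combination; if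
    [k != i], one approximant of [f i] serves all three tuples. *)
Lemma extension_linear (i k : 'I_m) (f : 'I_m -> F) (a : R[i]) (g h : F) :
  (forall j, L1_Linfc i j (f j)) -> L1_Linfc i k g -> L1_Linfc i k h ->
  \forall x \ae leb, S (upd f k (fun x => a * g x + h x)) x =
    a * S (upd f k g) x + S (upd f k h) x.
Proof.
move=> fL gL hL.
pose p := fun x => a * g x + h x.
have fi j : j != i -> Linfc (f j).
  by move=> ji; have := fL j; rewrite /L1_Linfc (negbTE ji).
have fii : cintegrable leb (f i) by apply/cLp1P; have := fL i; rewrite /L1_Linfc eqxx.
have pL : L1_Linfc i k p.
  move: gL hL; rewrite /L1_Linfc; case: ifP => _; last first.
    by move=> gL hL; apply: LinfcD => //; exact: LinfcZ.
  by move=> /cLp1P gi /cLp1P hi; apply/cLp1P; apply: cintegrableD => //; exact: cintegrableZ.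
have [mSp wSp] := SL (L1_Linfc_upd fL pL).
have [mSg wSg] := SL (L1_Linfc_upd fL gL).
have [mSh wSh] := SL (L1_Linfc_upd fL hL).
(* The cost of two nested uses of [weakL1_leD]; below, [e'] solves [E e' = e]. *)
pose E (e : R) := 2 * (e + 2 * (normc a * e + e)).
(* It suffices to approximate the three functions by values of T satisfying the same relation. *)
suff approx e : 0 < e -> exists tp tg th : F, [/\
    [/\ cmeasurable setT tp, cmeasurable setT tg & cmeasurable setT th],
    \forall x \ae leb, tp x = a * tg x + th x,
    weakL1_le (fun x => S (upd f k p) x - tp x) e,
    weakL1_le (fun x => S (upd f k g) x - tg x) e &
    weakL1_le (fun x => S (upd f k h) x - th x) e].
  pose w x := S (upd f k p) x - (a * S (upd f k g) x + S (upd f k h) x).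
  have mw : cmeasurable setT w.
    by apply: cmeasurableB => //; apply: cmeasurableD => //; exact: cmeasurableZ.
  have : \forall x \ae leb, w x = 0.
    apply: weakL1_le0_ae => // e e0.
    have na := normc_ge0 a.
    pose e' := e / (2 * (1 + 2 * (normc a + 1))).
    have e'0 : 0 < e' by rewrite divr_gt0//; lra.
    have [tp [tg [th [[mtp mtg mth] lin wp wg wh]]]] := approx e' e'0.
    pose X x := (S (upd f k p) x - tp x) + ((- a) * (S (upd f k g) x - tg x) + (- 1) * (S (upd f k h) x - th x)).
    have m1 : cmeasurable setT (fun x => (- a) * (S (upd f k g) x - tg x)).
      by apply: cmeasurableZ; exact: cmeasurableB.
    have m2 : cmeasurable setT (fun x => (- 1) * (S (upd f k h) x - th x)).
      by apply: cmeasurableZ; exact: cmeasurableB.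
    have m3 : cmeasurable setT (fun x => S (upd f k p) x - tp x) by exact: cmeasurableB.
    apply: (@weakL1_le_ae _ _ X) => //.
    - by apply: cmeasurableD => //; exact: cmeasurableD.
    - by apply: filterS lin => x lx; rewrite /X /w lx; ring.
    have e'E : E e' = e.
      by rewrite /E /e'; field; rewrite gt_eqF//; lra.
    rewrite -e'E; apply: weakL1_leD => //; first exact: cmeasurableD.
    apply: weakL1_leD => //.
      by rewrite -(normcN a); exact: weakL1_leZ.
    by have := weakL1_leZ (- 1) wh; rewrite normcN normc1 mul1r.
  by apply: filterS => x /eqP; rewrite subr_eq0 => /eqP.
move=> e0.
have mT (q : 'I_m -> F) : (forall j, Linfc (q j)) -> cmeasurable setT (T q) by exact: (T_meas Tlin).
have [ki|ki] := eqVneq k i.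
  rewrite ki in gL hL pL wSp wSg wSh mSp mSg mSh *.
  have gi : cintegrable leb g by apply/cLp1P; move: gL; rewrite /L1_Linfc eqxx.
  have hi : cintegrable leb h by apply/cLp1P; move: hL; rewrite /L1_Linfc eqxx.
  pose d := e / ((weak_coef i f + 1) * (normc a + 2)).
  have na := normc_ge0 a; have D1 : 0 < weak_coef i f + 1 by rewrite ltr_wpDl.
  have d0 : 0 < d by rewrite divr_gt0// mulr_gt0//; lra.
  have Dd c : 0 <= c -> c <= (normc a + 1) * d -> weak_coef i f * c <= e.
    move=> c0 cd; apply: (@le_trans _ _ ((weak_coef i f + 1) * ((normc a + 2) * d))).
      apply: ler_pM => //; first by rewrite lerDl.
      by apply: le_trans cd _; rewrite ler_wpM2r ?(ltW d0)//; lra.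
    by rewrite le_eqVlt; apply/orP; left; apply/eqP; rewrite /d; field; rewrite !gt_eqF//; lra.
  have [u ui gu] := Linfc_dense gi d0; have [v vi hv] := Linfc_dense hi d0.
  have uvi : Linfc (fun x => a * u x + v x) by apply: LinfcD => //; exact: LinfcZ.
  pose f0 := upd f i (fun=> 0); have f0i : forall j, Linfc (f0 j) := upd0_Linfc fi.
  have uf w : upd f i w = upd f0 i w by rewrite /f0 upd_upd.
  have updii w : upd f i w i = w by rewrite /upd eqxx.
  exists (T (upd f i (fun x => a * u x + v x))), (T (upd f i u)), (T (upd f i v)).
  rewrite !uf; split.
  - by split; apply: mT; exact: upd_Linfc.
  - exact: (T_linear Tlin).
  - have := wSp _ uvi; rewrite upd_upd -!uf weak_coef_upd updii; apply: weakL1_le_mono.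
    apply: Dd; first exact: L1norm_ge0.
    have -> : (fun x => p x - (a * u x + v x)) = (fun x => a * (g x - u x) + (h x - v x)).
      by apply/funext => x; rewrite /p; ring.
    have gui : cintegrable leb (fun x => g x - u x) by apply: cintegrableB => //; exact: Linfc_integrable.
    have hvi : cintegrable leb (fun x => h x - v x) by apply: cintegrableB => //; exact: Linfc_integrable.
    have aE : (\int[leb]_x (normc (a * (g x - u x)))%:E = (normc a * L1norm (fun x => g x - u x))%:E)%E.
      by rewrite integral_normcZ ?L1normE//; case: gui.
    apply: le_trans (L1normD (cintegrableZ a gui) hvi) _; rewrite /L1norm aE -/(L1norm _) mulrDl mul1r lerD//=.
    by rewrite ler_wpM2l.
  - have := wSg _ ui; rewrite upd_upd -!uf weak_coef_upd updii; apply: weakL1_le_mono.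
    apply: Dd; first exact: L1norm_ge0.
    by apply: le_trans gu _; rewrite ler_peMl ?(ltW d0)//; lra.
  - have := wSh _ vi; rewrite upd_upd -!uf weak_coef_upd updii; apply: weakL1_le_mono.
    apply: Dd; first exact: L1norm_ge0.
    by apply: le_trans hv _; rewrite ler_peMl ?(ltW d0)//; lra.
have gi : Linfc g by move: gL; rewrite /L1_Linfc (negbTE ki).
have hi : Linfc h by move: hL; rewrite /L1_Linfc (negbTE ki).
have pi : Linfc p by move: pL; rewrite /L1_Linfc (negbTE ki).
(* The coefficient depends on the entry in slot [k], so a common positive majorant of the three is
   taken. *)
pose M := weak_coef i (upd f k p) + weak_coef i (upd f k g) + weak_coef i (upd f k h) + 1.
have Dp := weak_coef_ge0 i (upd f k p); have Dg := weak_coef_ge0 i (upd f k g).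
have Dh := weak_coef_ge0 i (upd f k h).
have M0 : 0 < M by rewrite /M; lra.
have d0 : 0 < e / M by rewrite divr_gt0.
have [u ui fu] := Linfc_dense fii d0.
have Dd c : 0 <= c -> c <= M -> c * L1norm (fun x => f i x - u x) <= e.
  move=> c0 cM; apply: (@le_trans _ _ (M * (e / M))); first by apply: ler_pM => //; exact: L1norm_ge0.
  by rewrite mulrCA divff ?mulr1// gt_eqF.
pose f1 := upd f i u; have f1i j : Linfc (f1 j).
  by rewrite /f1 /upd; case: eqVneq => [_|ji]; [exact: ui|exact: fi].
have ik : i != k by rewrite eq_sym.
have fk w : upd f k w i = f i by rewrite /upd (negbTE ik).
exists (T (upd f1 k p)), (T (upd f1 k g)), (T (upd f1 k h)); split.
- by split; apply: mT; exact: upd_Linfc.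
- exact: (T_linear Tlin).
- by have := wSp _ ui; rewrite fk -(upd_comm f u p ik); apply: weakL1_le_mono; apply: Dd => //; rewrite /M; lra.
- by have := wSg _ ui; rewrite fk -(upd_comm f u g ik); apply: weakL1_le_mono; apply: Dd => //; rewrite /M; lra.
- by have := wSh _ ui; rewrite fk -(upd_comm f u h ik); apply: weakL1_le_mono; apply: Dd => //; rewrite /M; lra.
Qed.

(** The comparison property at [u = 0], where [T] vanishes almost everywhere by linearity. *)
Lemma extension_weak (i : 'I_m) (f : 'I_m -> F) : (forall j, L1_Linfc i j (f j)) ->
  (weakL1norm leb (S f) <= (weak_type_const * (A + B))%:E * cLnorm leb 1 (f i) *
    \prod_(k < m | k != i) cLnorm leb +oo (f k))%E.
Proof.
move=> fL; have fi j : j != i -> Linfc (f j).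
  by move=> ji; have := fL j; rewrite /L1_Linfc (negbTE ji).
have fii : cintegrable leb (f i) by apply/cLp1P; have := fL i; rewrite /L1_Linfc eqxx.
have [mS wS] := SL fL.
pose f0 := upd f i (fun=> 0); have f0i : forall j, Linfc (f0 j) := upd0_Linfc fi.
have T0 := T_upd0 Tlin i f0i; rewrite /f0 upd_upd in T0.
have w0 : weakL1_le (S f) (weak_coef i f * L1norm (f i)).
  apply: (@weakL1_le_ae _ _ (fun x => S f x - T (upd f i (fun=> 0)) x)) => //.
  - by apply: cmeasurableB => //; exact: (T_meas Tlin f0i).
  - by apply: filterS T0 => x ->; rewrite subr0.
  have := wS _ (@Linfc0 R n); congr (weakL1_le _ (_ * L1norm _)).
  by apply/funext => x; rewrite subr0.
have -> : (\prod_(k < m | k != i) cLnorm leb +oo (f k) =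
    (\prod_(k < m | k != i) fine (cLnorm leb +oo (f k)))%:E)%E.
  by rewrite -prodEFin; apply: eq_bigr => j ji; rewrite cLnormy_fineK//; exact: fi.
rewrite cLnorm1E L1normE// -!EFinM.
apply: ub_ereal_sup => _ [lam /= lam0 <-].
apply: le_trans (w0 _ lam0) _; rewrite lee_fin le_eqVlt; apply/orP; left; apply/eqP.
by rewrite /weak_coef; ring.
Qed.

End endpoint_bounds.

Theorem theorem6p1 (R : realType) (n m : nat) (hn : (0 < n)%N) (hm : (0 < m)%N) :
  exists C : R, 0 < C /\
  forall (K : 'M[R]_(m, n) -> R[i])
         (T : ('I_m -> 'rV[R]_n -> R[i]) -> 'rV[R]_n -> R[i]) (A B : R),
    locally_integrable_off0 K ->
    singular_integral K T ->
    (forall q, Lambda 2%:E q -> bounded_by B q 2%:E T) ->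
    coord_Hormander K A ->
    (forall f : 'I_m -> 'rV[R]_n -> R[i], (forall i, Linfc (f i)) ->
      (BMOnorm (T f) <=
        (C * (A + B))%:E *
        \prod_(i < m) cLnorm (lebesgue_mx R 1 n) +oo (f i))%E) /\
    (exists S : ('I_m -> 'rV[R]_n -> R[i]) -> 'rV[R]_n -> R[i],
      (forall f : 'I_m -> 'rV[R]_n -> R[i], (forall i, Linfc (f i)) ->
        S f = T f %[ae lebesgue_mx R 1 n]) /\
      (forall i : 'I_m,
        multilinear_operator (L1_Linfc i) S /\
        forall f : 'I_m -> 'rV[R]_n -> R[i],
          (forall j, L1_Linfc i j (f j)) ->
          (weakL1norm (lebesgue_mx R 1 n) (S f) <=
            (C * (A + B))%:E * cLnorm (lebesgue_mx R 1 n) 1 (f i) *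
            \prod_(k < m | k != i) cLnorm (lebesgue_mx R 1 n) +oo (f k))%E)).
Proof.
(* One constant for both estimates; the 1 makes it positive. *)
pose C := bmo_const R n m + weak_type_const R n + 1.
have Cb := bmo_const_ge0 R n m; have Cw := weak_type_const_ge0 R n.
exists C; split; first by rewrite /C; lra.
move=> K T A B Kloc KT Tbd Khor.
have B0 : 0 <= B := B_ge0 Tbd hm; have A0 : 0 <= A := A_ge0 Khor hm.
have AB : 0 <= A + B by rewrite addr_ge0.
have pr0 (P : pred 'I_m) f : (0 <= \prod_(k < m | P k) cLnorm (lebesgue_mx R 1 n) +oo (f k : 'rV[R]_n -> R[i]))%E.
  by apply: prode_ge0 => k _; rewrite /cLnorm Lnorm_ge0.
split => [f fi|].
  apply: le_trans (bmo_bound Kloc KT Tbd Khor hn hm fi) _.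
  by apply: lee_wpmul2r => //; rewrite lee_fin ler_wpM2r// /C; lra.
have [S [ST SL]] := extension_exists Kloc KT Tbd Khor hn hm.
exists S; split => [f fi|i]; first by rewrite ST//; exact: nearW.
split; last first.
  move=> f fL; apply: le_trans (extension_weak KT SL fL) _.
  apply: lee_wpmul2r => //; apply: lee_wpmul2r; first by rewrite /cLnorm Lnorm_ge0.
  by rewrite lee_fin ler_wpM2r// /C; lra.
split=> [f fL|k f a g h fL gL hL]; first by case: (SL i f fL).
rewrite !dfwith_upd.
apply: filterS (extension_linear KT Tbd Khor hm SL a fL gL hL) => x h' _.
exact: h'.
Qed.
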